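(* For positive integers $n$ define $$f(n):=\begin{cases}\left\lfloor\frac14(n-1)^2\right\rfloor & \text{if } n \text{ is even or } n=1,3,\\[3pt] \frac14(n-1)^2+1 & \text{if } n\text{ is odd, } n\ne1,3.\end{cases}$$ Then $\mathrm{ex}(n,\mathbf A\mathbf C)=f(n)$. Moreover, for $n\ge4$ the only extremal families (triple systems on $n$ vertices containing neither $\mathbf A$ nor $\mathbf C$ and having $f(n)$ triples) are the members of the class $\mathbf F_{(n)}$.
   Context: A triple system on a finite vertex set $V$, $|V|=n$, is a family $\mathcal F$ of distinct $3$-element subsets (triples) of $V$. We write $123$ or $12v$ for $\{1,2,3\}$, $\{1,2,v\}$ etc. $\mathbf A=\{124,135,236\}$ (on 6 vertices) and $\mathbf C=\{124,134,234\}$ (on 4 vertices). A triple system contains a configuration if some of its triples form a system isomorphic to it (not necessarily induced). $\mathrm{ex}(n,X_1\dots X_k)$ denotes the maximum number of triples in a triple system on $n$ vertices that contains none of $X_1,\dots,X_k$. Extensions: for a triple system $\mathcal F$ on the vertex set $V$ and new vertices $1,2,3,4\notin V$, its $2$-extension is the triple system $\mathcal F^{+2}:=\mathcal F\cup\{12v: v\in V\}$ on $V\cup\{1,2\}$, and its $4$-extension is the triple system $\mathcal F^{+4}:=\mathcal F\cup\{12v: v\in V\}\cup\{34v: v\in V\}\cup\{123,234\}$ on $V\cup\{1,2,3,4\}$. $\mathcal F^*_m$ is the triple system on an $m$-element set $V$ obtained by fixing $x\in V$ and a complete bipartite graph on $V\setminus\{x\}$ with parts of sizes $\lfloor\frac{m-1}{2}\rfloor$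 and $\lceil\frac{m-1}{2}\rceil$, and taking all triples consisting of $x$ and the two ends of an edge of this bipartite graph (so $\mathcal F^*_2$ is the empty triple system on 2 vertices). A five-ring is a triple system on 5 vertices isomorphic to $\{123,234,345,451,512\}$. The class $\mathbf F_{(n)}$ (up to isomorphism): for even $n\ge2$, $\mathbf F_{(n)}$ consists of the $n$-vertex triple systems that can be obtained by an arbitrary (possibly empty) sequence of $2$-extensions and $4$-extensions starting from a system of the form $\mathcal F^*_{n-2k}$ for some $0\le k\le\frac{n-2}{2}$; for odd $n\ge5$, $\mathbf F_{(n)}$ consists of the $n$-vertex triple systems obtained from a five-ring by an arbitrary (possibly empty) sequence of $2$- and $4$-extensions. *)

(* Defs.v *)
From mathcomp Require Import all_boot.

Set Implicit Arguments.
Unset Strict Implicit.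
Unset Printing Implicit Defensive.

Definition triple_system (V : finType) (F : {set {set V}}) : bool :=
  [forall e in F, #|e| == 3].

Definition relabel (V W : finType) (h : V -> W) (F : {set {set V}}) :
  {set {set W}} := [set h @: (e : {set V}) | e in F].

Definition isomorphic (V W : finType) (F : {set {set V}}) (G : {set {set W}}) :
  Prop := exists h : V -> W, bijective h /\ G = relabel h F.

Record config := Config {
  nvertices : nat;
  triples : {set {set 'I_nvertices}}
}.

(* The vertex named i, for 1 <= i <= k.+1; 'I_k.+1 itself counts from 0. *)
Definition vtx (k i : nat) : 'I_k.+1 := inord i.-1.

Definition triple (k a b c : nat) : {set 'I_k.+1} :=
  [set vtx k a; vtx k b; vtx k c].

Definition confA : config :=
  @Config 6 [set triple 5 1 2 4; triple 5 1 3 5; triple 5 2 3 6].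

Definition confC : config :=
  @Config 4 [set triple 3 1 2 4; triple 3 1 3 4; triple 3 2 3 4].

Definition five_ring : {set {set 'I_5}} :=
  [set triple 4 1 2 3; triple 4 2 3 4; triple 4 3 4 5; triple 4 4 5 1;
       triple 4 5 1 2].

(* The copy need not be induced. Mapping all vertices of X injectively is the
   same as finding triples isomorphic to X when X has no isolated vertices, as
   is the case for confA and confC. *)
Definition contains (V : finType) (F : {set {set V}}) (X : config) : bool :=
  [exists h : {ffun 'I_(nvertices X) -> V},
    injectiveb h && (relabel h (triples X) \subset F)].

Definition avoids (V : finType) (F : {set {set V}}) (Xs : seq config) : bool :=
  all (fun X => ~~ contains F X) Xs.

Definition exnum (n : nat) (Xs : seq config) : nat :=
  \max_(F : {set {set 'I_n}} | triple_system F && avoids F Xs) #|F|.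

(* In both extensions the old vertices are the inl v and the new ones the
   inr (vtx _ i). *)
Definition ext2 (V : finType) (F : {set {set V}}) : {set {set V + 'I_2}} :=
  let new i : V + 'I_2 := inr (vtx 1 i) in
  relabel inl F :|: [set [set new 1; new 2; inl v] | v : V].

Definition ext4 (V : finType) (F : {set {set V}}) : {set {set V + 'I_4}} :=
  let new i : V + 'I_4 := inr (vtx 3 i) in
  relabel inl F
    :|: [set [set new 1; new 2; inl v] | v : V]
    :|: [set [set new 3; new 4; inl v] | v : V]
    :|: [set [set new 1; new 2; new 3]; [set new 2; new 3; new 4]].

(* The m vertices (m >= 1) are the apex None and the two parts of the complete
   bipartite graph, of sizes floor ((m-1)/2) and ceil ((m-1)/2). *)
Definition Fstar (m : nat) :
  {set {set option ('I_(m.-1)./2 + 'I_(uphalf m.-1))}} :=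
  [set [set None; Some (inl a); Some (inr b)]
    | a : 'I_(m.-1)./2, b : 'I_(uphalf m.-1)].

Inductive obtained_from (V0 : finType) (F0 : {set {set V0}}) :
  forall V : finType, {set {set V}} -> Prop :=
| obtained_start (V : finType) (F : {set {set V}}) :
    isomorphic F0 F -> obtained_from F0 F
| obtained_ext2 (V W : finType) (F : {set {set V}}) (G : {set {set W}}) :
    obtained_from F0 F -> isomorphic (ext2 F) G -> obtained_from F0 G
| obtained_ext4 (V W : finType) (F : {set {set V}}) (G : {set {set W}}) :
    obtained_from F0 F -> isomorphic (ext4 F) G -> obtained_from F0 G.

Definition Fclass (n : nat) (V : finType) (F : {set {set V}}) : Prop :=
  #|V| = n /\
  if odd n then 5 <= n /\ obtained_from five_ring F
  else 2 <= n /\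
       exists2 k, k <= (n - 2) %/ 2 & obtained_from (Fstar (n - 2 * k)) F.

(* For odd n the division by 4 is exact. *)
Definition fAC (n : nat) : nat :=
  if [|| ~~ odd n, n == 1 | n == 3] then (n - 1) ^ 2 %/ 4
  else (n - 1) ^ 2 %/ 4 + 1.

(* Main.v *)
Require Import Defs.
From mathcomp Require Import all_boot zify.

(** A family without A and C is studied through its pairs of vertices: a pair
    is thin if it lies in one triple and thick if it lies in several. Excluding
    A and C makes the graph of thick pairs triangle-free
    ([thick_triangle_free]), so every triple has a thin pair. Let each triple
    share 6 units equally among its thin pairs ([weight]). The sum of the
    weights over all ordered pairs is then 12 times the number of triples
    ([weight_sum]), and the bound follows if a vertex v and a pair of vertices
    a, b of a suitable pairing of the vertices carry at most 6 units on va and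
    vb together.

    For a thick pair ab this holds with one exception: a case analysis of how v
    sees a and b ([thick_viewP]) yields at most 6, unless v is the vertex
    opposite to the side ab of a five-ring. It also holds for star pairs, two
    vertices in a triple with a vertex that is thick to both
    ([star_pair_view]). One therefore takes a maximum matching m of thick pairs
    and a maximum matching n of star pairs among the remaining vertices; the
    weight inside the leftover set is controlled by an exchange argument
    against the maximality of m ([augment], [outer_le]). Adding up gives
    [weight_bound], provided that five-rings are compensated.

    A five-ring is closed: a triple with two vertices in it lies inside it. An
    outside vertex seen by two or more ring vertices has the same apex for all
    of them, hence is paired. If at least four ring vertices see unpaired
    vertices, these avoid enough blocks to compensate ([four_active_slack]). If
    at most three do, deleting the others and induction give a strict
    inequality ([ring_few_active]), except when all outside vertices are
    paired, where the weights can be counted directly ([ring_full]).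

    In the case of equality every local bound is sharp, for every choice of m
    and n. This leads to a set of blocks such that any vertex of one block
    carries weight exactly 6 on any other, and all of which form a triple with
    every vertex outside the set ([dominating_blocks]), or to a vertex in all
    triples, or to a spanning five-ring ([extremal_structure]). Of two blocks
    one dominates the other, or they are linked by consecutive triples
    ([block_rel]). A block with the most apexes is thus the new pair of a
    2-extension, or half of the new quadruple of a 4-extension ([top_block]).
    Removing the new vertices leaves an extremal family, and induction applies.
    If a vertex lies in all triples, its link is a triangle-free graph with the
    maximum number of edges, and the equality case of Mantel's theorem
    identifies it ([star_isomorphic]). Conversely the base systems are extremal
    and both extensions preserve this ([obtained_extremal]). *)

Set Implicit Arguments.
Unset Strict Implicit.
Unset Printing Implicit Defensive.

(** * Triple systems as ternary relations *)

(** In both configurations three triples sit on the sides of a triangle a b c: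
    in C the sides have a common apex, in A they have distinct apexes outside
    the triangle. The inequalities in the last clause, with [tripleI], make
    all six vertices distinct. *)
Record acfree (V : finType) (T : V -> V -> V -> bool) : Prop := ACFree {
  tripleCl : forall a b c, T a b c = T b a c;
  tripleCr : forall a b c, T a b c = T a c b;
  tripleI : forall a b, T a a b = false;
  C_free : forall a b c x, T a b x -> T a c x -> T b c x -> False;
  A_free : forall a b c x y z, T a b x -> T a c y -> T b c z ->
    x != c -> y != b -> z != a -> x != y -> x != z -> y != z -> False }.

Section Codegrees.
Variables (V : finType) (T : V -> V -> V -> bool).
Definition apexes a b := [set c | T a b c].
Definition thick a b := 1 < #|apexes a b|.
Definition thin a b := #|apexes a b| == 1.
(** Each triple spends 6 units on its thin pairs in equal shares, and a thin
    pair receives the share of its only triple. *)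
Definition weight a b :=
  \sum_c T a b c * (thin a b * (6 %/ (thin a b + thin a c + thin b c))).
Definition five_ring_on v y a b z :=
  [/\ T v y a, T y a b, T a b z, T b z v & T z v y].
End Codegrees.

Lemma triple_neq12 (V : finType) (T : V -> V -> V -> bool) (acT : acfree T) a b :
  T a a b -> False.
Proof. by rewrite (tripleI acT). Qed.
Lemma triple_neq23 (V : finType) (T : V -> V -> V -> bool) (acT : acfree T) a b :
  T a b b -> False.
Proof. by rewrite (tripleCl acT) (tripleCr acT) (tripleI acT). Qed.
Lemma triple_neq13 (V : finType) (T : V -> V -> V -> bool) (acT : acfree T) a b :
  T a b a -> False.
Proof. by rewrite (tripleCr acT) (tripleI acT). Qed.

Lemma triple_ne (V : finType) (T : V -> V -> V -> bool) (acT : acfree T) a b c :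
  T a b c -> [/\ a != b, a != c & b != c].
Proof.
move=> h; split; apply/eqP => e; move: h; rewrite e => h.
- by case: (triple_neq12 acT h).
- by case: (triple_neq13 acT h).
- by case: (triple_neq23 acT h).
Qed.

(** [tsy] proves a triple known up to the order of its vertices, [irr] refutes
    a degenerate one and [neq] separates two vertices of a triple. [Cfree] and
    [Afree] derive a contradiction from a copy of C or A with the given
    vertices. *)
Ltac tsy := match goal with acT : acfree ?T |- is_true (?T _ _ _) =>
  first [ assumption
   | rewrite (tripleCl acT); assumption
   | rewrite (tripleCr acT); assumption
   | rewrite (tripleCl acT) (tripleCr acT); assumption
   | rewrite (tripleCr acT) (tripleCl acT); assumption
   | rewrite (tripleCl acT) (tripleCr acT) (tripleCl acT); assumption ] end.
Ltac irr := match goal with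
  | acT : acfree ?T, H : is_true (?T ?a ?a _) |- _ => case: (triple_neq12 acT H)
  | acT : acfree ?T, H : is_true (?T _ ?a ?a) |- _ => case: (triple_neq23 acT H)
  | acT : acfree ?T, H : is_true (?T ?a _ ?a) |- _ => case: (triple_neq13 acT H)
  | H : is_true (?a != ?a) |- _ => by rewrite eqxx in H
  | H : ?a <> ?a |- _ => by case: (H erefl)
  end.
Ltac ne_step := match goal with
  | acT : acfree ?T, H : is_true (?T ?x ?y _) |- is_true (?x != ?y) =>
      by case: (triple_ne acT H)
  | acT : acfree ?T, H : is_true (?T ?x _ ?y) |- is_true (?x != ?y) =>
      by case: (triple_ne acT H)
  | acT : acfree ?T, H : is_true (?T _ ?x ?y) |- is_true (?x != ?y) =>
      by case: (triple_ne acT H)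
  end.
Ltac neq := first [ assumption | rewrite eq_sym; assumption
   | ne_step | rewrite eq_sym; ne_step
   | (apply/eqP => ?; subst; irr) ].
Ltac Cfree a b c x := match goal with acT : acfree _ |- _ =>
  solve [exfalso; apply: (C_free acT (a:=a) (b:=b) (c:=c) (x:=x)); tsy] end.
Ltac Afree a b c x y z := match goal with acT : acfree _ |- _ =>
  exfalso; apply: (A_free acT (a:=a) (b:=b) (c:=c) (x:=x) (y:=y) (z:=z));
  [tsy | tsy | tsy | try neq ..] end.

Section Local.
Variables (V : finType) (T : V -> V -> V -> bool).
Hypothesis acT : acfree T.
Implicit Types a b c d v x y z t : V.

Lemma apexesC a b : apexes T a b = apexes T b a.
Proof. by apply/setP => c; rewrite !inE (tripleCl acT). Qed.
Lemma thickC a b : thick T a b = thick T b a.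
Proof. by rewrite /thick apexesC. Qed.
Lemma thinC a b : thin T a b = thin T b a.
Proof. by rewrite /thin apexesC. Qed.

Lemma thick_neq a b : thick T a b -> a != b.
Proof.
move=> /card_gt1P[x [y [+ _ _]]]; rewrite inE => h; neq.
Qed.

Lemma thick_other x a b : thick T a b -> exists2 y, T a b y & y != x.
Proof.
move=> /card_gt1P[y [z [yD zD yz]]]; rewrite !inE in yD zD.
have [e|] := eqVneq y x; last by exists y.
by exists z => //; rewrite -e eq_sym.
Qed.

Lemma thick_two a b x y : T a b x -> T a b y -> x != y -> thick T a b.
Proof. by move=> hx hy xy; apply/card_gt1P; exists x, y; split; rewrite ?inE. Qed.

Lemma thick_nthin a b : thick T a b -> thin T a b = false.
Proof. by rewrite /thick /thin; case: eqP => // ->. Qed.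

Lemma nthick_thin a b x : T a b x -> ~~ thick T a b -> thin T a b.
Proof.
move=> h; rewrite /thick /thin -leqNgt => le1; rewrite eqn_leq le1.
by apply/card_gt0P; exists x; rewrite inE.
Qed.

Lemma nthin_thick a b x : T a b x -> ~~ thin T a b -> thick T a b.
Proof. by move=> h; apply: contraR => /(nthick_thin h). Qed.

Lemma thin_eq a b x y : thin T a b -> T a b x -> T a b y -> x = y.
Proof.
move=> + hx hy; apply: contraTeq => xy.
by rewrite thick_nthin //; apply: thick_two hx hy xy.
Qed.

Lemma thin_apex a b : thin T a b -> exists c, T a b c.
Proof.
rewrite /thin => /eqP e; have /card_gt0P[c]: 0 < #|apexes T a b| by rewrite e.
by rewrite inE; exists c.
Qed.

(** Distinct apexes of ab, ac and bc would give A. Since ab and ac have two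
    apexes each, such a choice fails only if all these apexes collapse onto
    two vertices, and then C appears. *)
Lemma thick_star_apex a b c z : thick T a b -> thick T a c -> T b c z -> z = a.
Proof.
move=> ab ac bcz; apply/eqP/negP => /negP za.
have [abc|nabc] := boolP (T a b c).
  have [x abx xc] := thick_other c ab.
  have [y acy yb] := thick_other b ac.
  have [e|xy] := eqVneq x y; first by subst; Cfree b c y a.
  have [e|xz] := eqVneq x z; first by subst; Cfree a c z b.
  have [e|yz] := eqVneq y z; first by subst; Cfree a b z c.
  by Afree a b c x y z.
have nc x : T a b x -> x != c by move=> h; apply/eqP => e; subst; rewrite h in nabc.
have nb y : T a c y -> y != b.
  by move=> h; apply/eqP => e; subst; case/negP: nabc; tsy.
have [x abx xz] := thick_other z ab.
have [y acy yz] := thick_other z ac.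
have [e|xy] := eqVneq x y; last by Afree a b c x y z; auto.
subst y.
have [x' abx' xx'] := thick_other x ab.
have [e|xz'] := eqVneq x' z; last by Afree a b c x' x z; auto.
subst x'.
have [y' acy' yy'] := thick_other x ac.
have [e|yz'] := eqVneq y' z; last by Afree a b c x y' z; auto.
by subst; Cfree a b c z.
Qed.

Lemma thick_triangle_free a b c :
  thick T a b -> thick T a c -> thick T b c -> False.
Proof.
move=> ab ac bc; have [z bcz /eqP za] := thick_other a bc.
by apply: za; apply: thick_star_apex ab ac bcz.
Qed.

(** The two triples at v and a third triple on ab form A unless the apexes y
    and z coincide or are the only apexes of ab. *)
Lemma thick_pair_view a b v y z : thick T a b -> ~~ T a b v ->
  T v a y -> T v b z ->
  [/\ thin T v a, thin T v b &
   (y = z /\ [/\ thin T a y, thin T b y & thick T v y]) \/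
   [/\ y != z, T a b y, T a b z & forall t, T a b t -> (t == y) || (t == z)]].
Proof.
have viewl a' b' v' y' z' : thick T a' b' -> ~~ T a' b' v' ->
    T v' a' y' -> T v' b' z' -> thin T v' a'.
  move=> ab nv va vb; apply: nthick_thin va _; apply/negP => tva.
  have e : z' = a'.
    by apply: (@thick_star_apex a' v' b') => //; rewrite thickC.
  by subst; case/negP: nv; tsy.
move=> ab nv va vb.
have nv' : ~~ T b a v by rewrite (tripleCl acT).
have ba : thick T b a by rewrite thickC.
have ta := viewl _ _ _ _ _ ab nv va vb.
have tb := viewl _ _ _ _ _ ba nv' vb va.
split=> //; have yb : y != b by apply/eqP => e; subst; case/negP: nv; tsy.
have za : z != a by apply/eqP => e; subst; case/negP: nv; tsy.
have [e|yz] := eqVneq y z; [left|right].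
  subst z; split=> //.
  have nvy : ~~ T a b y by apply/negP => h; Cfree a b v y.
  have nvy' : ~~ T b a y by rewrite (tripleCl acT).
  split; last by (apply: (@thick_two v y a b); [tsy|tsy|exact: thick_neq]).
    by rewrite thinC; apply: (@viewl a b y v v) => //; tsy.
  by rewrite thinC; apply: (@viewl b a y v v) => //; tsy.
have only t : T a b t -> (t == y) || (t == z).
  move=> abt; apply/norP => -[ty tz].
  have tv : t != v by apply/eqP => e; subst; case/negP: nv; tsy.
  by Afree a b v t y z.
have [t abt ty] := thick_other y ab.
have [s abs sz] := thick_other z ab.
split=> //.
  by have /orP[/eqP<-|h] := only s abs; last by rewrite h in sz.
by have /orP[h|/eqP<-] := only t abt; first by rewrite h in ty.
Qed.

Lemma ring_rot v y a b z :
  five_ring_on T v y a b z -> five_ring_on T y a b z v.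
Proof. by case=> *; split; tsy. Qed.

Lemma ring_thick v y a b z : five_ring_on T v y a b z -> thick T v y.
Proof. by case=> *; apply: (@thick_two _ _ a z); [tsy|tsy|neq]. Qed.

Lemma ring_diag v y a b z t : five_ring_on T v y a b z -> T v a t -> t = y.
Proof.
move=> h; apply: thick_star_apex.
  by rewrite thickC; apply: ring_thick h.
by apply: ring_thick (ring_rot h).
Qed.

Lemma ring_side v y a b z t :
  five_ring_on T v y a b z -> T v y t -> (t == a) || (t == z).
Proof.
move=> h vyt; apply/norP => -[ta tz].
have h2 := ring_rot (ring_rot (ring_rot h)).
case: (h) => h3 h4 h5 h6 h7.
have tb : t != b.
  apply/eqP => e; subst.
  have vby : T v b y by tsy.
  have hh : five_ring_on T b z v y a by case: h => *; split; tsy.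
  have bvy : T b v y by tsy.
  by have e := ring_diag hh bvy; subst; irr.
by Afree v y b t z a.
Qed.

(** A second apex of vy other than z would give A on the triangle v, y, b. *)
Lemma thick_pair_ring a b v y z : y != z -> T v a y -> T v b z ->
  T a b y -> T a b z -> thin T v a -> thin T v b -> thick T v y ->
  five_ring_on T v y a b z.
Proof.
move=> yz vay vbz aby abz tva tvb vy.
have [t vyt ta] := thick_other a vy.
have [e|tz] := eqVneq t z; first by subst; split; tsy.
have tb : t != b.
  apply/eqP => e; subst; have h : T v b y by tsy.
  by have e := thin_eq tvb h vbz; subst; irr.
by Afree v y b t z a.
Qed.

Lemma weightC a b : weight T a b = weight T b a.
Proof.
apply: eq_bigr => c _; rewrite (tripleCl acT) (thinC b a).
by rewrite -!addnA (addnC (thin T a c)).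
Qed.

Lemma weight_nthin a b : ~~ thin T a b -> weight T a b = 0.
Proof. by move=> /negbTE h; rewrite /weight h big1 // => c _; rewrite mul0n muln0. Qed.

Lemma weight_thick a b : thick T a b -> weight T a b = 0.
Proof. by move=> h; rewrite weight_nthin // thick_nthin. Qed.

Lemma weight_thin a b c : thin T a b -> T a b c ->
  weight T a b = 6 %/ (1 + thin T a c + thin T b c).
Proof.
move=> h abc; rewrite /weight (bigD1 c) //= abc h !mul1n big1 ?addn0 // => d dc.
case abd: (T a b d) => //; move: dc.
by rewrite (thin_eq h abd abc) eqxx.
Qed.

Lemma weight_le6 a b : weight T a b <= 6.
Proof.
have [h|/weight_nthin -> //] := boolP (thin T a b).
have [c abc] := thin_apex h; rewrite (weight_thin h abc).
by do 2!case: (thin T _ c).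
Qed.

Lemma weight_gt0 a b : 0 < weight T a b -> thin T a b.
Proof. by apply: contraTT => /weight_nthin ->. Qed.

Lemma thin_weight_gt0 a b : thin T a b -> 0 < weight T a b.
Proof.
move=> h; have [c abc] := thin_apex h; rewrite (weight_thin h abc).
by do 2!case: (thin T _ c).
Qed.

Lemma weight_xx a : weight T a a = 0.
Proof. by apply: big1 => c _; rewrite (tripleI acT). Qed.

End Local.

(** * How a vertex sees a thick pair *)

(** The parameters wa and wb stand for the weights of va and vb; their sum
    exceeds 6 only in the last case. *)
Variant view_spec (V : finType) (T : V -> V -> V -> bool) (a b v : V) (wa wb : nat) : Prop :=
| ViewApex of T a b v & wa + wb = 6
| ViewLeft of ~~ T a b v & ~~ thin T v b & wb = 0 & wa <= 6
| ViewRight of ~~ T a b v & ~~ thin T v a & wa = 0 & wb <= 6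
| ViewTwin y of ~~ T a b v & T v a y & T v b y & thick T v y & thin T v a & thin T v b
    & thin T a y & thin T b y & wa = 3 & wb = 3
| ViewPath y z of ~~ T a b v & y != z & T v a y & T v b z & T a b y & T a b z &
    (forall t, T a b t -> (t == y) || (t == z)) & thin T v a & thin T v b
    & thin T v y & thin T v z & wa = 3 & wb = 3
| ViewRing y z of ~~ T a b v & five_ring_on T v y a b z & wa = 6 & wb = 6.

Section Local2.
Variables (V : finType) (T : V -> V -> V -> bool).
Hypothesis acT : acfree T.
Notation w := (weight T).
Implicit Types a b c d v x y z t : V.

Lemma thick_viewP a b v : thick T a b -> view_spec T a b v (w v a) (w v b).
Proof.
move=> ab; have [abv|nabv] := boolP (T a b v).
  apply: ViewApex => //.
  have hab : thin T a b = false by apply: thick_nthin.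
  have [va|nva] := boolP (thin T v a).
    rewrite (weight_thin va (c := b)); last by tsy.
    rewrite hab addn0; have [vb|nvb] := boolP (thin T v b); last by rewrite (weight_nthin nvb).
    rewrite (weight_thin vb (c := a)); last by tsy.
    by rewrite (thinC acT b) hab va.
  rewrite (weight_nthin nva); have tva : thick T v a.
    by apply: (nthin_thick (x := b)) nva; tsy.
  have vb : thin T v b.
    have h : T v b a by tsy.
    apply: contraT => /(nthin_thick h) tvb.
    by case: (thick_triangle_free acT tva tvb ab).
  rewrite (weight_thin vb (c := a)); last by tsy.
  by rewrite (thinC acT b) hab (negbTE nva).
have [vb|nvb] := boolP (thin T v b); last first.
  by apply: ViewLeft => //; rewrite ?weight_le6 ?weight_nthin.
have [va|nva] := boolP (thin T v a); last first.
  by apply: ViewRight => //; rewrite ?weight_le6 ?weight_nthin.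
have [y vay] := thin_apex va; have [z vbz] := thin_apex vb.
have [_ _] := thick_pair_view acT ab nabv vay vbz.
case=> [[e [ay by_ vy]]|[yz aby abz only]].
  subst z; apply: (ViewTwin (y := y)) => //.
    by rewrite (weight_thin va vay) ay (thick_nthin vy).
  by rewrite (weight_thin vb vbz) by_ (thick_nthin vy).
have [vy|nvy] := boolP (thick T v y).
  have r := thick_pair_ring acT yz vay vbz aby abz va vb vy.
  apply: (ViewRing (y := y) (z := z)) => //.
    rewrite (weight_thin va vay) (thick_nthin vy).
    by rewrite (thinC acT) (thick_nthin (ring_thick acT (ring_rot r))).
  have vz := ring_thick acT (ring_rot (ring_rot (ring_rot (ring_rot r)))).
  have bz := ring_thick acT (ring_rot (ring_rot (ring_rot r))).
  by rewrite (weight_thin vb vbz) (thinC acT v z) (thick_nthin vz) (thick_nthin bz).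
have [vz|nvz] := boolP (thick T v z).
  have zy : z != y by rewrite eq_sym.
  have r : five_ring_on T v z b a y.
    by apply: (thick_pair_ring acT zy) => //; tsy.
  case/negP: nvy; rewrite (thickC acT).
  by have := ring_thick acT (ring_rot (ring_rot (ring_rot (ring_rot r)))); rewrite (thickC acT).
have tvy : thin T v y by apply: (nthick_thin (x := a)) nvy; tsy.
have tvz : thin T v z by apply: (nthick_thin (x := b)) nvz; tsy.
apply: (ViewPath (y := y) (z := z)) => //.
  rewrite (weight_thin va vay) tvy (thick_nthin (a := a)) //.
  apply: (@thick_two _ T a y b v); [tsy|tsy|].
  by apply/eqP => e; subst; irr.
rewrite (weight_thin vb vbz) tvz (thick_nthin (a := b)) //.
apply: (@thick_two _ T b z a v); [tsy|tsy|].
by apply/eqP => e; subst; irr.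
Qed.

Lemma thin_star x a b : thick T x a -> thick T x b -> T x a b ->
  thin T a b /\ w a b = 6.
Proof.
move=> xa xb xab; have ab : thin T a b.
  apply: (nthick_thin (x := x)); first by tsy.
  by apply/negP => ab; apply: (thick_triangle_free acT xa xb ab).
split=> //; rewrite (weight_thin ab (c := x)); last by tsy.
by rewrite !(thinC acT _ x) !(thick_nthin xa) (thick_nthin xb).
Qed.

(** If the apexes of va and vb differ and neither is x, they form A with x. If
    one of them is x, the view of a thick pair at x by v determines the
    weights. If they coincide, their pair with v is thick, while their pairs
    with a and b are thin. *)
Lemma star_pair_view x a b v : thick T x a -> thick T x b -> T x a b ->
  v != x -> v != a -> v != b -> 0 < w v a -> 0 < w v b ->
  w v a = 3 /\ w v b = 3.
Proof.
have side a' b' p q : thick T x a' -> thick T x b' -> T x a' b' -> v != x ->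
    thin T v a' -> thin T v b' -> T v a' p -> T v b' q -> p = x ->
    w v a' = 3 /\ w v b' = 3.
  move=> xa xb xab vx va vb vap vbq e; subst p.
  have nxbv : ~~ T x b' v by apply/negP => h; Cfree a' b' v x.
  have vxa : T v x a' by tsy.
  have [tvx _] := thick_pair_view acT xb nxbv vxa vbq.
  case=> [[e _]|[aq xba xbq only]].
    subst q; have [tab _] := thin_star xa xb xab.
    have h1 : T a' b' v by tsy.
    have h2 : T a' b' x by tsy.
    by move: vx; rewrite (thin_eq tab h1 h2) eqxx.
  have := thick_viewP v xb; rewrite (_ : w v x = 3); last first.
    rewrite (weight_thin tvx vxa) va.
    by rewrite (thick_nthin xa).
  rewrite (weight_thin va vap) tvx (thinC acT a') (thick_nthin xa).
  by case=> [|_|_|||]; rewrite ?(negbTE nxbv) ?vb ?tvx.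
move=> xa xb xab vx va vb /weight_gt0 tva /weight_gt0 tvb.
have [p vap] := thin_apex tva; have [q vbq] := thin_apex tvb.
have [px|px] := eqVneq p x; first exact: (side a b p q).
have [qx|qx] := eqVneq q x.
  have [] // := side b a q p xb xa _ vx tvb tva vbq vap qx; first by tsy.
have [tab _] := thin_star xa xb xab.
have xab' : T a b x by tsy.
have pb : p != b.
  apply/eqP => e; subst; have h : T a b v by tsy.
  by move: vx; rewrite (thin_eq tab h xab') eqxx.
have qa : q != a.
  apply/eqP => e; subst; have h : T a b v by tsy.
  by move: vx; rewrite (thin_eq tab h xab') eqxx.
have [e|pq] := eqVneq p q; last first.
  by Afree a b v x p q.
subst q.
have vp : thick T v p by apply: (@thick_two _ T v p a b); [tsy|tsy|neq].
have thp a' b' : thick T x a' -> thick T x b' -> T x a' b' -> v != x ->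
    p != x -> thin T v a' -> thin T v b' -> T v a' p -> T v b' p -> 
    p != b' -> thin T a' b' -> v != b' -> thin T a' p.
  move=> xa' xb' xab1 _ _ tva' tvb' vap' vbp' pb' tab' vb1.
  have h1 : T a' b' x by tsy.
  apply: (nthick_thin (x := v)); first by tsy.
  apply/negP => ap; have [t apt tv] := thick_other v ap.
  have [e|tx] := eqVneq t x; last first.
    have tb : t != b'.
      apply/eqP => e; subst; have h : T a' b' p by tsy.
      by move: px; rewrite (thin_eq tab' h h1) eqxx.
    by Afree a' b' p x t v.
  subst t.
  have nxbp : ~~ T x b' p by apply/negP => h; Cfree a' b' p x.
  have h2 : T p x a' by tsy.
  have h3 : T p b' v by tsy.
  have [_ _] := thick_pair_view acT xb' nxbp h2 h3.
  case=> [[e _]|[_ _ xbv _]]; first by subst; irr.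
  have h4 : T v b' x by tsy.
  by move: px; rewrite (thin_eq tvb' vbp' h4) eqxx.
have tap := thp a b xa xb xab vx px tva tvb vap vbq pb tab vb.
have tbp : thin T b p.
  by apply: (thp b a) => //; rewrite ?(thinC acT b a) //; tsy.
by rewrite (weight_thin tva vap) (weight_thin tvb vbq) tap tbp (thick_nthin vp).
Qed.

Lemma star_pair_view_le x a b v : thick T x a -> thick T x b -> T x a b ->
  v != x -> v != a -> v != b -> w v a + w v b <= 6.
Proof.
move=> xa xb xab vx va vb.
have [->|ga] := posnP (w v a); first exact: weight_le6.
have [->|gb] := posnP (w v b); first by rewrite addn0 weight_le6.
by have [-> ->] := star_pair_view xa xb xab vx va vb ga gb.
Qed.
End Local2.

(** * Double counting the weights *)

Definition ntriples (V : finType) (T : V -> V -> V -> bool) :=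
  \sum_a \sum_b \sum_c T a b c.

(** Every triple has a thin pair, because thick pairs form no triangle, and so
    it spends all its 6 units. Both sides count a triple in all orders of its
    vertices. *)
Lemma weight_sum (V : finType) (T : V -> V -> V -> bool) : acfree T ->
  \sum_a \sum_b weight T a b = 2 * ntriples T.
Proof.
move=> acT; pose o a b := nat_of_bool (thin T a b).
pose k a b c := 6 %/ (o a b + o a c + o b c).
have oC a b : o a b = o b a by rewrite /o (thinC acT).
pose S1 := \sum_a \sum_b \sum_c T a b c * (o a b * k a b c).
have S1E : \sum_a \sum_b weight T a b = S1 by [].
have S2E : \sum_a \sum_b \sum_c T a b c * (o a c * k a b c) = S1.
  apply: eq_bigr => a _; rewrite exchange_big /=; apply: eq_bigr => b _.
  apply: eq_bigr => c _; rewrite (tripleCr acT) /k (oC c b).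
  by rewrite (addnC (o a c)).
have S3E : \sum_a \sum_b \sum_c T a b c * (o b c * k a b c) = S1.
  rewrite exchange_big /= -S2E; apply: eq_bigr => a _; apply: eq_bigr => b _.
  apply: eq_bigr => c _; rewrite (tripleCl acT) /k (oC b a) -!addnA.
  by rewrite (addnC (o b c)).
have : 3 * S1 = 6 * ntriples T.
  have -> : 3 * S1 = S1 + S1 + S1 by lia.
  rewrite -{2}S2E -{2}S3E /S1 -!big_split /= /ntriples big_distrr /=.
  apply: eq_bigr => a _; rewrite -!big_split /= big_distrr /=.
  apply: eq_bigr => b _; rewrite -!big_split /= big_distrr /=.
  apply: eq_bigr => c _; case abc : (T a b c); last by rewrite !mul0n muln0.
  rewrite !mul1n -!mulnDl /k muln1.
  have : 0 < o a b + o a c + o b c.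
    rewrite !addn_gt0 /o !lt0b; apply: contraT.
    rewrite !negb_or => /andP[/andP[ab ac] bc].
    have h1 : T a c b by tsy.
    have h2 : T b c a by tsy.
    by case: (thick_triangle_free acT (nthin_thick abc ab) (nthin_thick h1 ac) (nthin_thick h2 bc)).
  by rewrite /o; do 3!case: (thin T _ _).
by rewrite S1E; lia.
Qed.

Lemma sum_tight (I : finType) (P : pred I) (F G : I -> nat) :
  (forall i, P i -> F i <= G i) -> \sum_(i | P i) G i <= \sum_(i | P i) F i ->
  forall i, P i -> F i = G i.
Proof.
move=> le ge i Pi; apply/eqP; rewrite eqn_leq le //=.
move: ge; rewrite (bigD1 i) //= [X in _ <= X](bigD1 i) //=.
have : \sum_(j | P j && (j != i)) F j <= \sum_(j | P j && (j != i)) G j.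
  by apply: leq_sum => j /andP[Pj _]; apply: le.
by lia.
Qed.

(** * Maximum matchings *)

Section Matching.
Variables (V : finType) (E : rel V).

(** A matching is the involution that exchanges the ends of its edges and
    fixes the other vertices. *)
Definition matching (m : V -> V) :=
  involutive m /\ forall z, m z != z -> E z (m z).

Definition matched (m : V -> V) := [set z | m z != z].

Definition max_matching m :=
  matching m /\ forall m', matching m' -> #|matched m'| <= #|matched m|.

Lemma max_matching_exists : exists m, max_matching m.
Proof.
pose P (f : {ffun V -> V}) :=
  [forall z, (f (f z) == z) && ((f z != z) ==> E z (f z))].
have PE f : P f -> matching f.
  move=> /forallP h; split=> z; first by have /andP[/eqP] := h z.
  by move=> fz; have /andP[_ /implyP] := h z; apply.
have P0 : P [ffun z => z] by apply/forallP => z; rewrite !ffunE eqxx.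
case: (arg_maxnP (fun f : {ffun V -> V} => #|matched f|) P0) => f Pf fmax.
exists f; split; first exact: PE.
move=> m' [inv edge]; have := fmax [ffun z => m' z].
have -> : matched (fun_of_fin [ffun z => m' z]) = matched m'.
  by apply/setP => z; rewrite !inE ffunE.
apply; apply/forallP => z; rewrite !ffunE inv eqxx /=.
by apply/implyP => /edge.
Qed.

Lemma matched_inv m z : involutive m -> (m z \in matched m) = (z \in matched m).
Proof. by move=> inv; rewrite !inE inv eq_sym. Qed.

Lemma sum_matched_inv m (F : V -> nat) : involutive m ->
  \sum_(z in matched m) F (m z) = \sum_(z in matched m) F z.
Proof.
move=> inv; rewrite [RHS](reindex_inj (inv_inj inv)) /=.
by apply: eq_bigl => z; rewrite matched_inv.
Qed.

(** Adding the edge ab would enlarge the matching. *)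
Lemma max_matching_maximal m a b : max_matching m -> symmetric E -> irreflexive E ->
  a \notin matched m -> b \notin matched m -> ~~ E a b.
Proof.
move=> [[inv edge] mx] symE irrE; rewrite !inE !negbK => /eqP ma /eqP mb.
apply/negP => ab; have nab : a != b by apply: contraTneq ab => ->; rewrite irrE.
pose m' z := if z == a then b else if z == b then a else m z.
have mn z : z != a -> z != b -> (m z == a = false) * (m z == b = false).
  move=> za zb; split; apply/negbTE.
    by rewrite -ma (inj_eq (inv_inj inv)).
  by rewrite -mb (inj_eq (inv_inj inv)).
have : matching m'.
  split=> z; rewrite /m'.
    have [->|za] := eqVneq z a; first by rewrite eqxx eq_sym (negbTE nab).
    have [->|zb] := eqVneq z b; first by rewrite eqxx.
    by rewrite !(mn z za zb) inv.
  have [->|za] := eqVneq z a => //.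
  have [->|zb] := eqVneq z b => //; first by rewrite symE.
  exact: edge.
move=> /mx; apply/negP; rewrite -ltnNge; apply: proper_card.
apply/properP; split.
  apply/subsetP => z; rewrite !inE /m'.
  have [->|za] := eqVneq z a; first by move=> _; rewrite eq_sym.
  by have [->|zb] := eqVneq z b.
by exists a; rewrite ?inE /m' ?eqxx // 1?eq_sym // ma eqxx.
Qed.
End Matching.

(** * Two matchings and the exchange argument *)

Section PairingDefs.
Variables (V : finType) (T : V -> V -> V -> bool) (m n : V -> V).
Definition covered a b := [exists c, T a b c].
(** The second kind of block: the two vertices are unmatched and thick to a
    common vertex with which they form a triple. *)
Definition star_pair a b := 
  [&& m a == a, m b == b, a != b & [exists x, [&& T x a b, thick T x a & thick T x b]]].
Definition link_thin v z := [exists c, [&& T v z c, thin T v z & thin T v c]].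
Definition half_block v z := [&& z \in matched m, link_thin v z & ~~ link_thin v (m z)].
Definition avoided v z := ~~ covered v z && ~~ covered v (m z).
(** By [bad_ring] this happens only if v and the block of z lie on a
    five-ring. *)
Definition bad v z := 6 < weight T v z + weight T v (m z).
Definition rest := [set z | (m z == z) && (n z == z)].
Definition center z v := [&& T z v (n v), thick T z v & thick T z (n v)].
(** [outer] and [inner] split the leftover vertices a that may put weight on v
    a by the position of the apex. *)
Definition outer v := [set a in rest | link_thin v a & [exists c, T v a c && (c \notin rest)]].
Definition inner v := [set a in rest | [exists c, T v a c && (c \in rest)]].
End PairingDefs.

(** The excess weight on blocks of five-rings is outweighed by the blocks that
    vertices avoid. Vertices outside the matching count twice because the sum
    over ordered pairs contains their weights on blocks in both orders. *)
Definition ring_slack_on (V : finType) (T : V -> V -> V -> bool) (m n : V -> V) :=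
  forall v z, z \in matched m -> bad T m v z ->
  \sum_(u in matched m) bad T m u z + 2 * \sum_(u in matched n) bad T m u z
    + 2 * \sum_(u in rest m n) bad T m u z
  < \sum_(u in matched m) avoided T m u z + 2 * \sum_(u in matched n) avoided T m u z
    + 2 * \sum_(u in rest m n) avoided T m u z.

Lemma card_split (V : finType) (A : {set V}) (P : pred V) :
  #|A| = #|[set z in A | P z]| + #|[set z in A | ~~ P z]|.
Proof.
rewrite -(cardsID [set z | P z] A); congr (_ + _); apply: eq_card => z.
  by rewrite !inE.
by rewrite !inE andbC.
Qed.

Section Augment.
Variables (V : finType) (T : V -> V -> V -> bool) (m : V -> V).
Hypothesis acT : acfree T.
Hypothesis mmax : max_matching (thick T) m.
Notation w := (weight T).
Notation M := (matched m).
Implicit Types a b c d v x y z t : V.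

Let inv : involutive m. Proof. by case: mmax => -[]. Qed.
Lemma matched_thick z : z \in M -> thick T z (m z).
Proof. by rewrite inE; case: mmax => -[_ h] _ /h. Qed.

Lemma thick_irr : irreflexive (thick T).
Proof. by move=> a; apply/negP => /(thick_neq acT); rewrite eqxx. Qed.

Lemma unmatched_nthick a b : a \notin M -> b \notin M -> ~~ thick T a b.
Proof. by apply: max_matching_maximal mmax _ thick_irr => x y; apply: thickC. Qed.

Lemma nthin_cov a b : ~~ covered T a b -> ~~ thin T a b.
Proof. by apply: contra => /thin_apex[c h]; apply/existsP; exists c. Qed.

Lemma block_view_own z : z \in M -> w z z + w z (m z) = 0.
Proof. by move=> zM; rewrite weight_xx // weight_thick // matched_thick. Qed.

Lemma link_thin_le3 v z : link_thin T v z -> w v z <= 3.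
Proof.
case/existsP => c /and3P[vzc vz vc]; rewrite (weight_thin vz vzc) vc.
by case: (thin T z c).
Qed.

Lemma not_link_thin v z : ~~ thin T v z -> link_thin T v z = false.
Proof. by move=> h; apply/negbTE/negP => /existsP[c /and3P[_ vz _]]; rewrite vz in h. Qed.

Lemma link_thinI v z c : T v z c -> thin T v z -> thin T v c -> link_thin T v z.
Proof. by move=> *; apply/existsP; exists c; apply/and3P. Qed.

Lemma link_thinN v z c : T v z c -> thin T v z -> ~~ thin T v c -> link_thin T v z = false.
Proof.
move=> vzc vz vc; apply/negbTE/negP => /existsP[d /and3P[vzd _ vd]].
by rewrite (thin_eq vz vzc vzd) vd in vc.
Qed.

(** Besides the bound 6 this records what is left over in the incomplete
    views: a half block weighs at most 3 and an avoided block nothing. *)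
Lemma block_view v z : z \in M -> 
  w v z + w v (m z) + 3 * half_block T m v z + 3 * half_block T m v (m z) + 6 * avoided T m v z
    <= 6 + 6 * bad T m v z.
Proof.
move=> zM; have zz := matched_thick zM.
have mzM : m z \in M by rewrite matched_inv.
have avE c : T v z c -> avoided T m v z = false.
  by move=> h; apply/negbTE; rewrite /avoided negb_and !negbK; apply/orP; left; apply/existsP; exists c.
have avE' c : T v (m z) c -> avoided T m v z = false.
  by move=> h; apply/negbTE; rewrite /avoided negb_and !negbK; apply/orP; right; apply/existsP; exists c.
have hE : half_block T m v z = link_thin T v z && ~~ link_thin T v (m z) by rewrite /half_block zM.
have hE' : half_block T m v (m z) = link_thin T v (m z) && ~~ link_thin T v z.
  by rewrite /half_block mzM inv.
rewrite hE hE' /bad.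
case: (thick_viewP acT v zz) => [h e|nh nt e le|nh nt e le|y nh h1 h2 h3 t1 t2 t3 t4 e1 e2|y y' nh yy' h1 h2 h3 h4 only t1 t2 t3 t4 e1 e2|y y' nh r e1 e2].
- have a1 : T v z (m z) by tsy.
  have a2 : T v (m z) z by tsy.
  rewrite (avE _ a1) e.
  have [tz|tz] := boolP (thin T v z); have [tmz|tmz] := boolP (thin T v (m z)).
  + by rewrite (link_thinI a1 tz tmz) (link_thinI a2 tmz tz).
  + by rewrite (link_thinN a1 tz tmz) (not_link_thin tmz).
  + by rewrite (link_thinN a2 tmz tz) (not_link_thin tz).
  + by rewrite (not_link_thin tz) (not_link_thin tmz).
- rewrite (not_link_thin nt) e addn0 andbT /=.
  have [l|l] := boolP (link_thin T v z).
    have le3 := link_thin_le3 l.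
    have -> : avoided T m v z = false.
      by case/existsP: l => c /and3P[h _ _]; apply: avE h.
    by lia.
  case av: (avoided T m v z) => /=; last by lia.
  have -> : w v z = 0 by apply: weight_nthin; apply: nthin_cov; case/andP: av.
  by lia.
- rewrite (not_link_thin nt) e add0n andbT /=.
  have [l|l] := boolP (link_thin T v (m z)).
    have le3 := link_thin_le3 l.
    have -> : avoided T m v z = false.
      by case/existsP: l => c /and3P[h _ _]; apply: avE' h.
    by lia.
  case av: (avoided T m v z) => /=; last by lia.
  have -> : w v (m z) = 0 by apply: weight_nthin; apply: nthin_cov; case/andP: av.
  by lia.
- rewrite (avE _ h1) e1 e2 (link_thinN h1 t1) ?(link_thinN h2 t2) //.
    by rewrite (thick_nthin h3).
  by rewrite (thick_nthin h3).
- by rewrite (avE _ h1) e1 e2 (link_thinI h1 t1) // (link_thinI h2 t2).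
- have vz : thick T v y by apply: ring_thick r.
  have vz' : thick T v y'.
    rewrite (thickC acT); exact: (ring_thick acT (ring_rot (ring_rot (ring_rot (ring_rot r))))).
  rewrite e1 e2 (avE y); last by case: r => *; tsy.
  have l1 : link_thin T v z = false.
    apply/negbTE/negP => /existsP[c /and3P[h ht hc]].
    have e : c = y by apply: (ring_diag acT r h).
    by subst; rewrite (thick_nthin vz) in hc.
  have l2 : link_thin T v (m z) = false.
    apply/negbTE/negP => /existsP[c /and3P[h ht hc]].
    have h' : T v (m z) y' by case: r => *; tsy.
    by rewrite (thin_eq ht h h') (thick_nthin vz') in hc.
  by rewrite l1 l2.
Qed.

(** The thick pairs of the link of v whose ends are thinly joined to v form a
    matching. Replacing by it the blocks of m that it meets cannot enlarge m,
    so the vertices that it adds are outnumbered by those that lose their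
    block, and the partners of the latter are ends of half blocks. *)
Lemma augment v :
  #|[set z | link_thin T v z && (z \notin M) & [exists c, T v z c && thick T z c]]| <=
  #|[set z | half_block T m v z & [exists c, T v z c && thick T z c]]|.
Proof.
pose Q z := link_thin T v z && [exists c, T v z c && thick T z c].
pose mu z := odflt z [pick c | T v z c].
have muP z : Q z -> [/\ T v z (mu z), thin T v z, thin T v (mu z) & thick T z (mu z)].
  case/andP => /existsP[c /and3P[vzc vz vc]] /existsP[d /andP[vzd zd]].
  have [ec ed] : c = mu z /\ d = mu z.
    rewrite /mu; case: pickP => [e vze|/(_ c)]; last by rewrite vzc.
    by split; apply: (thin_eq vz).
  by rewrite -ec; split=> //; rewrite ec -ed.
have Qmu z : Q z -> Q (mu z) /\ mu (mu z) = z.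
  move=> /muP[h1 h2 h3 h4]; have h5 : T v (mu z) z by tsy.
  split.
    apply/andP; split; first by apply: link_thinI h5 _ _.
    by apply/existsP; exists z; rewrite h5 (thickC acT).
  rewrite {1}/mu; case: pickP => [e vze|/(_ z)]; last by rewrite h5.
  by apply: (thin_eq h3).
pose m' z := if Q z then mu z else if Q (m z) then z else m z.
have m'match : matching (thick T) m'.
  split=> z; rewrite /m'.
    have [qz|nqz] := boolP (Q z); first by have [-> ->] := Qmu z qz.
    have [qmz|nqmz] := boolP (Q (m z)); first by rewrite (negbTE nqz) qmz.
    by rewrite (negbTE nqmz) inv (negbTE nqz).
  have [/muP[]//|nqz] := boolP (Q z).
  have [|_ h] := boolP (Q (m z)); first by rewrite eqxx.
  by apply: matched_thick; rewrite inE.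
have le : #|matched m'| <= #|M| by case: mmax => _; apply.
have m'E : matched m' = [set z | Q z || (z \in M) && ~~ Q (m z)].
  apply/setP => z; rewrite !inE /m'.
  have [/muP[h1 _ _ _]|_] := boolP (Q z) => /=.
    by apply/eqP => e; rewrite e in h1; irr.
  by case: (Q (m z)); rewrite ?eqxx ?andbT ?andbF.
have c1 : #|M| = #|[set z in M | Q z]| + #|[set z in M | ~~ Q z & ~~ Q (m z)]|
    + #|[set z in M | ~~ Q z & Q (m z)]|.
  have e2 := card_split [set z in M | ~~ Q z] (fun z => Q (m z)).
  have e3 : #|[set z in [set z in M | ~~ Q z] | Q (m z)]|
      = #|[set z in M | ~~ Q z & Q (m z)]|.
    by apply: eq_card => z; rewrite !inE -andbA.
  have e4 : #|[set z in [set z in M | ~~ Q z] | ~~ Q (m z)]|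
      = #|[set z in M | ~~ Q z & ~~ Q (m z)]|.
    by apply: eq_card => z; rewrite !inE -andbA.
  by rewrite (card_split M Q); lia.
have c2 : #|matched m'| = #|[set z in M | Q z]| + #|[set z | Q z & z \notin M]|
    + #|[set z in M | ~~ Q z & ~~ Q (m z)]|.
  rewrite (card_split _ Q) (card_split [set z in matched m' | Q z] (fun z => z \in M)).
  rewrite m'E; congr (_ + _ + _); apply: eq_card => z; rewrite !inE.
  + by case: (Q z); rewrite ?andbF ?andbT.
  + by case: (Q z); rewrite ?andbF ?andbT.
  + by case: (Q z) => //=; rewrite ?andbF ?andbT.
have c3 : #|[set z in M | ~~ Q z & Q (m z)]| <=
    #|[set z | half_block T m v z & [exists c, T v z c && thick T z c]]|.
  rewrite -(card_imset _ (inv_inj inv)); apply: subset_leq_card.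
  apply/subsetP => _ /imsetP[z + ->]; rewrite inE => /and3P[zM nqz qmz].
  have [h1 h2 h3 h4] := muP _ qmz.
  rewrite inE /half_block matched_inv // zM inv /=.
  case/andP: (qmz) => -> -> /=; rewrite andbT.
  apply/negP => lz; case/negP: nqz; rewrite /Q lz /=.
  have zz := matched_thick zM; case/existsP: (lz) => c /and3P[vzc vz vc].
  case: (thick_viewP acT v zz) => [h e|nh nt e lew|nh nt e lew|y nh g1 g2 g3 t1 t2 t3 t4 e1 e2|y y' nh yy' g1 g2 g3 g4 only t1 t2 t3 t4 e1 e2|y y' nh r e1 e2].
  - by apply/existsP; exists (m z); rewrite zz andbT; tsy.
  - by rewrite h2 in nt.
  - by rewrite vz in nt.
  - by move: vc; rewrite (thin_eq vz vzc g1) (thick_nthin g3).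
  - apply/existsP; exists y; rewrite g1 /=.
    by apply: (@thick_two _ T z y (m z) v); [tsy|tsy|apply/eqP => e; move: h1; rewrite e => ?; irr].
  - have vy : thick T v y by apply: ring_thick r.
    have e : c = y by apply: (ring_diag acT r vzc).
    by subst; rewrite (thick_nthin vy) in vc.
have -> : #|[set z | link_thin T v z && (z \notin M) & [exists c, T v z c && thick T z c]]|
    = #|[set z | Q z & z \notin M]|.
  by apply: eq_card => z; rewrite !inE /Q -!andbA andbCA andbC -!andbA; do !bool_congr.
by lia.
Qed.
End Augment.

(** * Local bounds around star pairs and leftover vertices *)

Section Pairing.
Variables (V : finType) (T : V -> V -> V -> bool) (m n : V -> V).
Hypothesis acT : acfree T.
Hypothesis mmax : max_matching (thick T) m.
Hypothesis nmax : max_matching (star_pair T m) n.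
Notation w := (weight T).
Notation M := (matched m).
Notation N := (matched n).
Notation R := (rest m n).
Implicit Types a b c d v x y z t : V.

Let minv : involutive m. Proof. by case: mmax => -[]. Qed.
Let ninv : involutive n. Proof. by case: nmax => -[]. Qed.

Lemma star_pair_sym : symmetric (star_pair T m).
Proof.
move=> a b; rewrite /star_pair andbCA (eq_sym a b); congr [&& _, _, _ & _].
by apply: eq_existsb => x; rewrite (tripleCr acT) (andbC (thick T x a)).
Qed.

Lemma star_pair_irr : irreflexive (star_pair T m).
Proof. by move=> a; rewrite /star_pair eqxx !andbF. Qed.

Lemma star_matched z : z \in N ->
  [/\ z \notin M, n z \notin M, z != n z & exists2 x, x \in M & center T n x z].
Proof.
rewrite inE => nz; case: nmax => -[_ /(_ z nz) h] _; move: h.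
case/and4P => mz mnz zn /existsP[x /and3P[h1 h2 h3]].
have zM : z \notin M by rewrite inE mz.
split=> //; first by rewrite inE mnz.
exists x; last by apply/and3P.
by apply: contraTT h2 => xM; apply: (unmatched_nthick acT mmax).
Qed.

Lemma in_rest z : (z \in R) = (z \notin M) && (z \notin N).
Proof. by rewrite !inE !negbK. Qed.

Lemma sum_parts (F : V -> nat) :
  \sum_v F v = \sum_(v in M) F v + \sum_(v in N) F v + \sum_(v in R) F v.
Proof.
rewrite (bigID (mem M)) /= -addnA; congr (_ + _).
rewrite (bigID (mem N)) /=; congr (_ + _); apply: eq_bigl => v; last by rewrite in_rest.
by apply: andb_idl => /star_matched[].
Qed.

Lemma star_view z v : z \in N -> v != z -> v != n z -> w v z + w v (n z) <= 6.
Proof.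
move=> /star_matched[_ _ _ [x _ /and3P[h1 h2 h3]]] vz vnz.
have [->|vx] := eqVneq v x; first by rewrite !weight_thick.
exact: (star_pair_view_le acT h2 h3).
Qed.

Lemma star_view_own z : z \in N -> w z (n z) = 6.
Proof.
move=> /star_matched[_ _ _ [x _ /and3P[h1 h2 h3]]].
by case: (thin_star acT h2 h3 h1).
Qed.

Lemma star_block_view z v : z \in N -> w v z + w v (n z) <= 6.
Proof.
move=> zN; have [->|vz] := eqVneq v z; first by rewrite weight_xx // star_view_own.
have [->|vnz] := eqVneq v (n z); last exact: star_view.
by rewrite weight_xx // weightC // star_view_own.
Qed.

Lemma notin_covered a v z : T v z a -> ~~ avoided T m v z.
Proof. by move=> h; rewrite negb_and !negbK; apply/orP; left; apply/existsP; exists a. Qed.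

Lemma half_matched v z : half_block T m v z -> z \in M.
Proof. by case/and3P. Qed.

(** A center of a star pair is thick to both its ends and thus carries no
    weight on them, so its block loses 6 units; this loss pays for the pair
    itself, whose own weight is 6. *)
Lemma star_matched_block_view z v : z \in M -> v \in N ->
  (w v z + w v (m z)) + (w (n v) z + w (n v) (m z)) + 6 * center T n z v + 6 * center T n (m z) v
   + 6 * avoided T m v z + 6 * avoided T m (n v) z <= 12 + 6 * bad T m v z + 6 * bad T m (n v) z.
Proof.
move=> zM vN; have [vM nvM vnv _] := star_matched vN.
have mzM : m z \in M by rewrite matched_inv.
have zz := matched_thick mmax zM.
have nm x u : x \in M -> u \notin M -> x != u by move=> xM; apply: contraNneq => <-.
have main y : y \in M -> center T n y v ->
   w v y + w (n v) y = 0 /\ w v (m y) + w (n v) (m y) <= 6 /\ ~~ avoided T m v y /\ ~~ avoided T m (n v) y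
   /\ ~~ center T n (m y) v.
  move=> yM /and3P[h1 h2 h3]; have myM : m y \in M by rewrite matched_inv.
  split; first by rewrite !(weightC acT _ y) !weight_thick.
  split.
    rewrite (weightC acT v) (weightC acT (n v)).
    by apply: star_view => //; apply: nm.
  split; first by apply: (notin_covered (a := n v)) => //; tsy.
  split; first by apply: (notin_covered (a := v)) => //; tsy.
  apply/negP => /and3P[_ h4 _]; rewrite (thickC acT) in h4; rewrite (thickC acT) in h2.
  exact: (thick_triangle_free acT h2 h4 (matched_thick mmax yM)).
have [cz|cz] := boolP (center T n z v).
  have [e [le [/negbTE -> [/negbTE -> /negbTE ->]]]] := main z zM cz.
  by move: e le; clear; lia.
have [cz'|cz'] := boolP (center T n (m z) v).
  have [e [le [av1 [av2 _]]]] := main (m z) mzM cz'; rewrite minv in le.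
  have avC u : avoided T m u z = avoided T m u (m z) by rewrite /avoided minv andbC.
  rewrite !avC (negbTE av1) (negbTE av2).
  by move: e le; clear; lia.
have := block_view acT mmax v zM; have := block_view acT mmax (n v) zM.
by clear; lia.
Qed.

Definition rest_link b z := [exists a in R, T b z a].

(** A triple on b z whose apex is a leftover vertex has only thin pairs and
    gives b z weight 2, whereas [star_pair_view] would require 3 if b also had
    weight on the other end. *)
Lemma rest_star_view b z : b \in R -> z \in N ->
  w b z + w b (n z) + 3 * rest_link b z + 3 * rest_link b (n z) <= 6.
Proof.
move=> bR zN; have [zM nzM znz [x xM /and3P[h1 h2 h3]]] := star_matched zN.
have bM : b \notin M by move: bR; rewrite in_rest => /andP[].
have bz : b != z by apply: contraTneq bR => ->; rewrite in_rest zN andbF.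
have bnz : b != n z.
  by apply: contraTneq bR => ->; rewrite in_rest (matched_inv _ ninv) zN andbF.
have bx : b != x by apply: contraNneq bM => ->.
have main c d : c \notin M -> d \notin M -> thick T x c -> thick T x d -> T x c d ->
    b != c -> b != d -> rest_link b c -> w b c = 2 /\ w b d = 0 /\ ~~ rest_link b d.
  move=> cM dM xc xd xcd bc bd /existsP[a /andP[aR bca]].
  have aM : a \notin M by move: aR; rewrite in_rest => /andP[].
  have tn p q r : p \notin M -> q \notin M -> T p q r -> thin T p q.
    by move=> pM qM h; apply: (nthick_thin h); apply: (unmatched_nthick acT mmax).
  have w2 : w b c = 2.
    have bac : T b a c by tsy.
    have cab : T c a b by tsy.
    by rewrite (weight_thin (tn _ _ _ bM cM bca) bca) (tn _ _ _ bM aM bac) (tn _ _ _ cM aM cab).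
  split=> //; have w0 : w b d = 0.
    have [//|gd] := posnP (w b d).
    have gc : 0 < w b c by rewrite w2.
    by have [] := star_pair_view acT xc xd xcd bx bc bd gc gd; rewrite w2.
  split=> //; apply/negP => /existsP[e /andP[_ bde]].
  by have := thin_weight_gt0 (tn _ _ _ bM dM bde); rewrite w0.
have [l|l] := boolP (rest_link b z).
  by have [-> [-> /negbTE ->]] := main z (n z) zM nzM h2 h3 h1 bz bnz l.
have [l'|l'] := boolP (rest_link b (n z)); last first.
  by have := star_view zN bz bnz; clear; lia.
have h1' : T x (n z) z by tsy.
by have [-> [-> _]] := main (n z) z nzM zM h3 h2 h1' bnz bz l'.
Qed.

(** If the apex of ab is a leftover vertex, all pairs of the triple are thin
    and ab has weight 2. Otherwise the maximality of n prevents the apex from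
    being thick to both a and b, so ab has weight at most 3. *)
Lemma rest_rest_view a b : a \in R -> b \in R ->
  w a b <= 3 * (a \in outer T m n b) + 3 * (b \in outer T m n a) + 2 * (a \in inner T m n b).
Proof.
move=> aR bR; have [tab|/weight_nthin -> //] := boolP (thin T a b).
have [c abc] := thin_apex tab.
have bac : T b a c by tsy.
have aM : a \notin M by move: aR; rewrite in_rest => /andP[].
have bM : b \notin M by move: bR; rewrite in_rest => /andP[].
have ab : a != b by neq.
have [cR|cR] := boolP (c \in R).
  have -> : a \in inner T m n b.
    by rewrite inE aR; apply/existsP; exists c; rewrite bac.
  have cM : c \notin M by move: cR; rewrite in_rest => /andP[].
  have tac : thin T a c.
    by apply: (nthick_thin (x := b)); [tsy|apply: (unmatched_nthick acT mmax)].
  have tbc : thin T b c.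
    by apply: (nthick_thin (x := a)); [tsy|apply: (unmatched_nthick acT mmax)].
  by rewrite (weight_thin tab abc) tac tbc leq_addl.
have star : ~~ (thick T c a && thick T c b).
  apply/negP => /andP[ca cb].
  have nst : ~~ star_pair T m a b.
    apply: (max_matching_maximal nmax star_pair_sym star_pair_irr).
      by move: aR; rewrite in_rest => /andP[].
    by move: bR; rewrite in_rest => /andP[].
  case/negP: nst; apply/and4P; split=> //.
  - by move: aM; rewrite inE negbK.
  - by move: bM; rewrite inE negbK.
  - by apply/existsP; exists c; rewrite ca cb !andbT; tsy.
have out p q : p \in R -> T p q c -> thin T q p -> ~~ thick T c q -> 
    p \in outer T m n q.
  move=> pR pqc tqp tcq; rewrite inE pR /=.
  have qpc : T q p c by tsy.
  rewrite (link_thinI qpc tqp) /=; last first.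
    by rewrite (thinC acT); apply: (nthick_thin (x := p)) tcq; tsy.
  by apply/existsP; exists c; rewrite qpc.
have le3 : w a b <= 3.
  rewrite (weight_thin tab abc).
  case/nandP: star => h.
    have -> : thin T a c by rewrite (thinC acT); apply: (nthick_thin (x := b)) h; tsy.
    by case: (thin T b c).
  have -> : thin T b c by rewrite (thinC acT); apply: (nthick_thin (x := a)) h; tsy.
  by case: (thin T a c).
case/nandP: star => h.
  have -> : b \in outer T m n a by apply: out => //; tsy.
  by apply: leq_trans le3 _; rewrite mulnC -addnA addnCA leq_addr.
have -> : a \in outer T m n b by apply: out => //; rewrite (thinC acT).
by apply: leq_trans le3 _; rewrite -addnA leq_addr.
Qed.

(** An outer vertex whose link edge at b is thick is counted by [augment]. For
    the others the apex is an end of a half block or belongs to a star pair,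
    and it determines the outer vertex. *)
Lemma outer_le b : b \in R ->
  #|outer T m n b| <= \sum_(z in M) half_block T m b z + \sum_(z in N) rest_link b z.
Proof.
move=> bR; have bM : b \notin M by move: bR; rewrite in_rest => /andP[].
pose P z := [exists c, T b z c && thick T z c].
have hsum (A : {set V}) (p : pred V) : \sum_(z in A) p z = #|[set z in A | p z]|.
  rewrite -sum1_card big_mkcond [RHS]big_mkcond /=; apply: eq_bigr => z _.
  by rewrite inE; case: (z \in A); case: (p z).
have -> : \sum_(z in M) half_block T m b z = #|[set z | half_block T m b z]|.
  rewrite hsum; apply: eq_card => z; rewrite !inE; apply: andb_idl => /half_matched.
  by rewrite inE.
rewrite hsum (card_split _ P) (card_split [set z | half_block T m b z] P) -addnA.
apply: leq_add.
  apply: leq_trans (_ : _ <= _) (leq_trans (augment acT mmax b) _).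
    apply: subset_leq_card; apply/subsetP => z; rewrite 4!inE -!andbA.
    case/and5P => mz nz lz _ pz; rewrite inE lz; move: pz; rewrite /P => ->; rewrite !andbT.
    by rewrite negbK.
  by apply: eq_leq; apply: eq_card => z; rewrite !inE.
set A := [set z in _ | ~~ P z].
pose mu z := odflt z [pick c | T b z c].
have AP a : a \in A -> [/\ T b a (mu a), thin T b a & thin T b (mu a)] /\
    [/\ a \in R, ~~ thick T a (mu a) & mu a \notin R].
  rewrite 2!inE -!andbA => /and4P[aR /existsP[c /and3P[bac tba tbc]] /existsP[d /andP[bad dR]] pz].
  have ec : mu a = c.
    rewrite /mu; case: pickP => [e bae|/(_ c)]; last by rewrite bac.
    by apply: (thin_eq tba).
  rewrite ec; split; (split=> //); last by rewrite (thin_eq tba bac bad).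
  by apply: contra pz => h; apply/existsP; exists c; rewrite bac.
have inj : {in A &, injective mu}.
  move=> a a' /AP[[h1 _ h2] _] /AP[[h3 _ h4] _] e.
  by apply: (thin_eq h2); [tsy|rewrite e; tsy].
rewrite -(card_in_imset inj).
apply: leq_trans (leq_card_setU _ _); apply: subset_leq_card.
apply/subsetP => _ /imsetP[a /AP[[h1 h2 h3] [aR h4 h5]] ->].
have h1' : T b (mu a) a by tsy.
move: h5; rewrite in_rest negb_and !negbK => h5.
have [cM|cM] := boolP (mu a \in M); last first.
  move: h5; rewrite (negbTE cM) /= => cN.
  rewrite in_setU; apply/orP; right; rewrite in_set cN; apply/existsP; exists a.
  by rewrite aR.
rewrite in_setU; apply/orP; left; rewrite 2!in_set /half_block cM /=.
have -> : link_thin T b (mu a) by apply: link_thinI h1' h3 _.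
have -> : ~~ P (mu a).
  apply/negP => /existsP[d /andP[h6 h7]]; rewrite (thin_eq h3 h6 h1') in h7.
  by rewrite (thickC acT) h7 in h4.
rewrite andbT /=; apply/negP => l.
have l' : thin T b (m (mu a)) by case/existsP: l => c /and3P[].
case: (thick_viewP acT b (matched_thick mmax cM)) => [h e|nh nt e lew|nh nt e lew|y nh g1 g2 g3 t1 t2 t3 t4 e1 e2|y y' nh yy' g1 g2 g3 g4 only t1 t2 t3 t4 e1 e2|y y' nh r e1 e2].
- have h6 : T b (mu a) (m (mu a)) by tsy.
  move: aR; rewrite (thin_eq h3 h1' h6) in_rest (matched_inv _ minv).
  by rewrite cM.
- by rewrite l' in nt.
- by rewrite h3 in nt.
- by move: h2; rewrite (thin_eq h3 h1' g1) (thick_nthin g3).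
- rewrite -(thin_eq h3 h1' g1) in g3.
  case/negP: h4; rewrite (thickC acT).
  apply: (@thick_two _ T _ _ b (m (mu a))); [tsy|tsy|].
  by apply/eqP => e; move: bM; rewrite e (matched_inv _ minv) cM.
- have vy : thick T b y by apply: ring_thick r.
  have e : a = y by apply: (ring_diag acT r h1').
  by subst; rewrite (thick_nthin vy) in h2.
Qed.

End Pairing.

(** * The weight bound and its equality case *)

Lemma sum_mull (I : Type) (r : seq I) (P : pred I) (k : nat) (F : I -> nat) :
  \sum_(i <- r | P i) k * F i = k * \sum_(i <- r | P i) F i.
Proof. by rewrite big_distrr. Qed.

Ltac split_sums := repeat (rewrite sum_mull || rewrite big_split /=).

Lemma sum2_tight (I : finType) (A B : {set I}) (F G : I -> I -> nat) :
  (forall i j, i \in A -> j \in B -> F i j <= G i j) ->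
  \sum_(i in A) \sum_(j in B) G i j <= \sum_(i in A) \sum_(j in B) F i j ->
  forall i j, i \in A -> j \in B -> F i j = G i j.
Proof.
move=> le ge i j iA jB.
have ge' : \sum_(j in B) G i j <= \sum_(j in B) F i j.
  apply: eq_leq; apply/esym.
  apply: (@sum_tight _ (mem A) (fun i => \sum_(j in B) F i j) (fun i => \sum_(j in B) G i j)) => // k kA.
  by apply: leq_sum => l lB; apply: le.
by apply: (@sum_tight _ (mem B) (F i) (G i)) => // k kB; apply: le.
Qed.

Section Total.
Variables (V : finType) (T : V -> V -> V -> bool) (m n : V -> V).
Hypothesis acT : acfree T.
Hypothesis mmax : max_matching (thick T) m.
Hypothesis nmax : max_matching (star_pair T m) n.
Notation w := (weight T).
Notation M := (matched m).
Notation N := (matched n).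
Notation R := (rest m n).
Implicit Types a b c d v x y z t : V.

Hypothesis ring_slack : ring_slack_on T m n.

Let minv : involutive m. Proof. by case: mmax => -[]. Qed.
Let ninv : involutive n. Proof. by case: nmax => -[]. Qed.

Notation dsum A B F := (\sum_(v in A) \sum_(z in B) F v z).
Let SMM := dsum M M w.
Let SNM := dsum N M w.
Let SRM := dsum R M w.
Let SNN := dsum N N w.
Let SRN := dsum R N w.
Let SRR := dsum R R w.
Let av v z : nat := avoided T m v z.
Let bd v z : nat := bad T m v z.
Let hf v z : nat := half_block T m v z.
Let lk v z : nat := rest_link T m n v z.
Let out b := #|outer T m n b|.
Let inn b := #|inner T m n b|.

Lemma card_parts : #|M| + #|N| + #|R| = #|V|.
Proof.
by rewrite -!sum1_card (sum_parts acT mmax nmax (fun=> 1)).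
Qed.

Lemma weight_parts :
  \sum_a \sum_b w a b = SMM + 2 * SNM + 2 * SRM + SNN + 2 * SRN + SRR.
Proof.
have sym (A B : {set V}) : dsum A B w = dsum B A w.
  by rewrite exchange_big; do 2!apply: eq_bigr => ? _; rewrite weightC.
have e v : \sum_b w v b = \sum_(b in M) w v b + \sum_(b in N) w v b + \sum_(b in R) w v b.
  exact: (sum_parts acT mmax nmax).
rewrite (eq_bigr _ (fun v _ => e v)) !big_split /=.
rewrite !(sum_parts acT mmax nmax (fun v => \sum_(b in _) _)).
rewrite -/SMM -/SNM -/SRM -/SNN -/SRN -/SRR.
rewrite (sym M N) (sym M R) (sym N R) -/SNM -/SRM -/SRN.
clear; lia.
Qed.

Lemma matched_split (f : V -> V) (A : {set V}) (F : V -> V -> nat) : involutive f ->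
  \sum_(v in A) \sum_(z in matched f) (F v z + F v (f z)) = 2 * dsum A (matched f) F.
Proof.
move=> inv; rewrite big_distrr; apply: eq_bigr => v _.
by rewrite big_split /= sum_matched_inv // addnn mul2n.
Qed.

(** In each of these cells the weight of a vertex on a block is taken together
    with the terms that its local bound leaves unused, so that the cell is
    bounded by a constant up to five-rings. Here the middle term accounts for
    the own block of v, which has weight 0. *)
Definition cellMM v z :=
  w v z + w v (m z) + 6 * ((z == v) + (z == m v)) + 6 * av v z.

Lemma cellMM_le v z : v \in M -> z \in M -> cellMM v z <= 6 + 6 * bd v z.
Proof.
move=> vM zM; rewrite /cellMM.
have own : w z z + w z (m z) = 0 by apply: block_view_own.
have zz := matched_thick mmax zM.
have [c czz] : exists c, T z (m z) c.
  by case/card_gt1P: zz => c [_ [+ _ _]]; rewrite inE; exists c.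
have [<-|vz] := eqVneq z v.
  have -> : av z z = 0.
    by apply/eqP; rewrite eqb0 /avoided negb_and !negbK orbC; apply/orP; left; apply/existsP; exists c.
  have -> : (z == m z) = false by rewrite eq_sym; move: zM; rewrite inE => /negbTE.
  by move: own; clear; lia.
have [e|vz'] := eqVneq z (m v); last first.
  have := block_view acT mmax v zM; rewrite /av /bd; clear; lia.
have ve : v = m z by rewrite e minv.
subst v; rewrite addnC.
have -> : av (m z) z = 0.
  apply/eqP; rewrite eqb0 /avoided negb_and !negbK; apply/orP; left; apply/existsP; exists c.
  tsy.
rewrite weight_xx // weight_thick ?(thickC acT (m z)) //.
Qed.

Lemma sumMM : \sum_(v in M) \sum_(z in M) cellMM v z = 2 * SMM + 12 * #|M| + 6 * dsum M M av.
Proof.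
have e u : u \in M -> \sum_(z in M) (z == u) = 1.
  by move=> uM; rewrite (bigD1 u) //= eqxx big1 // => z /andP[_ /negbTE ->].
have cE v : v \in M ->
   \sum_(z in M) cellMM v z = 2 * \sum_(z in M) w v z + 12 + 6 * \sum_(z in M) av v z.
  move=> vM; rewrite /cellMM; split_sums; rewrite !e ?matched_inv //.
  by rewrite (sum_matched_inv (w v) minv); clear; lia.
by rewrite (eq_bigr _ cE); split_sums; rewrite sum_nat_const; clear; lia.
Qed.

Lemma sum_cap (A : {set V}) :
  \sum_(v in A) \sum_(z in M) (6 + 6 * bd v z) = 6 * (#|A| * #|M|) + 6 * dsum A M bd.
Proof.
under eq_bigr => ? _ do (split_sums; rewrite sum_nat_const).
by split_sums; rewrite sum_nat_const; clear; lia.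
Qed.

Lemma boundMM : 2 * SMM + 12 * #|M| + 6 * dsum M M av <= 6 * (#|M| * #|M|) + 6 * dsum M M bd.
Proof. by rewrite -sumMM -sum_cap; do 2!(apply: leq_sum => ? ?); apply: cellMM_le. Qed.

Definition cellNM v z :=
  (w v z + w v (m z)) + (w (n v) z + w (n v) (m z)) + 6 * center T n z v + 6 * center T n (m z) v
   + 6 * av v z + 6 * av (n v) z.

Lemma center_sum v : v \in N -> 0 < \sum_(z in M) center T n z v.
Proof.
move=> /(star_matched acT mmax nmax)[_ _ _ [x xM xc]].
by rewrite (bigD1 x) //= xc.
Qed.

Lemma sumNM :
  \sum_(v in N) \sum_(z in M) cellNM v z =
  4 * SNM + 12 * dsum N M (fun v z => center T n z v) + 12 * dsum N M av.
Proof.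
rewrite /cellNM; under eq_bigr do split_sums.
split_sums.
have e1 (F : V -> V -> nat) :
    \sum_(v in N) \sum_(z in M) F (n v) z = \sum_(v in N) \sum_(z in M) F v z.
  exact: (sum_matched_inv (fun v => \sum_(z in M) F v z) ninv).
have e2 (F : V -> V -> nat) :
    \sum_(v in N) \sum_(z in M) F v (m z) = \sum_(v in N) \sum_(z in M) F v z.
  by apply: eq_bigr => v _; apply: (sum_matched_inv (F v) minv).
rewrite (e1 (fun v z => w v (m z))) (e1 w) !(e2 w) (e1 av).
rewrite (e2 (fun v z => center T n z v)) -/SNM.
by clear; lia.
Qed.

Lemma sum_capNM : \sum_(v in N) \sum_(z in M) (12 + 6 * bd v z + 6 * bd (n v) z)
   = 12 * (#|N| * #|M|) + 12 * dsum N M bd.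
Proof.
under eq_bigr => ? _ do (split_sums; rewrite sum_nat_const).
split_sums; rewrite sum_nat_const.
rewrite (sum_matched_inv (fun v => \sum_(z in M) bd v z) ninv).
by clear; lia.
Qed.

Lemma cellNM_sum_le :
  4 * SNM + 12 * dsum N M (fun v z => center T n z v) + 12 * dsum N M av <=
  12 * (#|N| * #|M|) + 12 * dsum N M bd.
Proof.
rewrite -sumNM -sum_capNM; do 2!(apply: leq_sum => ? ?).
exact: star_matched_block_view.
Qed.

Lemma card_center : #|N| <= dsum N M (fun v z => center T n z v).
Proof. by rewrite -sum1_card; apply: leq_sum => v vN; apply: center_sum. Qed.

Lemma boundNM : 4 * SNM + 12 * #|N| + 12 * dsum N M av <=
  12 * (#|N| * #|M|) + 12 * dsum N M bd.
Proof. by have := cellNM_sum_le; have := card_center; clear; lia. Qed.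

Definition cellRM b z := w b z + w b (m z) + 3 * hf b z + 3 * hf b (m z) + 6 * av b z.

Lemma sumRM : \sum_(b in R) \sum_(z in M) cellRM b z
  = 2 * SRM + 6 * dsum R M hf + 6 * dsum R M av.
Proof.
rewrite /cellRM.
under eq_bigr => b _ do
  (split_sums; rewrite (sum_matched_inv (w b) minv) (sum_matched_inv (hf b) minv)).
by split_sums; rewrite -/SRM; clear; lia.
Qed.

Lemma boundRM : 2 * SRM + 6 * dsum R M hf + 6 * dsum R M av <=
  6 * (#|R| * #|M|) + 6 * dsum R M bd.
Proof. by rewrite -sumRM -sum_cap; do 2!(apply: leq_sum => ? ?); apply: block_view. Qed.

Lemma boundNN : 2 * SNN <= 6 * (#|N| * #|N|).
Proof.
rewrite -(matched_split _ _ ninv).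
have -> : 6 * (#|N| * #|N|) = \sum_(v in N) \sum_(z in N) 6.
  by under eq_bigr do rewrite sum_nat_const; rewrite sum_nat_const; clear; lia.
by do 2!(apply: leq_sum => ? ?); apply: (star_block_view acT mmax nmax).
Qed.

Definition cellRN b z := w b z + w b (n z) + 3 * lk b z + 3 * lk b (n z).

Lemma sumRN : \sum_(b in R) \sum_(z in N) cellRN b z = 2 * SRN + 6 * dsum R N lk.
Proof.
rewrite /cellRN.
under eq_bigr => b _ do
  (split_sums; rewrite (sum_matched_inv (w b) ninv) (sum_matched_inv (lk b) ninv)).
by split_sums; rewrite -/SRN; clear; lia.
Qed.

Lemma sum_capRN : \sum_(b in R) \sum_(z in N) 6 = 6 * (#|R| * #|N|).
Proof. by under eq_bigr do rewrite sum_nat_const; rewrite sum_nat_const; clear; lia. Qed.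

Lemma boundRN : 2 * SRN + 6 * dsum R N lk <= 6 * (#|R| * #|N|).
Proof.
rewrite -sumRN -sum_capRN; do 2!(apply: leq_sum => ? ?).
exact: (rest_star_view acT mmax nmax).
Qed.

Lemma sum_in_card (A : V -> {set V}) : (forall b, A b \subset R) ->
  \sum_(a in R) \sum_(b in R) (a \in A b) = \sum_(b in R) #|A b|.
Proof.
move=> sA; rewrite exchange_big; apply: eq_bigr => b _ /=.
rewrite -sum1_card [LHS]big_mkcond [RHS]big_mkcond; apply: eq_bigr => a _ /=.
case aA : (a \in A b); first by rewrite (subsetP (sA b)).
by case: (a \in R).
Qed.

Definition cellRR a b :=
  3 * (a \in outer T m n b) + 3 * (b \in outer T m n a) + 2 * (a \in inner T m n b).

Lemma sumRR : \sum_(a in R) \sum_(b in R) cellRR a b =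
  6 * \sum_(b in R) out b + 2 * \sum_(b in R) inn b.
Proof.
have so b : outer T m n b \subset R by apply/subsetP => z; rewrite inE => /and3P[].
have si b : inner T m n b \subset R by apply/subsetP => z; rewrite inE => /andP[].
rewrite /cellRR; under eq_bigr do split_sums.
split_sums; rewrite (sum_in_card so) (sum_in_card si).
by rewrite exchange_big /= (sum_in_card so) /out /inn; clear; lia.
Qed.

Lemma boundRR : SRR <= 6 * \sum_(b in R) out b + 2 * \sum_(b in R) inn b.
Proof.
rewrite -sumRR; do 2!(apply: leq_sum => ? ?).
exact: (rest_rest_view acT mmax nmax).
Qed.

Lemma bound_outer : \sum_(b in R) out b <= dsum R M hf + dsum R N lk.
Proof.
have : \sum_(b in R) out b <= \sum_(b in R) (\sum_(z in M) hf b z + \sum_(z in N) lk b z).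
  by apply: leq_sum => b bR; apply: (outer_le acT mmax).
by rewrite big_split.
Qed.

(** Block by block, the slack hypothesis makes the inequality strict wherever
    a five-ring occurs. *)
Lemma bound_ring :
  dsum M M bd + 2 * dsum N M bd + 2 * dsum R M bd <=
  dsum M M av + 2 * dsum N M av + 2 * dsum R M av ?= iff
  [forall z in M, forall v, ~~ bad T m v z && ~~ avoided T m v z].
Proof.
pose B z := \sum_(u in M) bd u z + 2 * \sum_(u in N) bd u z + 2 * \sum_(u in R) bd u z.
pose A z := \sum_(u in M) av u z + 2 * \sum_(u in N) av u z + 2 * \sum_(u in R) av u z.
have swap (F : V -> V -> nat) : dsum M M F + 2 * dsum N M F + 2 * dsum R M F =
   \sum_(z in M) (\sum_(u in M) F u z + 2 * \sum_(u in N) F u z + 2 * \sum_(u in R) F u z).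
  have sw (X : {set V}) : dsum X M F = \sum_(z in M) \sum_(v in X) F v z.
    exact: exchange_big.
  by rewrite !sw; split_sums.
rewrite !swap; have BA z : z \in M -> B z <= A z.
  move=> zM; have [/existsP[v]|/existsPn nb] := boolP [exists v, bad T m v z].
    by move=> /(ring_slack zM) /ltnW.
  have z0 (X : {set V}) : \sum_(u in X) bd u z = 0.
    by apply: big1 => u _; rewrite /bd (negbTE (nb u)).
  by rewrite /B !z0.
split; first by apply: leq_sum.
apply/eqP/forallP => [e z|h]; last first.
  have z0 (F : V -> V -> nat) (X : {set V}) z : z \in M -> (forall v, F v z = 0) -> \sum_(u in X) F u z = 0.
    by move=> zM f0; apply: big1 => u _; apply: f0.
  apply: eq_bigr => z zM; have := h z; rewrite zM /= => /forallP hz.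
  have b0 v : bd v z = 0 by have /andP[/negbTE h1 _] := hz v; rewrite /bd h1.
  have a0 v : av v z = 0 by have /andP[_ /negbTE h1] := hz v; rewrite /av h1.
  by rewrite !z0.
apply/implyP => zM; have eBA : B z = A z.
  by apply: (sum_tight BA) => //; rewrite -/(\sum_(i in M) B i) e.
have nb v : bad T m v z = false.
  apply/negbTE/negP => /(ring_slack zM); rewrite -/(B z) -/(A z) eBA.
  by rewrite ltnn.
have B0 : B z = 0.
  by rewrite /B !big1 // => u _; rewrite /bd nb.
have /eqP : \sum_v av v z = 0.
  by rewrite (sum_parts acT mmax nmax); move: eBA; rewrite B0 /A; clear; lia.
rewrite sum_nat_eq0 => /forallP h; apply/forallP => v; rewrite nb /=.
by have := h v; rewrite /= eqb0.
Qed.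

(** The outer terms of the leftover vertices cancel against half blocks and
    links to star pairs, and the bad blocks against the avoided ones; only the
    inner terms remain. *)
Lemma weight_bound :
  2 * (\sum_a \sum_b w a b) + 12 * #|V| + 6 * (#|R| * #|R|) <=
  6 * (#|V| * #|V|) + 12 * #|R| + 4 * \sum_(b in R) inn b.
Proof.
rewrite weight_parts -card_parts.
have := boundMM; have := boundNM; have := boundRM; have := boundNN.
have := boundRN; have := boundRR; have := bound_outer; have [] := bound_ring.
rewrite !mulnDl !mulnDr (mulnC #|M| #|N|) (mulnC #|M| #|R|) (mulnC #|N| #|R|).
move: (dsum M M bd) (dsum N M bd) (dsum R M bd) (dsum M M av) (dsum N M av) (dsum R M av).
move: (dsum R M hf) (dsum R N lk) (\sum_(b in R) inn b) (\sum_(b in R) out b).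
move: SMM SNM SRM SNN SRN SRR (#|M| * #|M|) (#|N| * #|M|) (#|R| * #|M|) (#|N| * #|N|)
  (#|R| * #|N|) (#|R| * #|R|) #|M| #|N| #|R|.
by clear; lia.
Qed.

Record tight : Prop := Tight {
  tight_good : forall v z, z \in M -> bad T m v z = false;
  tightMM : forall v z, v \in M -> z \in M -> z != v -> z != m v -> w v z + w v (m z) = 6;
  tightNM : forall v z, v \in N -> z \in M ->
    (w v z + w v (m z)) + (w (n v) z + w (n v) (m z))
       + 6 * center T n z v + 6 * center T n (m z) v = 12;
  tightRM : forall b z, b \in R -> z \in M ->
    w b z + w b (m z) + 3 * half_block T m b z + 3 * half_block T m b (m z) = 6;
  tightRN : forall b z, b \in R -> z \in N ->
    w b z + w b (n z) + 3 * rest_link T m n b z + 3 * rest_link T m n b (n z) = 6;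
  tightRR : forall a b, a \in R -> b \in R -> w a b = cellRR a b;
  tight_outer : forall b, b \in R ->
    #|outer T m n b| = \sum_(z in M) half_block T m b z + \sum_(z in N) rest_link T m n b z }.

(** [weight_bound] is a sum of inequalities between cells, so equality holds
    in every cell. *)
Lemma weight_tight :
  6 * (#|V| * #|V|) + 12 * #|R| + 4 * \sum_(b in R) inn b <=
  2 * (\sum_a \sum_b w a b) + 12 * #|V| + 6 * (#|R| * #|R|) -> tight.
Proof.
rewrite weight_parts -card_parts.
have := boundMM; have := boundNM; have := boundRM; have := boundNN.
have := boundRN; have := boundRR; have := bound_outer.
have [ring_le ring_eq] := bound_ring; move: ring_le.
rewrite !mulnDl !mulnDr (mulnC #|M| #|N|) (mulnC #|M| #|R|) (mulnC #|N| #|R|).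
move=> h1 h2 h3 h4 h5 h6 h7 h8 h9.
have gen : [/\ 6 * (#|M| * #|M|) + 6 * dsum M M bd <= 2 * SMM + 12 * #|M| + 6 * dsum M M av,
   12 * (#|N| * #|M|) + 12 * dsum N M bd <= 4 * SNM + 12 * #|N| + 12 * dsum N M av,
   6 * (#|R| * #|M|) + 6 * dsum R M bd <= 2 * SRM + 6 * dsum R M hf + 6 * dsum R M av &
   6 * (#|R| * #|N|) <= 2 * SRN + 6 * dsum R N lk] /\ 
  [/\ 6 * \sum_(b in R) out b + 2 * \sum_(b in R) inn b <= SRR,
    dsum R M hf + dsum R N lk <= \sum_(b in R) out b &
  dsum M M bd + 2 * dsum N M bd + 2 * dsum R M bd ==
  dsum M M av + 2 * dsum N M av + 2 * dsum R M av].
  move: h1 h2 h3 h4 h5 h6 h7 h8 h9; clear.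
  move: (dsum M M bd) (dsum N M bd) (dsum R M bd) (dsum M M av) (dsum N M av) (dsum R M av).
  move: (dsum R M hf) (dsum R N lk) (\sum_(b in R) inn b) (\sum_(b in R) out b).
  move: SMM SNM SRM SNN SRN SRR (#|M| * #|M|) (#|N| * #|M|) (#|R| * #|M|) (#|N| * #|N|)
    (#|R| * #|N|) (#|R| * #|R|) #|M| #|N| #|R|.
  by clear; split; split; lia.
case: gen => -[g1 g2 g3 g4] [g5 g6 g7].
move: ring_eq; rewrite g7 => /esym /forallP clean.
have b0 v z : z \in M -> bd v z = 0.
  by move=> zM; have /implyP/(_ zM)/forallP/(_ v)/andP[/negbTE h _] := clean z; rewrite /bd h.
have a0 v z : z \in M -> av v z = 0.
  by move=> zM; have /implyP/(_ zM)/forallP/(_ v)/andP[_ /negbTE h] := clean z; rewrite /av h.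
split.
- by move=> v z zM; have /eqP := b0 v z zM; rewrite eqb0 => /negbTE.
- move=> v z vM zM zv zmv; rewrite -sumMM -sum_cap in g1.
  have := sum2_tight cellMM_le g1 vM zM.
  rewrite /cellMM b0 // a0 // (negbTE zv) (negbTE zmv); clear; lia.
- move=> v z vN zM; have h : \sum_(v in N) \sum_(z in M) (12 + 6 * bd v z + 6 * bd (n v) z)
      <= \sum_(v in N) \sum_(z in M) cellNM v z.
    by rewrite sumNM sum_capNM; move: g2 card_center; clear; lia.
  have le i j : i \in N -> j \in M -> cellNM i j <= 12 + 6 * bd i j + 6 * bd (n i) j.
    by move=> iN jM; apply: star_matched_block_view.
  have := sum2_tight le h vN zM.
  by rewrite /cellNM !b0 // !a0 //; clear; lia.
- move=> b z bR zM; rewrite -sumRM -sum_cap in g3.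
  have le i j : i \in R -> j \in M -> cellRM i j <= 6 + 6 * bd i j.
    by move=> _ jM; apply: block_view.
  have := sum2_tight le g3 bR zM.
  by rewrite /cellRM b0 // a0 // /hf; clear; lia.
- move=> b z bR zN; rewrite -sumRN -sum_capRN in g4.
  have le i j : i \in R -> j \in N -> cellRN i j <= 6.
    by move=> iR jN; apply: (rest_star_view acT mmax nmax).
  exact: (sum2_tight le g4 bR zN).
- move=> a b aR bR; rewrite -sumRR in g5.
  exact: (sum2_tight (rest_rest_view acT mmax nmax) g5 aR bR).
- move=> b bR; have le i : i \in R -> out i <= \sum_(z in M) hf i z + \sum_(z in N) lk i z.
    by move=> iR; apply: (outer_le acT mmax).
  by apply: (sum_tight le) => //; rewrite big_split.
Qed.
End Total.

(** * Numerical form of the weight bound *)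

Lemma card_involution_even (V : finType) (f : V -> V) (A : {set V}) :
  (forall a, a \in A -> [/\ f a \in A, f a != a & f (f a) = a]) -> ~~ odd #|A|.
Proof.
elim: {A}_.+1 {-2}A (ltnSn #|A|) => // k IH A; rewrite ltnS => Ak fA.
have [->|[a aA]] := set_0Vmem A; first by rewrite cards0.
have [faA faa ffa] := fA a aA.
have cA : #|A| = #|(A :\ a) :\ f a|.+2.
  by rewrite (cardsD1 a) aA (cardsD1 (f a) (A :\ a)) !inE faA faa.
rewrite cA /= negbK; apply: IH; first by rewrite cA in Ak; apply: leq_trans Ak.
move=> b; rewrite !inE => /and3P[bfa ba bA]; have [h1 h2 h3] := fA b bA.
rewrite h1 h2 h3 !andbT; split=> //; apply/andP; split.
  by apply: contraNneq ba => e; rewrite -h3 e ffa.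
by apply: contraNneq bfa => e; rewrite -e h3.
Qed.

Lemma matched_even (V : finType) (f : V -> V) : involutive f -> ~~ odd #|matched f|.
Proof.
move=> inv; apply: (@card_involution_even _ f) => a aM.
by rewrite matched_inv //; split=> //; move: aM; rewrite inE.
Qed.

Section Global.
Variables (V : finType) (T : V -> V -> V -> bool) (m n : V -> V).
Hypothesis acT : acfree T.
Hypothesis mmax : max_matching (thick T) m.
Hypothesis nmax : max_matching (star_pair T m) n.
Hypothesis slack : ring_slack_on T m n.
Notation R := (rest m n).

Lemma rest_parity : odd #|R| = odd #|V|.
Proof.
have [[minv _] _] := mmax; have [[ninv _] _] := nmax.
rewrite -(card_parts acT mmax nmax) !oddD.
by rewrite (negbTE (matched_even minv)) (negbTE (matched_even ninv)).
Qed.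

(** The edges of the link of b between leftover vertices are disjoint, so they
    match the inner vertices in pairs. *)
Lemma inner_even b : b \in R -> ~~ odd #|inner T m n b|.
Proof.
move=> bR; have bM : b \notin matched m by move: bR; rewrite (in_rest) => /andP[].
pose mu z := odflt z [pick c | T b z c].
apply: (@card_involution_even _ mu) => a; rewrite inE => /andP[aR /existsP[c /andP[bac cR]]].
have aM : a \notin matched m by move: aR; rewrite (in_rest) => /andP[].
have cM : c \notin matched m by move: cR; rewrite (in_rest) => /andP[].
have bca : T b c a by tsy.
have tba : thin T b a by apply: (nthick_thin bac); apply: (unmatched_nthick acT mmax).
have tbc : thin T b c by apply: (nthick_thin bca); apply: (unmatched_nthick acT mmax).
have e1 : mu a = c.
  by rewrite /mu; case: pickP => [d h|/(_ c)]; [apply: thin_eq tba _ _|rewrite bac].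
have e2 : mu c = a.
  by rewrite /mu; case: pickP => [d h|/(_ a)]; [apply: thin_eq tbc _ _|rewrite bca].
rewrite e1 e2; split=> //; last by clear e1 e2; neq.
by rewrite inE cR; apply/existsP; exists a; rewrite bca.
Qed.

Lemma inner_lt b : b \in R -> #|inner T m n b| < #|R|.
Proof.
move=> bR; apply: proper_card; apply/properP; split.
  by apply/subsetP => z; rewrite inE => /andP[].
by exists b => //; rewrite inE bR /=; apply/negP => /existsP[c /andP[h _]]; irr.
Qed.

Lemma sum_inner_odd : \sum_(b in R) #|inner T m n b| <= #|R| * #|R|.-1.
Proof.
rewrite -sum_nat_const; apply: leq_sum => b bR.
by have := inner_lt bR; clear; lia.
Qed.

Lemma sum_inner_even : ~~ odd #|R| ->
  \sum_(b in R) #|inner T m n b| <= #|R| * (#|R| - 2).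
Proof.
move=> e; rewrite -sum_nat_const; apply: leq_sum => b bR.
have := inner_lt bR; have := inner_even bR; move: e.
by move: #|inner T m n b| #|R| => i r; clear; lia.
Qed.

(** With r leftover vertices [weight_bound] exceeds 6 n^2 - 12 n by at most 8
    r - 2 r^2, which is at most 6 because r is odd like n. *)
Lemma ntriples_bound_odd : odd #|V| -> 2 * ntriples T <= 3 * (#|V|.-1 * #|V|.-1).
Proof.
rewrite -rest_parity => oR.
have := weight_bound acT mmax nmax slack; rewrite weight_sum //.
have := sum_inner_odd.
have : #|R| <= #|V| by apply: max_card.
move: oR; move: (\sum_(b in R) _) (ntriples T) => i t.
case: #|R| => [|[|[|r]]] //= _; case: #|V| => // v _ h1 h2; rewrite /= in h1 *.
  by move: h1 h2; clear; nia.
by move: h1 h2; clear; nia.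
Qed.

(** For even n the number r of leftover vertices is even, so an inner set has
    at most r - 2 vertices, and the excess over 6 n^2 - 12 n is at most 4 r -
    2 r^2. *)
Lemma ntriples_bound_even : ~~ odd #|V| ->
  2 * ntriples T <= 3 * (#|V| * (#|V| - 2)).
Proof.
rewrite -rest_parity => eR.
have := weight_bound acT mmax nmax slack; rewrite weight_sum //.
have := sum_inner_even eR.
have : #|R| <= #|V| by apply: max_card.
move: (eR); rewrite {1}rest_parity; move: eR (\sum_(b in R) _) (ntriples T) => + i t.
case: #|R| => [|[|r]] //=; case: #|V| => [|[|v]] //= _ _ le h1 h2;
  by move: h1 h2; rewrite ?subSS ?subn0; clear; nia.
Qed.

(** The excess 4 r - 2 r^2 vanishes for r = 0 and r = 2 only. *)
Lemma ntriples_tight : ~~ odd #|V| -> 3 * (#|V| * (#|V| - 2)) <= 2 * ntriples T ->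
  tight T m n /\ (#|R| = 0 \/ #|R| = 2).
Proof.
rewrite -rest_parity => eR.
have := weight_bound acT mmax nmax slack; have := weight_tight acT mmax nmax slack.
rewrite weight_sum //.
have := sum_inner_even eR.
have : #|R| <= #|V| by apply: max_card.
move: (eR); rewrite {1}rest_parity; move: eR (\sum_(b in R) _) (ntriples T) => + i t.
case: #|R| => [|[|r]] //=; case: #|V| => [|[|v]] //= _ _ le h1 h2 h3 h4.
- by split; [apply: h2; move: h1 h4; rewrite ?subSS ?subn0; clear; nia|left].
- by split; [apply: h2; move: h1 h4; rewrite ?subSS ?subn0; clear; nia|left].
rewrite !subSS !subn0 in h1 h4.
have r0 : r = 0 by move: h1 h3 h4; clear; nia.
by split; [apply: h2; move: h1 h3 h4; rewrite r0; clear; nia|right; rewrite r0].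
Qed.
End Global.

(** * Five-rings *)

Section Ring.
Variables (V : finType) (T : V -> V -> V -> bool).
Hypothesis acT : acfree T.
Variables s0 s1 s2 s3 s4 : V.
Hypothesis ring : five_ring_on T s0 s1 s2 s3 s4.
Notation w := (weight T).
Implicit Types a b c d p q v x y z t u : V.

Definition ring_set := [set x in [:: s0; s1; s2; s3; s4]].
Notation S := ring_set.

Lemma in_ring x : (x \in S) = [|| x == s0, x == s1, x == s2, x == s3 | x == s4].
Proof. by rewrite !inE. Qed.

Lemma card_ring : #|S| = 5.
Proof.
rewrite cardsE; apply: (@card_uniqP _ [:: s0; s1; s2; s3; s4]).
case: ring => h1 h2 h3 h4 h5.
rewrite /= !inE !negb_or !andbT -!andbA.
by do !(apply/andP; split); neq.
Qed.

Lemma ring_cover p q : p \in S -> q \in S -> p != q -> exists2 c, c \in S & T p q c.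
Proof.
case: ring => h1 h2 h3 h4 h5.
have find c : c \in S -> T p q c -> exists2 c, c \in S & T p q c by exists c.
rewrite in_ring => /orP[|/orP[|/orP[|/orP[]]]] /eqP e1; 
rewrite in_ring => /orP[|/orP[|/orP[|/orP[]]]] /eqP e2; subst p q; rewrite ?eqxx //= => _.
all: by first [ apply: (find s0); [rewrite in_ring eqxx ?orbT //|tsy]
  | apply: (find s1); [rewrite in_ring eqxx ?orbT //|tsy]
  | apply: (find s2); [rewrite in_ring eqxx ?orbT //|tsy]
  | apply: (find s3); [rewrite in_ring eqxx ?orbT //|tsy]
  | apply: (find s4); [rewrite in_ring eqxx ?orbT //|tsy] ].
Qed.

(** By [ring_diag] and [ring_side] the apexes of all ten pairs are ring
    vertices. *)
Lemma ring_closed p q t : p \in S -> q \in S -> T p q t -> t \in S.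
Proof.
have r1 := ring_rot ring; have r2 := ring_rot r1; have r3 := ring_rot r2.
have r4 := ring_rot r3.
rewrite in_ring => /orP[|/orP[|/orP[|/orP[]]]] /eqP e1; 
rewrite in_ring => /orP[|/orP[|/orP[|/orP[]]]] /eqP e2; subst p q => h; try irr.
all: rewrite in_ring.
all: try by first [ have := ring_side acT ring h | have := ring_side acT r1 h
  | have := ring_side acT r2 h | have := ring_side acT r3 h | have := ring_side acT r4 h];
  case/orP=> ->; rewrite ?orbT.
all: try by first [ have -> := ring_diag acT ring h | have -> := ring_diag acT r1 h
  | have -> := ring_diag acT r2 h | have -> := ring_diag acT r3 h | have -> := ring_diag acT r4 h];
  rewrite eqxx ?orbT.
all: rewrite (tripleCl acT) in h.
all: try by first [ have := ring_side acT ring h | have := ring_side acT r1 h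
  | have := ring_side acT r2 h | have := ring_side acT r3 h | have := ring_side acT r4 h];
  case/orP=> ->; rewrite ?orbT.
all: try by first [ have -> := ring_diag acT ring h | have -> := ring_diag acT r1 h
  | have -> := ring_diag acT r2 h | have -> := ring_diag acT r3 h | have -> := ring_diag acT r4 h];
  rewrite eqxx ?orbT.
Qed.

(** Distinct apexes would give A together with a triple of the ring on pq. *)
Lemma ring_view u p q x y : u \notin S -> p \in S -> q \in S -> p != q ->
  T p u x -> T q u y -> x = y.
Proof.
move=> uS pS qS pq pux quy; apply/eqP; apply: contraT => xy.
have [c cS pqc] := ring_cover pS qS pq.
have xS : x \notin S.
  by apply: contra uS => xS; apply: (ring_closed pS xS (t := u)); tsy.
have yS : y \notin S.
  by apply: contra uS => yS; apply: (ring_closed qS yS (t := u)); tsy.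
have ne k l : k \in S -> l \notin S -> k != l by move=> kS; apply: contraNneq => <-.
have qx := ne _ _ qS xS; have py := ne _ _ pS yS; have cu := ne _ _ cS uS.
have cx := ne _ _ cS xS; have cy := ne _ _ cS yS.
by Afree p q u c x y.
Qed.

Lemma ring_view_thin u p q x : u \notin S -> p \in S -> q \in S -> p != q ->
  T p u x -> covered T q u -> forall y, T p u y -> y = x.
Proof.
move=> uS pS qS pq pux /existsP[z quz] y puy.
by rewrite (ring_view uS pS qS pq puy quz) (ring_view uS pS qS pq pux quz).
Qed.

(** By [ring_view] such a vertex u forms triples with the same apex for all
    ring vertices that see it. *)
Definition ring_paired :=
  [set u | u \notin S & [exists p in S, exists q in S, [&& p != q, covered T p u & covered T q u]]].
Definition private s := [set u | [&& u \notin S, u \notin ring_paired & covered T s u]].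

Lemma in_private u s :
  (u \in private s) = [&& u \notin S, u \notin ring_paired & covered T s u].
Proof. by rewrite /private in_set. Qed.

Lemma ring_pairedI u p q : u \notin S -> p \in S -> q \in S -> p != q ->
  covered T p u -> covered T q u -> u \in ring_paired.
Proof.
move=> uS pS qS pq pu qu; rewrite inE uS; apply/existsP; exists p; rewrite pS.
by apply/existsP; exists q; rewrite qS pq pu.
Qed.

Lemma ring_paired_other u s : u \in ring_paired ->
  exists2 p, p \in S & (p != s) && covered T p u.
Proof.
rewrite inE => /andP[uS /existsP[p /andP[pS /existsP[q /andP[qS /and3P[pq pu qu]]]]]].
have [e|ps] := eqVneq p s; last by exists p; rewrite ?ps.
by exists q; rewrite // -e eq_sym pq.
Qed.

Lemma outside_ring s u x : s \in S -> u \notin S -> T s u x -> x \notin S.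
Proof.
by move=> sS uS h; apply: contra uS => xS; apply: (ring_closed sS xS (t := u)); tsy.
Qed.

Lemma card_private s : s \in S -> private s != set0 -> 1 < #|private s|.
Proof.
move=> sS /set0Pn[u]; rewrite inE => /and3P[uS uP /existsP[x sux]].
apply/card_gt1P; exists u, x.
have xS := outside_ring sS uS sux.
have sxu : T s x u by tsy.
split; last by neq.
  by rewrite inE uS uP; apply/existsP; exists x.
rewrite inE xS /=; apply/andP; split; last by apply/existsP; exists u.
apply/negP => xP; have [p pS /andP[ps px]] := ring_paired_other s xP.
have sp : s != p by rewrite eq_sym.
case/existsP: px => y pxy; have e := ring_view xS sS pS sp sxu pxy; subst y.
case/negP: uP; apply: (ring_pairedI (p := s) (q := p)) => //; apply/existsP; exists x => //.
by tsy.
Qed.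

Lemma private_disjoint s t : s \in S -> t \in S -> s != t -> [disjoint private s & private t].
Proof.
move=> sS tS st; rewrite disjoints_subset; apply/subsetP => u; rewrite in_setC !in_private.
case/and3P=> uS uP su; apply/negP => /and3P[_ _ tu].
by case/negP: uP; apply: (ring_pairedI uS sS tS st su tu).
Qed.

Lemma private_avoid u s p : s \in S -> p \in S -> s != p -> u \in private s -> ~~ covered T u p.
Proof.
move=> sS pS sp; rewrite inE => /and3P[uS uP su]; apply: contra uP => /existsP[x upx].
by apply: (ring_pairedI uS sS pS sp su); apply/existsP; exists x; tsy.
Qed.

(** The ring vertices on which the compensation for the five-ring rests. *)
Definition active := [set s in S | private s != set0].
End Ring.

Section RingSlack.
Variables (V : finType) (T : V -> V -> V -> bool) (m n : V -> V).
Hypothesis acT : acfree T.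
Hypothesis mmax : max_matching (thick T) m.
Hypothesis nmax : max_matching (star_pair T m) n.
Hypothesis actives : forall s0 s1 s2 s3 s4, five_ring_on T s0 s1 s2 s3 s4 ->
  3 < #|active T s0 s1 s2 s3 s4|.
Implicit Types a b c d p q v x y z t u : V.

Lemma bad_ring v z : z \in matched m -> bad T m v z ->
  exists y y', five_ring_on T v y z (m z) y'.
Proof.
move=> zM; rewrite /bad.
case: (thick_viewP acT v (matched_thick mmax zM)) => [h e|nh nt e lew|nh nt e lew|y nh g1 g2 g3 t1 t2 t3 t4 e1 e2|y y' nh yy' g1 g2 g3 g4 only t1 t2 t3 t4 e1 e2|y y' nh r e1 e2].
- by rewrite e.
- by rewrite e addn0 ltnNge lew.
- by rewrite e add0n ltnNge lew.
- by rewrite e1 e2.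
- by rewrite e1 e2.
- by exists y, y'.
Qed.

(** By closure both vertices lie on the same ring, on which only one vertex is
    opposite to the block. *)
Lemma bad_uniq u v z : z \in matched m -> bad T m u z -> bad T m v z -> u = v.
Proof.
move=> zM bu bv; have zz := matched_thick mmax zM.
have [y [y' r]] := bad_ring zM bv.
have [x [x' r']] := bad_ring zM bu.
have nthick c : bad T m c z -> (~~ thick T c z) && (~~ thick T c (m z)).
  rewrite /bad => h; apply/andP; split; apply: contraL h => h; rewrite -leqNgt.
    by rewrite (weight_thick h) weight_le6.
  by rewrite (weight_thick h) addn0 weight_le6.
have [nz nmz] := andP (nthick u bu).
case: (r') => h1 h2 h3 h4 h5.
have zS : z \in ring_set v y z (m z) y' by rewrite in_ring eqxx ?orbT.
have mzS : m z \in ring_set v y z (m z) y' by rewrite in_ring eqxx ?orbT.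
have xS : x \in ring_set v y z (m z) y'.
  by apply: (ring_closed acT r zS mzS); tsy.
have : u \in ring_set v y z (m z) y'.
  by apply: (ring_closed acT r zS xS); tsy.
rewrite in_ring => /orP[/eqP //|/orP[|/orP[|/orP[]]]] /eqP e; subst u.
- by case/negP: nz; apply: (ring_thick acT (ring_rot r)).
- by irr.
- by irr.
- case/negP: nmz; rewrite (thickC acT); apply: (ring_thick acT (ring_rot (ring_rot (ring_rot r)))).
Qed.

(** Two active ring vertices lie off the block. Each has at least two private
    vertices, which avoid the block, so four avoiding vertices outweigh the
    single bad one even when the latter counts twice. *)
Lemma four_active_slack : ring_slack_on T m n.
Proof.
move=> v z zM bv.
have le (F : V -> nat) : 
  \sum_(u in matched m) F u + 2 * \sum_(u in matched n) F u + 2 * \sum_(u in rest m n) F u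
   <= 2 * \sum_u F u.
  by rewrite (sum_parts acT mmax nmax); clear; lia.
have ge (F : V -> nat) : \sum_u F u <=
  \sum_(u in matched m) F u + 2 * \sum_(u in matched n) F u + 2 * \sum_(u in rest m n) F u.
  by rewrite (sum_parts acT mmax nmax); clear; lia.
apply: leq_ltn_trans (le _) (leq_trans _ (ge _)).
have -> : \sum_u bad T m u z = 1.
  rewrite (bigD1 v) //= bv big1 // => u /eqP uv.
  by case bu : (bad T m u z) => //; case: uv; apply: bad_uniq bu bv.
have [y [y' r]] := bad_ring zM bv.
have act := actives r.
have cardav : \sum_u avoided T m u z = #|[set u | avoided T m u z]|.
  by rewrite -sum1_card [RHS]big_mkcond; apply: eq_bigr => u _; rewrite inE; case: avoided.
rewrite cardav.
set A := active _ _ _ _ _ _ in act; set S := ring_set v y z (m z) y'.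
have zS : z \in S by rewrite in_ring eqxx !orbT.
have mzS : m z \in S by rewrite in_ring eqxx !orbT.
have : 1 < #|A :\ z :\ m z|.
  have := cardsD1 z A; have := cardsD1 (m z) (A :\ z); move: act; clear.
  by do 2!case: (_ \in _); lia.
case/card_gt1P => s [t [sA tA st]].
have sub s' : s' \in A :\ z :\ m z ->
   [/\ s' \in S, 1 < #|private T v y z (m z) y' s'| & private T v y z (m z) y' s' \subset [set u | avoided T m u z]].
  rewrite 2!in_setD1 => /and3P[smz sz]; rewrite in_set => /andP[sS sP].
  split=> //; first by apply: (card_private acT r).
  apply/subsetP => u us; rewrite inE /avoided.
  by rewrite (private_avoid acT sS zS sz us) (private_avoid acT sS mzS smz us).
have [sS cs ss] := sub s sA; have [tS ct stt] := sub t tA.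
have dis := private_disjoint T sS tS st.
apply: leq_trans (subset_leq_card (_ : private T v y z (m z) y' s :|: private T v y z (m z) y' t \subset _)).
  have := (leq_card_setU (private T v y z (m z) y' s) (private T v y z (m z) y' t)).2.
  by rewrite dis => /eqP ->; move: cs ct; clear; lia.
by rewrite subUset ss stt.
Qed.
End RingSlack.

(** * Five-rings with few active vertices *)

Lemma fAC_even k : fAC k.*2 = k * k.-1.
Proof.
rewrite /fAC odd_double /=; case: k => // k.
have -> : (k.+1.*2 - 1) ^ 2 = (k.+1 * k) * 4 + 1.
  have -> : k.+1.*2 - 1 = k.*2.+1 by lia.
  by rewrite expnS expn1 -!muln2; nia.
by rewrite divnMDl // addn0.
Qed.

Lemma fAC_odd k : 1 < k -> fAC k.*2.+1 = k * k + 1.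
Proof.
move=> k1; rewrite /fAC /= odd_double /= eqSS double_eq0.
have -> : (k == 0) = false by case: k k1.
have -> : (k.*2.+1 == 3) = false by apply/eqP; lia.
have -> : (k.*2.+1 - 1) ^ 2 = (k * k) * 4 by rewrite subn1 /= expnS expn1 -!muln2; nia.
by rewrite mulnK.
Qed.

Lemma fAC_add2 n : 3 < n -> fAC (n + 2) = fAC n + n.
Proof.
move=> n3; rewrite -(odd_double_half n); case: (odd n) => /=.
  have k1 : 1 < n./2 by rewrite -ltn_double; lia.
  have -> : 1 + n./2.*2 + 2 = (n./2.+1).*2.+1 by lia.
  rewrite add1n !fAC_odd //; last by lia.
  by rewrite -muln2; nia.
have -> : 0 + n./2.*2 + 2 = (n./2.+1).*2 by lia.
by rewrite add0n !fAC_even; case: n./2 => // k; rewrite -muln2 /=; nia.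
Qed.

Lemma fAC_add4 n : fAC n + (2 * n + 2) <= fAC (n + 4).
Proof.
have [n3|] := ltnP 3 n.
  by rewrite (_ : n + 4 = n + 2 + 2) ?fAC_add2 //; lia.
by case: n => [|[|[|[|]]]].
Qed.

Definition inside (V : finType) (T : V -> V -> V -> bool) (X : {set V}) :=
  \sum_(a in X) \sum_(b in X) \sum_(c in X) T a b c.

Section RingRemoval.
Variables (V : finType) (T : V -> V -> V -> bool).
Hypothesis acT : acfree T.
Variables s0 s1 s2 s3 s4 : V.
Hypothesis ring : five_ring_on T s0 s1 s2 s3 s4.
Implicit Types a b c d p q v x y z t u : V.
Notation S := (ring_set s0 s1 s2 s3 s4).
Notation P := (ring_paired T s0 s1 s2 s3 s4).
Notation Z := (private T s0 s1 s2 s3 s4).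
Notation act := (active T s0 s1 s2 s3 s4).

Definition ring_degree s := \sum_(u in ~: S) \sum_(x in ~: S) T s u x.

Lemma sum_apexes a b : \sum_c T a b c = #|apexes T a b|.
Proof.
by rewrite -sum1_card [RHS]big_mkcond; apply: eq_bigr => c _; rewrite inE; case: (T a b c).
Qed.

(** Paired vertices have a single apex for s, and an inactive s sees no
    others. *)
Lemma ring_degree_inactive s : s \in S -> s \notin act -> ring_degree s <= #|P|.
Proof.
move=> sS; rewrite inE sS negbK /= => /eqP Z0.
have le u : u \in ~: S -> \sum_(x in ~: S) T s u x <= (u \in P).
  rewrite inE => uS; have le1 : \sum_(x in ~: S) T s u x <= #|apexes T s u|.
    by rewrite -sum_apexes [X in _ <= X](bigID (mem (~: S))) leq_addr.
  apply: leq_trans le1 _; have [uP|uP] := boolP (u \in P).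
    have [p pS /andP[ps pu]] := ring_paired_other s uP.
    have sp : s != p by rewrite eq_sym.
    have [-> //|[x]] := set_0Vmem (apexes T s u); first by rewrite cards0.
    rewrite inE => sux; apply: (@leq_trans #|[set x]|); last by rewrite cards1.
    apply: subset_leq_card.
    apply/subsetP => y; rewrite !inE => suy.
    by rewrite (ring_view_thin acT ring uS sS pS sp sux pu suy).
  have -> // : #|apexes T s u| = 0.
  apply/eqP; rewrite cards_eq0; apply/eqP/setP => x; rewrite !inE.
  apply/negbTE/negP => sux; have : u \in Z s.
    by rewrite in_private uS uP; apply/existsP; exists x.
  by rewrite Z0 inE.
apply: (@leq_trans (\sum_(u in ~: S) (u \in P))); first exact: leq_sum.
rewrite -sum1_card big_mkcond [X in _ <= X]big_mkcond /=; apply: leq_sum => u _.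
by case: (u \in ~: S) => //; case: (u \in P).
Qed.

Lemma sum_ring (F : V -> nat) : \sum_(b in S) F b = \sum_(b <- [:: s0; s1; s2; s3; s4]) F b.
Proof.
have u : uniq [:: s0; s1; s2; s3; s4].
  by apply/card_uniqP; have := card_ring acT ring; rewrite cardsE.
by rewrite big_uniq //; apply: eq_bigl => x; rewrite inE.
Qed.

Lemma ring_row : \sum_(b in S) \sum_(c in S) T s0 b c <= 6.
Proof.
have [s0S s1S s2S s3S s4S] : [/\ s0 \in S, s1 \in S, s2 \in S, s3 \in S & s4 \in S].
  by rewrite !in_ring !eqxx !orbT.
have le b : \sum_(c in S) T s0 b c <= #|apexes T s0 b|.
  by rewrite -sum_apexes [X in _ <= X](bigID (mem S)) leq_addr.
apply: (@leq_trans (\sum_(b in S) #|apexes T s0 b|)); first by apply: leq_sum.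
have le1 a b c : apexes T a b \subset [set c] -> #|apexes T a b| <= 1.
  by move=> h; rewrite -(cards1 c); apply: subset_leq_card.
have le2 a b c d : apexes T a b \subset [set c; d] -> #|apexes T a b| <= 2.
  move=> h; apply: leq_trans (subset_leq_card h) _; rewrite cards2.
  by case: (_ != _).
have b0 : #|apexes T s0 s0| = 0.
  by apply/eqP; rewrite cards_eq0; apply/eqP/setP => x; rewrite !inE (tripleI acT).
have b1 : #|apexes T s0 s1| <= 2.
  apply: (le2 _ _ s2 s4); apply/subsetP => x; rewrite !inE.
  exact: (ring_side acT ring).
have b2 : #|apexes T s0 s2| <= 1.
  apply: (le1 _ _ s1); apply/subsetP => x; rewrite !inE => h.
  by rewrite (ring_diag acT ring h).
have r' : five_ring_on T s0 s4 s3 s2 s1 by case: ring => *; split; tsy.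
have b4 : #|apexes T s0 s4| <= 2.
  apply: (le2 _ _ s3 s1); apply/subsetP => x; rewrite !inE.
  exact: (ring_side acT r').
have b3 : #|apexes T s0 s3| <= 1.
  apply: (le1 _ _ s4); apply/subsetP => x; rewrite !inE => h.
  by rewrite (ring_diag acT r' h).
rewrite sum_ring !big_cons big_nil.
by move: b0 b1 b2 b3 b4; clear; lia.
Qed.
End RingRemoval.

Section RingBound.
Variables (V : finType) (T : V -> V -> V -> bool).
Hypothesis acT : acfree T.
Variables s0 s1 s2 s3 s4 : V.
Hypothesis ring : five_ring_on T s0 s1 s2 s3 s4.
Implicit Types a b c d p q v x y z t u : V.
Notation S := (ring_set s0 s1 s2 s3 s4).
Notation P := (ring_paired T s0 s1 s2 s3 s4).
Notation Z := (private T s0 s1 s2 s3 s4).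
Notation act := (active T s0 s1 s2 s3 s4).

Lemma ring_set_rot t0 t1 t2 t3 t4 : ring_set t0 t1 t2 t3 t4 = ring_set t1 t2 t3 t4 t0 :> {set V}.
Proof. by apply/setP => x; rewrite !in_ring; do 5!case: (x == _). Qed.

Lemma inside_ring : inside T S <= 30.
Proof.
have r1 := ring_rot ring; have r2 := ring_rot r1; have r3 := ring_rot r2.
have r4 := ring_rot r3.
rewrite /inside (sum_ring acT ring) !big_cons big_nil.
have := ring_row acT ring; have := ring_row acT r1; have := ring_row acT r2.
have := ring_row acT r3; have := ring_row acT r4.
have e1 := ring_set_rot s0 s1 s2 s3 s4; have e2 := ring_set_rot s1 s2 s3 s4 s0.
have e3 := ring_set_rot s2 s3 s4 s0 s1; have e4 := ring_set_rot s3 s4 s0 s1 s2.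
by rewrite -e4 -e3 -e2 -e1; clear; lia.
Qed.

(** Since the ring is closed, a triple misses Y, lies in the ring, or consists
    of a vertex of Y and an outside pair. *)
Lemma ring_removal (Y : {set V}) : Y \subset S ->
  ntriples T <= inside T (~: Y) + inside T S + 3 * \sum_(s in Y) ring_degree T s0 s1 s2 s3 s4 s.
Proof.
move=> YS.
pose i1 a b c := T a b c && [&& a \in ~: Y, b \in ~: Y & c \in ~: Y].
pose i2 a b c := T a b c && [&& a \in S, b \in S & c \in S].
pose i3 a b c := T a b c && [&& a \in Y, b \in ~: S & c \in ~: S].
have le a b c : T a b c <= i1 a b c + i2 a b c + (i3 a b c + i3 b a c + i3 c a b).
  rewrite /i1 /i2 /i3 !in_setC; case abc: (T a b c) => //=.
  have bac : T b a c by tsy.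
  have cab : T c a b by tsy.
  rewrite bac cab /=.
  have cl p q t : T p q t -> p \in S -> q \in S -> t \in S by move=> h pS qS; apply: (ring_closed acT ring pS qS h).
  have acb : T a c b by tsy.
  have bca : T b c a by tsy.
  have := cl _ _ _ abc; have := cl _ _ _ acb; have := cl _ _ _ bca.
  have := subsetP YS a; have := subsetP YS b; have := subsetP YS c.
  move: (a \in Y) (b \in Y) (c \in Y) (a \in S) (b \in S) (c \in S).
  by clear; do 6!case=> //=; move=> h1 h2 h3 h4 h5 h6;
    first [by have := h1 isT | by have := h2 isT | by have := h3 isT
      | by have := h4 isT isT | by have := h5 isT isT | by have := h6 isT isT].
have sum3 (A B : {set V}) :
   \sum_a \sum_b \sum_c (T a b c && [&& a \in A, b \in B & c \in B])
   = \sum_(a in A) \sum_(b in B) \sum_(c in B) T a b c.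
  rewrite [RHS]big_mkcond; apply: eq_bigr => a _.
  case aA: (a \in A); last by rewrite big1 // => b _; rewrite big1 // => c _; rewrite andbF.
  rewrite [RHS]big_mkcond; apply: eq_bigr => b _.
  case bB: (b \in B); last by rewrite big1 // => c _; rewrite andbF.
  by rewrite [RHS]big_mkcond; apply: eq_bigr => c _; case: (c \in B); rewrite ?andbT ?andbF.
apply: (@leq_trans (\sum_a \sum_b \sum_c (i1 a b c + i2 a b c + (i3 a b c + i3 b a c + i3 c a b)))).
  by do 3!(apply: leq_sum => ? _).
have e1 : \sum_a \sum_b \sum_c i1 a b c = inside T (~: Y) by exact: (sum3 (~: Y) (~: Y)).
have e2 : \sum_a \sum_b \sum_c i2 a b c = inside T S by exact: (sum3 S S).
have e3 : \sum_a \sum_b \sum_c i3 a b c = \sum_(s in Y) ring_degree T s0 s1 s2 s3 s4 s by exact: (sum3 Y (~: S)).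
have e4 : \sum_a \sum_b \sum_c i3 b a c = \sum_a \sum_b \sum_c i3 a b c.
  by rewrite exchange_big.
have e5 : \sum_a \sum_b \sum_c i3 c a b = \sum_a \sum_b \sum_c i3 a b c.
  under eq_bigr do rewrite exchange_big /=.
  exact: exchange_big.
have add (F G : V -> V -> V -> nat) : \sum_a \sum_b \sum_c (F a b c + G a b c)
   = \sum_a \sum_b \sum_c F a b c + \sum_a \sum_b \sum_c G a b c.
  rewrite -big_split; apply: eq_bigr => a _; rewrite -big_split; apply: eq_bigr => b _.
  by rewrite big_split.
rewrite !add e1 e2 e5 e4 e3; clear; lia.
Qed.

Hypothesis inside_bound : forall X : {set V}, X \proper [set: V] -> inside T X <= 6 * fAC #|X|.

(** Inactive ring vertices have small degree, so deleting them leaves a family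
    that is too small: two of them if at least four outside vertices are
    unpaired, and otherwise four, because two active vertices already need
    four private vertices. *)
Lemma ring_few_active : #|act| <= 3 -> P != ~: S -> ntriples T < 6 * fAC #|V|.
Proof.
move=> act3 PS; have cS := card_ring acT ring; have cSC := cardsC S; rewrite cS in cSC.
have PsubS : P \subset ~: S by apply/subsetP => u; rewrite !in_set => /andP[].
have cP : #|P| < #|~: S| by apply: proper_card; rewrite properEneq PS.
have removal (Y : {set V}) : Y \subset S :\: act -> 0 < #|Y| ->
    ntriples T <= 6 * fAC (#|V| - #|Y|) + 30 + 3 * (#|Y| * #|P|).
  move=> YS Y0; have YS' : Y \subset S by apply: subset_trans YS (subsetDl _ _).
  apply: leq_trans (ring_removal YS') _; apply: leq_add; first apply: leq_add.
  - have := cardsC Y; rewrite addnC => e.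
    rewrite -e addnK; apply: inside_bound; rewrite properEcard subsetT cardsT -e.
    by move: Y0; clear; lia.
  - exact: inside_ring.
  - rewrite leq_mul2l /= -sum_nat_const; apply: leq_sum => s sY.
    have := subsetP YS s sY; rewrite in_setD => /andP[sa sS].
    exact: ring_degree_inactive.
have actS : act \subset S by apply/subsetP => s; rewrite inE => /andP[].
have cI : #|S :\: act| = 5 - #|act| by rewrite cardsDS // cS.
(* at least four outside vertices are unpaired in this case *)
have [U4|U4] := leqP (#|P| + 9) #|V|.
  have : 1 < #|S :\: act| by rewrite cI; move: act3; clear; lia.
  case/card_gt1P => a [b [aI bI ab]].
  have YI : [set a; b] \subset S :\: act by rewrite subUset !sub1set aI bI.
  have := removal _ YI; rewrite cards2 ab /= => /(_ isT).
  have n2 : 3 < #|V| - 2 by move: U4; clear; lia.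
  have := fAC_add2 n2; rewrite subnK; last by move: U4; clear; lia.
  move: U4; clear; move: #|V| #|P| (ntriples T) => n p t.
  by move: (fAC n) (fAC (n - 2)) => f g; lia.
have act1 : #|act| <= 1.
  rewrite leqNgt; apply/negP => /card_gt1P[s [t [sA tA st]]].
  move: sA tA; rewrite !inE => /andP[sS sP] /andP[tS tP].
  have sS' : s \in S by rewrite !inE.
  have tS' : t \in S by rewrite !inE.
  have dis := private_disjoint T sS' tS' st.
  have c1 := card_private acT ring sS' sP; have c2 := card_private acT ring tS' tP.
  have : #|Z s :|: Z t| = #|Z s| + #|Z t|.
    by have := (leq_card_setU (Z s) (Z t)).2; rewrite dis => /eqP.
  have : #|Z s :|: Z t| <= #|~: S :\: P|.
    apply: subset_leq_card; apply/subsetP => u; rewrite in_setU !in_private in_setD in_setC.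
    by case/orP=> /and3P[-> ->].
  rewrite cardsDS //; move: c1 c2 cSC cP U4; clear; lia.
have : 3 < #|S :\: act| by rewrite cI; move: act1; clear; lia.
have [s sS actss] : exists2 s, s \in S & act \subset [set s].
  have [->|[s sA]] := set_0Vmem act.
    by exists s0; rewrite ?sub0set // in_ring eqxx.
  exists s; first by apply: (subsetP actS).
  apply/subsetP => t tA; rewrite inE; apply: contraLR act1 => ts; rewrite -ltnNge.
  by apply/card_gt1P; exists t, s.
move=> _; have YI : S :\ s \subset S :\: act by apply: setDS.
have cY : #|S :\ s| = 4 by have := cardsD1 s S; rewrite sS cS => -[].
have := removal _ YI; rewrite cY => /(_ isT).
have n4 : 4 <= #|V| by rewrite -cSC.
have := @fAC_add4 (#|V| - 4); rewrite subnK //.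
move: cP cSC; clear; move: #|~: S| #|V| #|P| (ntriples T) => c n p t.
by move: (fAC n) (fAC (n - 4)) => f g; lia.
Qed.
End RingBound.

(** * Tightly paired blocks *)

(** The common outcome of the equality cases: blocks {a, k a} covering K, with
    full weight between them. The last two clauses restrict the thick pairs
    that leave K. *)
Record tight_pairs (V : finType) (T : V -> V -> V -> bool) (K : {set V}) (k : V -> V) : Prop :=
  TightPairs {
  pairs_stable : forall a, a \in K -> k a \in K;
  pairs_inv : forall a, a \in K -> k (k a) = a;
  pairs_thick : forall a, a \in K -> thick T a (k a);
  pairs_full : forall a c, a \in K -> c \in K -> c != a -> c != k a ->
    weight T a c + weight T a (k c) = 6;
  outside_one_thick : forall z a b, z \notin K -> a \in K -> b \in K ->
    thick T z a -> thick T z b -> a = b;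
  outside_thick_leaf : forall z c d, z \notin K -> c \in K -> thick T z c ->
    thick T (k c) d -> d = c }.

Definition full_view (V : finType) (T : V -> V -> V -> bool) (K : {set V}) (k : V -> V) a :=
  forall c, c \in K -> a != c -> a != k c -> weight T a c + weight T a (k c) = 6.

Section Pairs.
Variables (V : finType) (T : V -> V -> V -> bool) (K : {set V}) (k : V -> V).
Hypothesis acT : acfree T.
Hypothesis tp : tight_pairs T K k.
Notation w := (weight T).
Implicit Types a b c d p q v x y z t u : V.

Let kK := pairs_stable tp.
Let kk := pairs_inv tp.
Let kth := pairs_thick tp.

Lemma pair_neq a : a \in K -> k a != a.
Proof. by move=> /kth /(thick_neq acT); rewrite eq_sym. Qed.

Lemma full_in a : a \in K -> full_view T K k a.
Proof.
move=> aK c cK ac akc; apply: (pairs_full tp) => //; first by rewrite eq_sym.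
by apply: contraNneq akc => ->; rewrite kk.
Qed.

Lemma apex_via z a b c : thick T a z -> thick T z b -> T a b c -> c = z.
Proof. by move=> h1 h2; apply: (thick_star_apex acT) => //; rewrite (thickC acT). Qed.

(** Since az is thick, the pair of a and k z has weight 6, and its apex must
    be z, where two thick pairs meet. *)
Lemma thick_end a z : full_view T K k a -> z \in K -> thick T a z -> a != k z -> T a z (k z).
Proof.
move=> fa zK az akz; have anz := thick_neq acT az.
have := fa z zK anz akz; rewrite (weight_thick az) add0n => w6.
have thk : thin T a (k z) by apply: weight_gt0; rewrite w6.
have [q h] := thin_apex thk.
by have e := apex_via az (kth zK) h; subst; tsy.
Qed.

Lemma weight3 a b c : thin T a b -> T a b c -> thin T a c -> thick T b c -> w a b = 3.
Proof. by move=> h1 h2 h3 h4; rewrite (weight_thin h1 h2) h3 (thick_nthin h4). Qed.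

Lemma weight6_thick a b c : w a b = 6 -> T a b c -> thick T a c /\ thick T b c.
Proof.
move=> w6 abc; have tab : thin T a b by apply: weight_gt0; rewrite w6.
have acb : T a c b by tsy.
have bca : T b c a by tsy.
move: w6; rewrite (weight_thin tab abc).
have [//|h1] := boolP (thick T a c); last first.
  by rewrite (nthick_thin acb h1); case: (thin T b c).
move=> ac; have [//|h2] := boolP (thick T b c); last first.
by rewrite (nthick_thin bca h2); case: (thin T a c).
Qed.

(** A path view of the block of c reproduces itself at the blocks of y and y',
    which a sees along paths as well. With t' the partner of y' and p' the
    apex of a t', the full weight of y on the blocks of y' and of p' then
    leaves no admissible apex. *)
Lemma no_path a c y y' : full_view T K k a -> c \in K -> a != c -> a != k c ->
  y != y' -> T a c y -> T a (k c) y' -> T c (k c) y -> T c (k c) y' ->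
  (forall t, T c (k c) t -> (t == y) || (t == y')) ->
  thin T a c -> thin T a (k c) -> thin T a y -> thin T a y' -> False.
Proof.
move=> fa cK ac ad; have := kth cK; have := kK cK; have := kk cK.
move: ad; set d := k c => ad kd dK cd yy' acy ady' cdy cdy' Dcd tac tad tay tay'.
have cy : thick T c y by apply: (@thick_two _ T c y a d); [tsy|tsy|neq].
have dy' : thick T d y' by apply: (@thick_two _ T d y' a c); [tsy|tsy|neq].
have yK : y \in K.
  apply: contraT => yK; have yc : thick T y c by rewrite (thickC acT).
  have e := outside_thick_leaf tp yK cK yc dy'; subst y'; irr.
have y'K : y' \in K.
  apply: contraT => y'K; have yc : thick T y' d by rewrite (thickC acT).
  have cy' : thick T (k d) y by rewrite kd.
  have e := outside_thick_leaf tp y'K dK yc cy'; by move: cdy; rewrite e => ?; irr.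
have [t et] : exists t, t = k y by exists (k y).
have [t' et'] : exists t', t' = k y' by exists (k y').
have yt : thick T y t by rewrite et; apply: kth.
have y't' : thick T y' t' by rewrite et'; apply: kth.
have tK : t \in K by rewrite et kK.
have t'K : t' \in K by rewrite et' kK.
have kt : k t = y by rewrite et kk.
have kt' : k t' = y' by rewrite et' kk.
have dc : thick T d c by rewrite (thickC acT).
have y'd : thick T y' d by rewrite (thickC acT).
have yc : thick T y c by rewrite (thickC acT).
have cy'd : forall q, T c y' q -> q = d by move=> q; apply: apex_via.
have dyc : forall q, T d y q -> q = c by move=> q; apply: apex_via.
have nyc : y != c by neq.
have nyd : y != d by neq.
have ny'c : y' != c by neq.
have ny'd : y' != d by neq.
have ntc : t != c by apply: contra_neq nyd => e; rewrite -kt e.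
have ntd : t != d by apply: contra_neq nyc => e; rewrite -kt e kd.
have nt'c : t' != c by apply: contra_neq ny'd => e; rewrite -kt' e.
have nt'd : t' != d by apply: contra_neq ny'c => e; rewrite -kt' e kd.
have ty' : t != y'.
  apply/eqP => e; have h : T c t d by rewrite e; tsy.
  by move: nyd; rewrite (apex_via cy yt h) eqxx.
have ntt' : t != t' by apply: contra_neq yy' => e; rewrite -kt e.
have yt'n : y != t' by apply: contra_neq ty' => e; rewrite et e kt'.
have nay : a != y by neq.
have nay' : a != y' by neq.
have nat_ : a != t by apply/eqP => e; subst a; move: tay; rewrite (thinC acT) (thick_nthin yt).
have nat' : a != t' by apply/eqP => e; subst a; move: tay'; rewrite (thinC acT) (thick_nthin y't').
have ayc : T a y c by tsy.
have ay'd : T a y' d by tsy.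
(* a block with one end y already seen is again seen along a path *)
have step z s r : z \in K -> s = k z -> thin T a z -> T a z r -> thin T a r -> thick T z r ->
    a != z -> a != s -> r != s ->
    exists p, [/\ T a s p, p != r, T z s r & T z s p] /\
      [/\ forall q, T z s q -> (q == r) || (q == p), thin T a s & thin T a p].
  move=> zK es taz azr tar zr naz nas nrs.
  have zs : thick T z s by rewrite es; apply: kth.
  have wz : w a z = 3 by apply: (weight3 taz azr).
  have := fa z zK naz; rewrite -es => /(_ nas) w6.
  have := thick_viewP acT a zs; case.
  - by move=> h _; move: nrs; rewrite (thin_eq taz azr (_ : T a z s)) ?eqxx //; tsy.
  - by move=> _ _ h; move: w6; rewrite wz h.
  - by move=> _ _ h; rewrite h in wz.
  - move=> q _ h1 h2 h3; by move: tar; rewrite (thin_eq taz azr h1) (thick_nthin h3).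
  - move=> q q' _ qq' h1 h2 h3 h4 h5 h6 h7 h8 h9 _ _.
    have e : q = r by apply: (thin_eq taz). 
    subst q; exists q'; split; split=> //.
    by rewrite eq_sym.
  - by move=> q q' _ _ h; rewrite h in wz.
have [p [[atp pc yztc ytp] [Dyt tat tap]]] :
    exists p, [/\ T a t p, p != c, T y t c & T y t p] /\
      [/\ forall q, T y t q -> (q == c) || (q == p), thin T a t & thin T a p].
  by apply: (step y t c) => //; rewrite eq_sym.
have [p' [[at'p' p'd y't'd y't'p'] [Dy't' tat' tap']]] :
    exists p, [/\ T a t' p, p != d, T y' t' d & T y' t' p] /\
      [/\ forall q, T y' t' q -> (q == d) || (q == p), thin T a t' & thin T a p].
  by apply: (step y' t' d) => //; rewrite eq_sym.
have t'p' : thick T t' p'.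
  by apply: (@thick_two _ T t' p' a y'); [tsy|tsy|].
have nacov x r : thin T a x -> T a x r -> forall r', T a x r' -> r' = r.
  by move=> h1 h2 r' h3; apply: (thin_eq h1).
have nyy' q : ~~ T y y' q.
  apply/negP => h; have ncyy' : ~~ T y c y'.
    by apply/negP => h'; (have h2 : T c y' y by tsy); rewrite (cy'd _ h2) eqxx in nyd.
  have y'yq : T y' y q by tsy.
  have y'cd : T y' c d by tsy.
  case: (thick_pair_view acT yc ncyy' y'yq y'cd) => _ _ [[e _]|[_ _ _ only]].
    by subst q; (have h2 : T d y y' by tsy); rewrite (dyc _ h2) eqxx in ny'c.
  have ya : T y c a by tsy.
  have yd : T y c d by tsy.
  have yt1 : T y c t by tsy.
  have nda : a != d by [].
  have nta := nat_.
  move: (only _ ya) (only _ yt1); rewrite (negbTE nda) (negbTE ntd) !orbF.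
  by move/eqP=> e /eqP e2; rewrite e e2 eqxx in nta.
have wyt' : w y t' = 6.
  have := pairs_full tp yK y'K; rewrite -et -et' eq_sym yy' => /(_ isT).
  rewrite eq_sym ty' => /(_ isT).
  rewrite weight_nthin //; apply/negP => /thin_apex[q h].
  by have := nyy' q; rewrite h.
have tyt' : thin T y t' by apply: weight_gt0; rewrite wyt'.
have [q yt'q] := thin_apex tyt'.
have [yq t'q] := weight6_thick wyt' yt'q.
have at'y : ~~ T a t' y.
  apply/negP => h; have h2 : T a y t' by tsy.
  by rewrite (thin_eq tay h2 ayc) eqxx in nt'c.
have nca : c != p'.
  apply/eqP => e; subst p'; have h2 : T a c t' by tsy.
  by rewrite (thin_eq tac h2 acy) eqxx in yt'n.
have nqc : q != c.
  apply/eqP => e; subst q.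
  have t'c : thick T c t' by rewrite (thickC acT).
  have t'y' : thick T t' y' by rewrite (thickC acT).
  have h2 : T c y' d by tsy.
  by have e := apex_via t'c t'y' h2; rewrite e eqxx in nt'd.
have eq_ : q = p'.
  apply/eqP; apply: contraT => qp'.
  have nqa : q != a.
    apply/eqP => e; subst q; have h2 : T a y t' by tsy.
    by rewrite (thin_eq tay h2 ayc) eqxx in nt'c.
  have np'y : p' != y by apply: contraNneq at'y => <-.
  have nct' : c != t' by rewrite eq_sym.
  have p'q : p' != q by rewrite eq_sym.
  have ncq : c != q by rewrite eq_sym.
  by Afree a y t' c p' q.
subst q; have yp' := yq.
have p'K : p' \in K.
  apply: contraT => p'K; have h1 : thick T p' y by rewrite (thickC acT).
  have h2 : thick T p' t' by rewrite (thickC acT).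
  by have e := outside_one_thick tp p'K yK t'K h1 h2; rewrite e eqxx in yt'n.
have [r er] : exists r, r = k p' by exists (k p').
have kr : k r = p' by rewrite er kk.
have rK : r \in K by rewrite er kK.
have ap't' : T a p' t' by tsy.
(* y p' is thick by now and viewed by a, which exhausts its apexes *)
have nayp' : ~~ T y p' a.
  apply/negP => h; have h2 : T a y p' by tsy.
  by rewrite (thin_eq tay h2 ayc) eqxx in nca.
have [Dyp'c Dyp'] : T y p' c /\ forall s, T y p' s -> (s == c) || (s == t').
  case: (thick_pair_view acT yp' nayp' ayc ap't') => _ _ [[e _]|[_ h _ only]] //.
  by rewrite e eqxx in nt'c.
have [ep|np't] := eqVneq p' t.
  rewrite ep in y't'p'.
  have h1 : T c t y by tsy.
  have h2 : T t y' t' by tsy.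
  have h3 : T c y' d by tsy.
  have n1 : y != d := nyd.
  by Afree c t y' y d t'; rewrite eq_sym.
have np'c : p' != c by rewrite eq_sym.
have np'y : p' != y by apply: contraNneq at'y => <-.
have nyr : y != r by apply: contra_neq np't => e; rewrite -kr -e et.
have := pairs_full tp yK p'K np'y; rewrite -et -er => /(_ np't).
rewrite (weight_thick yp') add0n => wyr.
have tyr : thin T y r by apply: weight_gt0; rewrite wyr.
have [s yrs] := thin_apex tyr.
have p'r : thick T p' r by rewrite er; apply: kth.
have e := apex_via yp' p'r yrs; subst s.
have h : T y p' r by tsy.
have := Dyp' _ h; case/orP => /eqP e.
  by move: p'd; rewrite -kr e -/d eqxx.
have e2 : p' = y' by rewrite -kr e kt'.
by have := yq; move: (nyy' t'); rewrite -e2 => /negP []; tsy.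
Qed.
End Pairs.

(** * Domination and links between blocks *)

Section Relation.
Variables (V : finType) (T : V -> V -> V -> bool) (K : {set V}) (k : V -> V).
Hypothesis acT : acfree T.
Hypothesis tp : tight_pairs T K k.
Notation w := (weight T).
Implicit Types a b c d g h p q v x y z t u : V.

Let kK := pairs_stable tp.
Let kk := pairs_inv tp.
Let kth := pairs_thick tp.

Lemma k_neq a c : a \in K -> c \in K -> c != a -> c != k a ->
  [/\ a != c, a != k c, k c != a, k c != k a & k a != c].
Proof.
move=> aK cK ca cka; have akc : a != k c by apply: contraNneq cka => ->; rewrite kk.
have kaka : k c != k a by apply: contraNneq ca => e; rewrite -(kk cK) e kk.
by split=> //; rewrite eq_sym.
Qed.

Variant full_view_spec a c : Prop :=
| FullApex of T c (k c) a
| FullLeft of w a c = 6 & ~~ thin T a (k c)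
| FullRight of w a (k c) = 6 & ~~ thin T a c
| FullTwin y of T a c y & T a (k c) y & thick T a y & thin T a c & thin T a (k c)
    & thin T c y & w a c = 3.

(** [no_path] excludes path views, and five-ring views have weight 12. *)
Lemma full_viewP a c : full_view T K k a -> c \in K -> a != c -> a != k c ->
  full_view_spec a c.
Proof.
move=> fa cK ac akc; have w6 := fa c cK ac akc.
case: (thick_viewP acT a (kth cK)) => [h e|nh nt e lew|nh nt e lew|y nh g1 g2 g3 t1 t2 t3 t4 e1 e2|y y' nh yy' g1 g2 g3 g4 only t1 t2 t3 t4 e1 e2|y y' nh r e1 e2].
- exact: FullApex.
- by apply: FullLeft => //; rewrite -w6 e addn0.
- by apply: FullRight => //; rewrite -w6 e.
- exact: (FullTwin g1 g2).
- by case: (no_path acT tp fa cK ac akc yy' g1 g2).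
- by rewrite e1 e2 in w6.
Qed.

(** The apex z of a thin pair of weight 6 is thick to both its ends. If z
    belonged to a third block, [thick_end] would give C; if it were outside K,
    it would be thick to two vertices of K. *)
Lemma view6 a c : a \in K -> c \in K -> c != a -> c != k a -> w a c = 6 ->
  T c (k c) a \/ T a (k a) c /\ thick T (k a) c.
Proof.
move=> aK cK ca cka w6; have [ac akc _ _ _] := k_neq aK cK ca cka.
have tac : thin T a c by apply: weight_gt0; rewrite w6.
have [z acz] := thin_apex tac; have [az cz] := weight6_thick acT w6 acz.
have [e|zka] := eqVneq z (k a).
  by subst z; right; split; [tsy|rewrite (thickC acT)].
have [e|zkc] := eqVneq z (k c); first by subst z; left; tsy.
have zK : z \in K.
  apply: contraT => zK; rewrite (thickC acT) in az; rewrite (thickC acT) in cz.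
  by have e := outside_one_thick tp zK aK cK az cz; rewrite e eqxx in ca.
have az' := thick_end acT tp (full_in tp aK) zK az.
have cz' := thick_end acT tp (full_in tp cK) zK cz.
have h1 : T a z (k z) by apply: az'; apply: contra_neq zka => ->; rewrite kk.
have h2 : T c z (k z) by apply: cz'; apply: contra_neq zkc => ->; rewrite kk.
by Cfree a c (k z) z.
Qed.

(** Any other view of the block of a by c contradicts one of the hypotheses on
    ac and ay. *)
Lemma view_twin a c y : a \in K -> c \in K -> c != a -> c != k a ->
  T a c y -> thick T a y -> thin T a c -> thin T c y -> w a c = 3 -> T a (k a) c.
Proof.
move=> aK cK ca cka acy ay tac tcy w3; have [ac akc _ _ _] := k_neq aK cK ca cka.
have cay : T c a y by tsy.
case: (full_viewP (full_in tp cK) aK ca cka) => [//|h _|h1 h2|y2 h1 h2 h3 h4 h5 h6 h7].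
- by rewrite (weightC acT) w3 in h.
- by rewrite (thinC acT) tac in h2.
- have e : y2 = y by apply: (thin_eq h4).
  by subst; rewrite (thick_nthin ay) in h6.
Qed.

Lemma block_view_rel a c : a \in K -> c \in K -> c != a -> c != k a ->
  [\/ T c (k c) a, T a (k a) c /\ T a (k a) (k c), T a (k a) c /\ thick T (k a) c
    | T a (k a) (k c) /\ thick T (k a) (k c)].
Proof.
move=> aK cK ca cka; have [ac akc kca kcka kac] := k_neq aK cK ca cka.
have kcK := kK cK.
case: (full_viewP (full_in tp aK) cK ac akc) => [h|h _|h _|y h1 h2 h3 h4 h5 h6 h7].
- exact: Or41.
- by case: (view6 aK cK ca cka h) => ?; [apply: Or41|apply: Or43].
- case: (view6 aK kcK kca kcka h); last by move=> ?; apply: Or44.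
  by rewrite kk // => ?; apply: Or41; tsy.
- apply: Or42; split.
    exact: (view_twin aK cK ca cka h1).
  have akkc : a != k (k c) by rewrite kk.
  case: (full_viewP (full_in tp aK) kcK akc akkc) => [g|g1 g2|g1 g2|y' g1 g2 g3 g4 g5 g6 g7].
  + rewrite kk // in g; have e : y = k c by apply: (thin_eq h4); [|tsy].
    by subst y; rewrite thick_nthin // in h6; apply: kth.
  + by rewrite kk // h4 in g2.
  + by rewrite h5 in g2.
  + by apply: (view_twin aK kcK kca kcka g1).
Qed.

(** The triples of a 4-extension on its new vertices k a, a, c, k c. *)
Definition linked a c := [/\ T (k a) a c, T a c (k c) & thick T a c].

(** If neither block dominates the other, [block_view_rel], applied to both
    blocks in both roles, yields a thick pair between them, and [thick_end]
    turns it into a link. *)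
Lemma block_rel a c : a \in K -> c \in K -> c != a -> c != k a ->
  [\/ T a (k a) c /\ T a (k a) (k c), T c (k c) a /\ T c (k c) (k a) |
   [\/ linked a c, linked a (k c), linked (k a) c | linked (k a) (k c)] ].
Proof.
move=> aK cK ca cka; have [ac akc kca kcka kac] := k_neq aK cK ca cka.
have kaK := kK aK; have kcK := kK cK.
have half x y : x \in K -> y \in K -> y != x -> y != k x -> ~~ T y (k y) x ->
   [\/ T x (k x) y /\ T x (k x) (k y), linked (k x) y | linked (k x) (k y)].
  move=> xK yK yx ykx nyx; have [n1 n2 n3 n4 n5] := k_neq xK yK yx ykx.
  have kxK := kK xK; have kyK := kK yK.
  have mk y' : y' \in K -> y' != x -> y' != k x -> T x (k x) y' -> thick T (k x) y' ->
     T x (k x) (k y') \/ linked (k x) y'.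
    move=> y'K y'x y'kx h1 h2; rewrite /linked kk //.
    have := thick_end acT tp (full_in tp kxK) y'K h2.
    have [_ _ _ n _] := k_neq xK y'K y'x y'kx.
    by rewrite eq_sym n => /(_ isT) h; right; split=> //.
  case: (block_view_rel xK yK yx ykx) => [h|h|[h1 h2]|[h1 h2]].
  - by rewrite h in nyx.
  - exact: Or31.
  - by case: (mk y yK yx ykx h1 h2) => ?; [apply: Or31|apply: Or32].
  - have := mk (k y) kyK n3 n4 h1 h2; rewrite kk // => -[?|?]; [apply: Or31|apply: Or33] => //.
have [h1|h1] := boolP (T c (k c) a); last first.
  by case: (half a c aK cK ca cka h1) => h; [apply: Or31|apply: Or33; apply: Or43|apply: Or33; apply: Or44].
have [h2|h2] := boolP (T c (k c) (k a)); first by apply: Or32.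
have ckka : c != k (k a) by rewrite kk.
have cka' : c != k a by [].
case: (half (k a) c kaK cK cka' ckka h2); rewrite kk //.
- by case=> g1 g2; apply: Or31; split; tsy.
- by move=> h; apply: Or33; apply: Or41.
- by move=> h; apply: Or33; apply: Or42.
Qed.
End Relation.

(** * A block above all others *)

Section Top.
Variables (V : finType) (T : V -> V -> V -> bool) (K : {set V}) (k : V -> V).
Hypothesis acT : acfree T.
Hypothesis tp : tight_pairs T K k.
Hypothesis dominated : forall a b, a \in K -> b \notin K -> T a (k a) b.
Notation w := (weight T).
Implicit Types a b c d g h p q v x y z t u : V.

Let kK := pairs_stable tp.
Let kk := pairs_inv tp.
Let kth := pairs_thick tp.

(** Otherwise g has weight 6 on k c, and the partner of g continues the chain
    at k c. Closing the chain through g yields A, or a five-ring one of whose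
    sides has a third apex. *)
Lemma chain_apex a c g : a \in K -> c \in K -> c != a -> c != k a -> linked T k a c ->
  g \in K -> g != c -> g != k c -> T a (k a) g -> T c (k c) g.
Proof.
move=> aK cK ca cka; rewrite /linked.
have [ac akc kca kcka kac] := k_neq tp aK cK ca cka.
have kb : k (k a) = a by apply: kk.
have kd : k (k c) = c by apply: kk.
have dK : k c \in K by apply: kK.
have ab : thick T a (k a) by apply: kth.
have cd : thick T c (k c) by apply: kth.
move: kb kd dK ab cd ac akc kca kcka kac cka; set b := k a; set d := k c.
move=> kb kd dK ab cd ac ad ca' db bc cb [bac acd tac] gK gc gd abg.
have nga : g != a by neq.
have ngb : g != b by neq.
have nd z : T c g z -> z = d.
  move=> cgz; apply/eqP; apply: contraT => zd.
  have [e|za] := eqVneq z a; first by subst z; Cfree c b g a.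
  have [e|zb] := eqVneq z b.
    subst z; have h : T b c g by tsy.
    by have e := thick_star_apex acT ab tac h; subst g; rewrite eqxx in nga.
  have dg : d != g by rewrite eq_sym.
  have bd : b != d by rewrite eq_sym.
  by Afree a c g d b z; rewrite eq_sym.
have gK' := full_in tp gK.
case: (full_viewP acT tp gK' cK gc gd) => [//|h _|h nt|y h1 h2 _ _ _ _ _].
- have tgc : thin T g c by apply: weight_gt0; rewrite h.
  have [z gcz] := thin_apex tgc; have cgz : T c g z by tsy.
  have e := nd _ cgz; subst z; tsy.
- have cg : c != g by rewrite eq_sym.
  have dg : d != g by rewrite eq_sym.
  have [ckg dkg kgd ckg' dkg'] : [/\ c != k g, d != k g, k g != d, k g != c & k g != d].
    have e x : x \in K -> k x != g -> x != k g.
      by move=> xK; apply: contra_neq => ->; rewrite kk.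
    have h1 : c != k g by apply: e => //; rewrite eq_sym.
    have h2 : d != k g by apply: e => //; rewrite kd eq_sym.
    by split=> //; rewrite eq_sym.
  case: (view6 acT tp gK dK dg dkg h); rewrite ?kd; first by move=> ?; tsy.
  case=> ghd hd; have hK := kK gK; have gh := kth gK.
  move: ghd hd hK gh ckg dkg kgd ckg' {dkg'}; set h' := k g => ghd hd hK gh ch dh hd' hc.
  have hcd : T h' d c.
    have := thick_end acT tp (full_in tp hK) dK hd; rewrite kd; exact.
  have kh : k h' = g by apply: kk.
  have ac1 : thick T a c by [].
  have ha : h' != a by apply: contra_neq ngb => e; rewrite -kh e.
  have hb : h' != b by apply: contra_neq nga => e; rewrite -kh e.
  have [abh|nabh] := boolP (T a b h').
    (* h' sees the thick pair a c along b and d, which closes a five-ring *)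
    have nach : ~~ T a c h' by apply/negP => x; Cfree b c h' a.
    have hab : T h' a b by tsy.
    have hcd' : T h' c d by tsy.
    have [tha thc] := thick_pair_view acT tac nach hab hcd'.
    case=> [[e _]|[bd acb acd' only]]; first by subst d; rewrite e eqxx in db.
    have db' : d != b by [].
    have r : five_ring_on T h' d c a b.
      apply: (thick_pair_ring acT db') => //; tsy.
    have r' : five_ring_on T a b h' d c by case: r => *; split; tsy.
    have := ring_side acT r' abg.
    have nhg : g != h' by rewrite -kh; apply: (pair_neq acT tp).
    by rewrite (negbTE nhg) (negbTE gc).
  have relb := block_view_rel acT tp (pairs_stable tp aK) gK.
  have rela := block_view_rel acT tp aK gK nga ngb.
  rewrite -/b -/h' (negbTE nabh) kb in rela relb.
  have {}relb := relb ngb nga.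
  have nbah : ~~ T b a h' by rewrite (tripleCl acT).
  have {}rela : T g h' a \/ thick T b g.
    case: rela => [?|[_ f]|[_ ?]|[f _]]; [by left| by []|by right|by []].
  have {}relb : T g h' b \/ thick T a g.
    case: relb => [?|[_ f]|[_ ?]|[f _]]; [by left| |by right|]; by rewrite f in nbah.
  case: rela relb => [gha|tbg] [ghb|tag].
  + by Cfree a b h' g.
  + (* a five-ring a c d h' g, of which a c is a side with the third apex b *)
    have nad : ~~ T d h' a.
      apply/negP => x; have adh : T a d h' by tsy.
      have dc : thick T c d by [].
      by have e := apex_via acT tac cd adh; rewrite e eqxx in hc.
    have dh' : thick T d h' by rewrite (thickC acT).
    have adc : T a d c by tsy.
    have ahg : T a h' g by tsy.
    have [tad tah] := thick_pair_view acT dh' nad adc ahg.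
    case=> [[e _]|[ncg dhc dhg only]]; first by rewrite e eqxx in gc.
    have r : five_ring_on T a c d h' g by apply: (thick_pair_ring acT ncg).
    have acb : T a c b by tsy.
    have := ring_side acT r acb; rewrite eq_sym (negbTE db).
    by rewrite eq_sym (negbTE ngb).
  + (* the six-cycle b a c d h' g gives A on its alternate vertices *)
    have h1 : T c b a by tsy.
    have h2 : T c h' d by tsy.
    have h3 : T b h' g by tsy.
    by Afree c b h' a d g; rewrite eq_sym.
  + by case: (thick_triangle_free acT ab tag tbg).
- have cgy : T c g y by tsy.
  by have e := nd _ cgy; rewrite e in h2; case: (triple_neq23 acT h2).
Qed.

Lemma linked_sym a c : a \in K -> c \in K -> linked T k a c -> linked T k c a.
Proof. by move=> aK cK [h1 h2 h3]; split; [tsy|tsy|rewrite (thickC acT)]. Qed.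

(** By [block_rel] an end of the block of g is an apex of the pair a, k a. If
    the other end were not, the way it sees the two pairs of the chain would
    give C or a five-ring with a third apex on a side. *)
Lemma chain_apex_both a c g : a \in K -> c \in K -> c != a -> c != k a -> linked T k a c ->
  g \in K -> g != a -> g != k a -> g != c -> g != k c ->
  ~ (T g (k g) a /\ T g (k g) (k a)) ->
  T a (k a) g /\ T c (k c) g.
Proof.
move=> aK cK ca cka l gK ga gka gc gkc ndom.
have [ac akc kca kcka kac] := k_neq tp aK cK ca cka.
have l' := linked_sym aK cK l.
have kkg := kk gK.
have hK := kK gK.
have [hga hgka hgc hgkc] : [/\ k g != a, k g != k a, k g != c & k g != k c].
  by split; [apply: contra_neq gka|apply: contra_neq ga|apply: contra_neq gkc|apply: contra_neq gc]
    => e; rewrite -(kk gK) e ?kk.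
(* if one end of a block is an apex of a, k a, then so is the other *)
have one x : x \in K -> x != a -> x != k a -> x != c -> x != k c ->
    k x != a -> k x != k a -> k x != c -> k x != k c ->
    T a (k a) x -> T a (k a) (k x).
  move=> xK xa xka xc xkc kxa kxka kxc kxkc abx; apply: contraT => nabh.
  have cdx := chain_apex aK cK ca cka l xK xc xkc abx.
  have hxK := kK xK.
  have nm : ~~ T (k a) a (k x) by rewrite (tripleCl acT).
  have ncdh : ~~ T c (k c) (k x).
    by apply: contra nabh; apply: (chain_apex cK aK).
  have nm' : ~~ T (k c) c (k x) by rewrite (tripleCl acT).
  case: (l) => bac acd tac.
  have viewc p : p \in K -> x != p -> x != k p -> ~~ T p (k p) (k x) ->
      T x (k x) p \/ thick T (k p) x.
    move=> pK xp xkp np; case: (block_view_rel acT tp pK xK xp xkp) => [?|[_ f]|[_ ?]|[f _]].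
    - by left.
    - by rewrite f in np.
    - by right.
    - by rewrite f in np.
  have kaK := kK aK; have kcK := kK cK.
  have xkka : x != k (k a) by rewrite kk.
  have xkkc : x != k (k c) by rewrite kk.
  have ra := viewc a aK xa xka nabh.
  have rb := viewc (k a) kaK xka xkka; rewrite kk // in rb.
  have {}rb := rb nm.
  have rc := viewc c cK xc xkc ncdh.
  have rd := viewc (k c) kcK xkc xkkc; rewrite kk // in rd.
  have {}rd := rd nm'.
  have h1 : T x a (k a) by tsy.
  have h2 : T x c (k c) by tsy.
  case: ra rb => [xha|tbx] [xhb|tax].
  - by Cfree a (k a) (k x) x.
  - (* x and c are both thick to a, so x c has no apex but a *)
    have cx : thick T c a by rewrite (thickC acT).
    have h3 : T c x (k c) by tsy.
    have e := apex_via acT cx tax h3; by rewrite e eqxx in akc.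
  - have [tdx|tcx] : thick T (k c) x \/ thick T c x.
      case: rc rd => [xhc|tdx] [xhd|tcx]; [|by right|by left|by left].
      by Cfree c (k c) (k x) x.
      (* a five-ring x, k a, a, c, k c whose first side has the further apex k x *)
      have nacx : ~~ T a c x by apply/negP => f; Cfree (k a) c x a.
      have [txa txc] := thick_pair_view acT tac nacx h1 h2.
      case=> [[e _]|[nbd acb acd' only]]; first by rewrite e eqxx in kcka.
      have tbx' : thick T x (k a) by rewrite (thickC acT).
      have r : five_ring_on T x (k a) a c (k c).
        by apply: (thick_pair_ring acT nbd).
      have := ring_side acT r (_ : T x (k a) (k x)); rewrite (negbTE kxa) (negbTE kxkc).
      by apply; tsy.
    have h3 : T a x (k a) by tsy.
    have e := apex_via acT tac tcx h3; by rewrite e eqxx in kac.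
  - by case: (thick_triangle_free acT (kth aK) tax tbx).
have dom : T a (k a) g.
  have oneh : T a (k a) (k g) -> T a (k a) g.
    by move=> h; have := one (k g) hK; rewrite kkg; apply.
  case: (block_rel acT tp aK gK ga gka) => [[]//|//|[] []]; rewrite ?kk // => h _ _.
  - by tsy.
  - by apply: oneh; tsy.
  - by apply: oneh.
split=> //; exact: (chain_apex aK cK).
Qed.

Definition top_pair a := forall v, v != a -> v != k a -> T a (k a) v.
Definition top_chain a c := [/\ T (k a) a c, T a c (k c) &
  forall v, v != a -> v != k a -> v != c -> v != k c -> T a (k a) v /\ T c (k c) v].

(** Take a block with the most apexes. No block dominates it: such a block
    would inherit all its apexes and gain its two vertices. If some block is
    not dominated by it, then the two are linked, and [chain_apex_both] makes
    all other vertices apexes of both. *)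
Theorem top_block : K != set0 ->
  (exists2 a, a \in K & top_pair a) \/
  (exists a c, [/\ a \in K, c \in K, c != a, c != k a & top_chain a c]).
Proof.
case/set0Pn=> a0 a0K.
case: (arg_maxnP (fun a => #|apexes T a (k a)|) a0K) => a aK amax.
have ndom c : c \in K -> c != a -> c != k a -> ~ (T c (k c) a /\ T c (k c) (k a)).
  move=> cK ca cka [cda cdb]; have [ac akc kca kcka kac] := k_neq tp aK cK ca cka.
  have /= le := amax c cK; suff: #|apexes T a (k a)| < #|apexes T c (k c)| by rewrite ltnNge le.
  apply: proper_card.
  apply/properP; split; last first.
    exists a; rewrite inE //; apply/negP => h; irr.
  apply/subsetP => h; rewrite !inE => abh.
  have [e|hc] := eqVneq h c; first by subst h; Cfree a (k c) (k a) c.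
  have [e|hkc] := eqVneq h (k c); first by subst h; Cfree a c (k a) (k c).
  have [hK|] := boolP (h \in K); last exact: dominated.
  have ha : h != a by neq.
  have hka : h != k a by neq.
  have kha : k h != a by apply: contra_neq hka => e; rewrite -(kk hK) e.
  have khka : k h != k a by apply: contra_neq ha => e; rewrite -(kk hK) e kk.
  have khc : k h != c by apply: contra_neq hkc => e; rewrite -(kk hK) e.
  have khkc : k h != k c by apply: contra_neq hc => e; rewrite -(kk hK) e kk.
  have bc : k a != c by [].
  have no1 : ~~ T h c (k h).
    apply/negP => x; have y1 : T a c (k c) by tsy.
    by Afree a h c (k a) (k c) (k h); rewrite eq_sym.
  have no2 : ~~ T h (k c) (k h).
    apply/negP => x; have y1 : T a (k c) c by tsy.
    have bd : k a != k c by rewrite eq_sym.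
    by Afree a h (k c) (k a) c (k h); rewrite eq_sym.
  case: (block_view_rel acT tp hK cK _ _) => [||//|[f _]|[f _]|[f _]].
  - by rewrite eq_sym.
  - by rewrite eq_sym.
  - by case/negP: no1; tsy.
  - by case/negP: no1; tsy.
  - by case/negP: no2; tsy.
have chain x y : x \in K -> y \in K -> y != a -> y != k a -> (x == a) || (x == k a) ->
    linked T k x y -> top_chain x y.
  move=> xK yK ya yka xa l; case: (l) => h1 h2 h3.
  have xx : [/\ y != x, y != k x & forall v, v != x -> v != k x -> (v != a) && (v != k a)].
    case/orP: xa => /eqP ->; split; rewrite ?kk //; first by move=> v -> ->.
    by move=> v -> ->.
  case: xx => yx ykx vx; split=> // v v1 v2 v3 v4.
  have [vK|vK] := boolP (v \in K); last by split; apply: dominated.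
  have /andP[va vka] := vx v v1 v2.
  apply: chain_apex_both => //.
  case=> g1 g2; apply: (ndom v vK va vka).
  by case/orP: xa g1 g2 => /eqP ->; rewrite ?kk.
have [/existsP[c /and4P[cK ca cka nabc]]|/existsPn all] :=
    boolP [exists c, [&& c \in K, c != a, c != k a & ~~ T a (k a) c]]; last first.
  left; exists a => // v va vka; have [vK|vK] := boolP (v \in K); last exact: dominated.
  by have := all v; rewrite vK va vka negbK.
right; have [ac akc kca kcka kac] := k_neq tp aK cK ca cka.
have kaK := kK aK; have kcK := kK cK.
case: (block_rel acT tp aK cK ca cka) => [[f _]|f|]; first by rewrite f in nabc.
  by case: (ndom c cK ca cka f).
case=> l.
- exists a, c; split=> //; apply: chain => //; rewrite ?eqxx //.
- exists a, (k c); split=> //; apply: chain => //; rewrite ?eqxx //.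
- exists (k a), c; split=> //; rewrite ?kk //; apply: chain => //; rewrite ?eqxx ?orbT //.
- exists (k a), (k c); split=> //; rewrite ?kk //; apply: chain => //; rewrite ?eqxx ?orbT //.
Qed.
End Top.

(** * Equality: swapping blocks at unmatched vertices *)

Section Swap.
Variables (V : finType) (T : V -> V -> V -> bool).
Hypothesis acT : acfree T.
Implicit Types (m n : V -> V) (a b c d u v x y z : V).

(** The new matching has the same size, so that everything derived for a
    maximum matching holds for both. *)
Lemma swap_matching m x u : max_matching (thick T) m -> x \in matched m ->
  u \notin matched m -> thick T x u ->
  exists m1, [/\ max_matching (thick T) m1, m1 x = u, m1 u = x, m1 (m x) = m x &
    forall z, z != x -> z != m x -> z != u -> m1 z = m z].
Proof.
move=> [[inv edge] mx] xM uM xu.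
have mx_x : m x != x by rewrite inE in xM.
have mu : m u = u by apply/eqP; move: uM; rewrite inE negbK.
have ux : u != x by apply: contraNneq uM => ->.
have umx : u != m x by apply: contraNneq uM => ->; rewrite matched_inv.
pose m1 z := if z == x then u else if z == u then x else if z == m x then m x else m z.
have e1 : m1 x = u by rewrite /m1 eqxx.
have e2 : m1 u = x by rewrite /m1 (negbTE ux) eqxx.
have e3 : m1 (m x) = m x by rewrite /m1 (negbTE mx_x) eq_sym (negbTE umx) eqxx.
have e4 z : z != x -> z != m x -> z != u -> m1 z = m z.
  by rewrite /m1 => /negbTE -> /negbTE -> /negbTE ->.
have n4 z : z != x -> z != m x -> z != u -> [/\ m z != x, m z != m x & m z != u].
  move=> zx zmx zu; split.
  - by apply: contra_neq zmx => <-; rewrite inv.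
  - by rewrite (inj_eq (inv_inj inv)).
  - by apply: contra_neq zu => e; rewrite -(inv z) e.
exists m1; split=> //; split; first split.
- move=> z; have [->|zx] := eqVneq z x; first by rewrite e1 e2.
  have [->|zu] := eqVneq z u; first by rewrite e2 e1.
  have [->|zmx] := eqVneq z (m x); first by rewrite !e3.
  by have [h1 h2 h3] := n4 z zx zmx zu; rewrite (e4 z) // e4 // inv.
- move=> z; have [->|zx] := eqVneq z x; first by rewrite e1.
  have [->|zu] := eqVneq z u; first by rewrite e2 (thickC acT).
  have [->|zmx] := eqVneq z (m x); first by rewrite e3 eqxx.
  by rewrite e4 //; apply: edge.
- move=> m' m'm; apply: leq_trans (mx m' m'm) _; apply: eq_leq.
  have -> : matched m1 = u |: (matched m :\ m x).
    apply/setP => z; rewrite !inE.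
    have [->|zu] := eqVneq z u; first by rewrite e2 eq_sym ux.
    have [->|zmx] := eqVneq z (m x); first by rewrite e3 eqxx.
    have [->|zx] := eqVneq z x; first by rewrite e1 ux mx_x.
    by rewrite e4.
  rewrite cardsU1 !inE mu eqxx andbF /= (cardsD1 (m x) (matched m)).
  by rewrite matched_inv // xM.
Qed.
End Swap.

Section Even.
Variables (V : finType) (T : V -> V -> V -> bool).
Hypothesis acT : acfree T.
Hypothesis all_tight : forall m n, max_matching (thick T) m ->
  max_matching (star_pair T m) n -> tight T m n /\ (#|rest m n| = 0 \/ #|rest m n| = 2).
Notation w := (weight T).
Implicit Types (m n : V -> V) (a b c d u v x y z : V).

Lemma tight_matched m v z : max_matching (thick T) m -> v \in matched m -> z \in matched m ->
  z != v -> z != m v -> w v z + w v (m z) = 6.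
Proof.
move=> mm; have [n nn] := max_matching_exists (star_pair T m).
by have [t _] := all_tight mm nn; apply: (tightMM t).
Qed.

(** By tightness v has weight 6 on the block of x before and after the swap.
    *)
Lemma exchange_weight m x u v : max_matching (thick T) m -> x \in matched m ->
  u \notin matched m -> thick T x u -> v \in matched m -> v != x -> v != m x ->
  w v u = w v (m x).
Proof.
move=> mm xM uM xu vM vx vmx; have [m1 [mm1 e1 e2 e3 e4]] := swap_matching acT mm xM uM xu.
have inv : involutive m by case: mm => -[].
have xmv : x != m v by apply: contra_neq vmx => ->; rewrite inv.
have xv : x != v by rewrite eq_sym.
have vu : v != u by apply: contraNneq uM => <-.
have := tight_matched mm vM xM xv xmv.
have vM1 : v \in matched m1 by rewrite inE e4 //; move: vM; rewrite inE.
have xM1 : x \in matched m1.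
  by rewrite inE e1; apply: contraNneq uM => ->.
have xm1v : x != m1 v by rewrite e4.
have := tight_matched mm1 vM1 xM1 xv xm1v; rewrite e1.
by move=> h1 h2; apply/eqP; rewrite -(eqn_add2l (w v x)) h1 h2.
Qed.

Lemma unmatched_thick m u z : max_matching (thick T) m -> u \notin matched m ->
  thick T u z -> z \in matched m.
Proof.
by move=> mm uM uz; apply: contraTT uz => zM; apply: (unmatched_nthick acT mm).
Qed.

(** By [exchange_weight] the pair of the partners of x1 and x2 has weight 6.
    Its apex is thick to both partners, and with the triples of u on the two
    blocks it gives A. *)
Lemma double_thick_core m u x1 x2 : max_matching (thick T) m -> u \notin matched m ->
  x1 != x2 -> thick T u x1 -> thick T u x2 -> T u x1 (m x1) -> T u x2 (m x2) -> False.
Proof.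
move=> mm uM x12 ux1 ux2 t1 t2.
have inv : involutive m by case: mm => -[].
have x1M := unmatched_thick mm uM ux1; have x2M := unmatched_thick mm uM ux2.
have xy1 := matched_thick mm x1M; have xy2 := matched_thick mm x2M.
have x1u : thick T x1 u by rewrite (thickC acT).
have x2u : thick T x2 u by rewrite (thickC acT).
have x2y1 : x2 != m x1.
  by apply/eqP => e; rewrite e in ux2; apply: (thick_triangle_free acT ux1 ux2 xy1).
have x1y2 : x1 != m x2 by apply: contra_neq x2y1 => ->; rewrite inv.
have x21 : x2 != x1 by rewrite eq_sym.
have e1 := exchange_weight mm x1M uM x1u x2M x21 x2y1.
rewrite weight_thick // in e1.
have e2 := exchange_weight mm x2M uM x2u x1M x12 x1y2.
rewrite weight_thick // in e2.
have w21 := tight_matched mm x2M x1M x12 x1y2.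
rewrite -e1 addn0 in w21.
have [q0 h0] : exists q, T x1 x2 q.
  by apply: thin_apex; apply: weight_gt0; rewrite weightC // w21.
have x12u : T x1 x2 u by have e := thick_star_apex acT ux1 ux2 h0; rewrite -e.
have y1M : m x1 \in matched m by rewrite matched_inv.
have n1 : x2 != m (m x1) by rewrite inv.
have wy := tight_matched mm y1M x2M x2y1 n1.
rewrite weightC // -e1 add0n in wy.
have [q h] : exists q, T (m x1) (m x2) q by apply: thin_apex; apply: weight_gt0; rewrite wy.
have [y1q y2q] := weight6_thick acT wy h.
have qu : q != u.
  apply/eqP => e; subst q; have f : T u (m x1) (m x2) by tsy.
  by have e := apex_via acT ux1 xy1 f; rewrite e eqxx in x1y2.
have x1q : x1 != q.
  apply/eqP => e; subst q.
  have y2x2 : thick T (m x2) x2 by rewrite (thickC acT).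
  have e := thick_star_apex acT y2q y2x2 x12u; subst u.
  by rewrite matched_inv // x2M in uM.
have x2q : x2 != q.
  apply/eqP => e; subst q.
  have y1x1 : thick T (m x1) x1 by rewrite (thickC acT).
  have e := thick_star_apex acT y1x1 y1q x12u; subst u.
  by rewrite matched_inv // x1M in uM.
by Afree u (m x1) (m x2) x1 x2 q.
Qed.

(** If u carries no weight on the block of x, only the center term can make
    the tight cell of u reach its value, so u is in a star pair with center x.
    *)
Lemma unseen_center m n u x : max_matching (thick T) m -> max_matching (star_pair T m) n ->
  u \notin matched m -> thick T u x -> ~~ T u x (m x) -> center T n x u /\ u \in matched n.
Proof.
move=> mm nn uM ux nt; have xM := unmatched_thick mm uM ux.
have [t _] := all_tight mm nn; have xy := matched_thick mm xM.
have nuy q : ~~ T u (m x) q.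
  apply/negP => h; have e := apex_via acT ux xy h; subst q.
  by case/negP: nt; tsy.
have wuy : w u (m x) = 0.
  by apply: weight_nthin; apply/negP => /thin_apex[q h]; have := nuy q; rewrite h.
have wux : w u x = 0 by apply: weight_thick.
have lx : link_thin T u x = false.
  by apply: not_link_thin; rewrite thick_nthin.
have ly : link_thin T u (m x) = false.
  by apply/negbTE/negP => /existsP[q /and3P[h _ _]]; have := nuy q; rewrite h.
have nr : u \notin rest m n.
  apply/negP => uR; have := tightRM t uR xM.
  by rewrite wux wuy /half_block lx ly !andbF.
have uN : u \in matched n by apply: contraR nr => uN; rewrite in_rest uM.
split=> //; have := tightNM t uN xM; rewrite wux wuy.
have [//|nc] := boolP (center T n x u).
have -> : center T n (m x) u = false.
  apply/negbTE/negP => /and3P[_ yu _]; rewrite (thickC acT) in yu.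
  exact: (thick_triangle_free acT ux yu xy).
have := block_view acT mm (n u) xM; rewrite (tight_good t _ xM).
by clear; lia.
Qed.

(** If u forms no triple with one of the two blocks, it is in a star pair with
    center there, and a swap with the other end of this pair reduces to
    [double_thick_core]. *)
Lemma unmatched_one_thick m u x1 x2 : max_matching (thick T) m -> u \notin matched m ->
  thick T u x1 -> thick T u x2 -> x1 = x2.
Proof.
move=> mm uM ux1 ux2; apply/eqP; apply: contraT => x12.
have [n nn] := max_matching_exists (star_pair T m).
have inv : involutive m by case: mm => -[].
have side z1 z2 : z1 != z2 -> thick T u z1 -> thick T u z2 -> ~~ T u z1 (m z1) -> False.
  move=> z12 uz1 uz2 nt.
  have [c1 uN] := unseen_center mm nn uM uz1 nt.
  have [_ bM _ _] := star_matched acT mm nn uN.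
  case/and3P: c1 => zub _ zb.
  have z1M := unmatched_thick mm uM uz1; have z2M := unmatched_thick mm uM uz2.
  have z1u : thick T z1 u by rewrite (thickC acT).
  have t2 : T u z2 (m z2).
    apply: contraT => nt2; have [/and3P[zub2 _ _] _] := unseen_center mm nn uM uz2 nt2.
    have [tub _] := thin_star acT z1u zb zub.
    have h1 : T u (n u) z1 by tsy.
    have h2 : T u (n u) z2 by tsy.
    by rewrite (thin_eq tub h1 h2) eqxx in z12.
  have [m2 [mm2 e1 e2 e3 e4]] := swap_matching acT mm z1M bM zb.
  have z21 : z2 != z1 by rewrite eq_sym.
  have ub : u != n u by neq.
  have uz1' : u != z1 by neq.
  have uy1 : u != m z1 by apply: contraNneq uM => ->; rewrite matched_inv.
  have z2y1 : z2 != m z1.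
    apply/eqP => e; rewrite e in uz2.
    exact: (thick_triangle_free acT uz1 uz2 (matched_thick mm z1M)).
  have z2b : z2 != n u by apply: contraNneq bM => <-.
  have uM2 : u \notin matched m2 by rewrite inE e4 //; move: uM; rewrite inE.
  apply: (double_thick_core mm2 uM2 z12 uz1 uz2); first by rewrite e1; tsy.
  by rewrite e4.
have [t1|t1] := boolP (T u x1 (m x1)); last by case: (side x1 x2).
have [t2|t2] := boolP (T u x2 (m x2)); first by case: (double_thick_core mm uM x12 ux1 ux2).
by case: (side x2 x1) => //; rewrite eq_sym.
Qed.

Lemma partner_one_thick m u x d : max_matching (thick T) m -> u \notin matched m ->
  thick T u x -> thick T (m x) d -> d = x.
Proof.
move=> mm uM ux yd; have xM := unmatched_thick mm uM ux.
have xu : thick T x u by rewrite (thickC acT).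
have [m1 [mm1 e1 e2 e3 e4]] := swap_matching acT mm xM uM xu.
have yM1 : m x \notin matched m1 by rewrite inE e3 eqxx.
have yx : thick T (m x) x by rewrite (thickC acT); apply: (matched_thick mm).
exact: (unmatched_one_thick mm1 yM1 yd yx).
Qed.

Lemma matched_tight_pairs m : max_matching (thick T) m -> tight_pairs T (matched m) m.
Proof.
move=> mm; have inv : involutive m by case: mm => -[].
split.
- by move=> a aM; rewrite matched_inv.
- by move=> a _; apply: inv.
- by move=> a aM; apply: (matched_thick mm).
- by move=> a c aM cM ca cma; apply: tight_matched.
- by move=> z a b zM _ _; apply: (unmatched_one_thick mm zM).
- by move=> z c d zM _; apply: (partner_one_thick mm zM).
Qed.
End Even.

(** * Equality: a vertex with thick unmatched neighbours *)

Section Rich.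
Variables (V : finType) (T : V -> V -> V -> bool).
Hypothesis acT : acfree T.
Hypothesis all_tight : forall m n, max_matching (thick T) m ->
  max_matching (star_pair T m) n -> tight T m n /\ (#|rest m n| = 0 \/ #|rest m n| = 2).
Notation w := (weight T).
Implicit Types (m n : V -> V) (a b c d u v x y z : V).

(** The vertices that a swap can make the partner of x, together with m x
    itself. *)
Definition spoke m x z := (z == m x) || (z \notin matched m) && thick T x z.

Lemma spoke_thick m x z : max_matching (thick T) m -> x \in matched m -> spoke m x z ->
  thick T x z.
Proof. by move=> mm xM /orP[/eqP->|/andP[]//]; apply: (matched_thick mm). Qed.

Lemma spoke_leaf m x u z d : max_matching (thick T) m -> u \notin matched m -> thick T x u ->
  spoke m x z -> thick T z d -> d = x.
Proof.
move=> mm uM xu sz zd; have ux : thick T u x by rewrite (thickC acT).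
case/orP: sz => [/eqP e|/andP[zM xz]].
  by subst z; apply: (partner_one_thick acT all_tight mm uM ux).
by rewrite (thickC acT) in xz; apply: (unmatched_one_thick acT all_tight mm zM).
Qed.

(** The two spokes of x that form a triple with it; they make [spoke_apex]
    possible. *)
Lemma spoke_pair m n x u : max_matching (thick T) m -> max_matching (star_pair T m) n ->
  u \notin matched m -> thick T x u ->
  T x u (m x) \/ [/\ T x u (n u), spoke m x (n u) & u \in matched n].
Proof.
move=> mm nn uM xu; have ux : thick T u x by rewrite (thickC acT).
have [t|t] := boolP (T u x (m x)); first by left; tsy.
have [c uN] := unseen_center acT all_tight mm nn uM ux t.
have [_ bM _ _] := star_matched acT mm nn uN.
by case/and3P: c => h1 h2 h3; right; split=> //; rewrite /spoke bM h3 orbT.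
Qed.

(** All spokes have the same weight at v by [exchange_weight]; hence if one of
    them has the apex v with x, all do, and the two spokes in a triple with x
    give C. *)
Lemma spoke_apex m x u y v : max_matching (thick T) m -> x \in matched m ->
  u \notin matched m -> thick T x u ->
  v \in matched m -> v != x -> v != m x -> spoke m x y -> ~~ T x y v.
Proof.
move=> mm xM uM xu vM vx vmx sy; apply/negP => xyv.
have su : spoke m x u by rewrite /spoke uM xu orbT.
have sm : spoke m x (m x) by rewrite /spoke eqxx.
have inv : involutive m by case: mm => -[].
have wv z : spoke m x z -> w v z = w v (m x).
  case/orP => [/eqP->//|/andP[zM xz]].
  exact: (exchange_weight acT all_tight mm xM zM).
have xv : x != v by rewrite eq_sym.
have xmv : x != m v by apply: contra_neq vmx => ->; rewrite inv.
have w6 := tight_matched all_tight mm vM xM xv xmv.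
have vxy : T v x y by tsy.
have xy := spoke_thick mm xM sy.
have yleaf d : thick T y d -> d = x by apply: (spoke_leaf mm uM xu).
have all z : spoke m x z -> T x z v.
  move=> sz; have xz := spoke_thick mm xM sz.
  have zleaf d : thick T z d -> d = x by apply: (spoke_leaf mm uM xu).
  case: (thick_viewP acT v xz) => [h e|nh nt e le|nh nt e le|q nh g1 g2 g3 t1 t2 t3 t4 e1 e2|q q' nh qq' g1 g2 g3 g4 only t1 t2 t3 t4 e1 e2|q q' nh r e1 e2].
  - exact: h.
  - have wx : w v x = 6 by rewrite -w6 -(wv _ sz) e addn0.
    have [vy _] := weight6_thick acT wx vxy.
    rewrite (thickC acT) in vy; have e2 := yleaf _ vy; by rewrite e2 eqxx in vx.
  - have wz : w v z = 6.
      by have := w6; rewrite -(wv _ sz) e add0n.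
    have tz : thin T v z by apply: weight_gt0; rewrite wz.
    have [q vzq] := thin_apex tz; have [_ zq] := weight6_thick acT wz vzq.
    by have e2 := zleaf _ zq; subst q; tsy.
  - have e : q = y by apply: (thin_eq t1).
    by subst q; rewrite (thickC acT) in g3; have e3 := yleaf _ g3; rewrite e3 eqxx in vx.
  - have zq' : thick T z q' by apply: (@thick_two _ T z q' v x); [tsy|tsy|].
    by have e3 := zleaf _ zq'; subst q'; irr.
  - by have := w6; rewrite -(wv _ sz); move: e1 e2 w6; clear; lia.
have su1 : T x u v by apply: all.
have [n nn] := max_matching_exists (star_pair T m).
have sm1 : T x (m x) v by apply: all.
case: (spoke_pair mm nn uM xu) => [h|[h sn _]].
  by Cfree u (m x) v x.
have sn1 : T x (n u) v by apply: all.
by Cfree u (n u) v x.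
Qed.

(** In the other cases of [block_rel] the pair x, m x would have an apex in
    another block, against [spoke_apex]. *)
Lemma block_sees_block m x u a : max_matching (thick T) m -> x \in matched m ->
  u \notin matched m -> thick T x u ->
  a \in matched m -> a != x -> a != m x -> T a (m a) x /\ T a (m a) (m x).
Proof.
move=> mm xM uM xu aM ax amx.
have inv : involutive m by case: mm => -[].
have tp := matched_tight_pairs acT all_tight mm.
have xa : x != a by rewrite eq_sym.
have xma : x != m a by apply: contra_neq amx => ->; rewrite inv.
have [n1 n2 n3 n4 n5] := k_neq tp aM xM xa xma.
have no z : z \in matched m -> z != x -> z != m x -> T x (m x) z -> False.
  move=> zM zx zmx; apply/negP; apply: (spoke_apex mm xM uM) => //.
  by rewrite /spoke eqxx.
have noa := no a aM ax amx.
have noma : T x (m x) (m a) -> False.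
  by apply: no; rewrite ?matched_inv // eq_sym.
case: (block_rel acT tp aM xM xa xma) => [//|[h _]|[] []]; rewrite ?inv => *; exfalso.
- exact: noa.
- by apply: noa; tsy.
- by apply: noa; tsy.
- by apply: noma; tsy.
- by apply: noma; tsy.
Qed.

(** Swap z for the partner of x and apply [block_sees_block]. *)
Lemma block_sees_spoke m x u a z : max_matching (thick T) m -> x \in matched m ->
  u \notin matched m -> thick T x u ->
  a \in matched m -> a != x -> a != m x -> spoke m x z -> T a (m a) z.
Proof.
move=> mm xM uM xu aM ax amx.
case/orP => [/eqP ->|/andP[zM xz]].
  by case: (block_sees_block mm xM uM xu aM ax amx).
have [m1 [mm1 e1 e2 e3 e4]] := swap_matching acT mm xM zM xz.
have az : a != z by apply: contraNneq zM => <-.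
have ea := e4 a ax amx az.
have mx_x : m x != x by rewrite inE in xM.
have xM1 : x \in matched m1 by rewrite inE e1; apply: contraNneq zM => ->.
have yM1 : m x \notin matched m1 by rewrite inE e3 eqxx.
have xy := matched_thick mm xM.
have aM1 : a \in matched m1 by rewrite inE ea; rewrite inE in aM.
have am1 : a != m1 x by rewrite e1.
by case: (block_sees_block mm1 xM1 yM1 xy aM1 ax am1); rewrite ea e1.
Qed.

(** Call x rich if it is thick to an unmatched vertex. The block of x' would
    dominate x, so the spoke m x' would have the apex x with x', against
    [spoke_apex]. *)
Lemma rich_unique m x u x' u' : max_matching (thick T) m ->
  u \notin matched m -> thick T x u -> u' \notin matched m -> thick T x' u' -> x = x'.
Proof.
move=> mm uM xu u'M xu'; apply/eqP; apply: contraT => xx'.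
have mem z v : v \notin matched m -> thick T z v -> z \in matched m.
  by move=> vM zv; apply: (unmatched_thick acT mm vM); rewrite (thickC acT).
have xM := mem x u uM xu; have x'M := mem x' u' u'M xu'.
have sy z : spoke m z (m z) by rewrite /spoke eqxx.
have x'y : x' != m x.
  apply/eqP => e; subst x'.
  have e := spoke_leaf mm uM xu (sy x) xu'; subst u'.
  by rewrite xM in u'M.
have x'x : x' != x by rewrite eq_sym.
have [h _] := block_sees_block mm xM uM xu x'M x'x x'y.
have xy' : x != m x' by apply: contra_neq x'y => ->; case: mm => -[] ->.
have := spoke_apex mm x'M u'M xu' xM xx' xy' (sy x').
by case/negP.
Qed.

(** Otherwise z has no thick pair and is one of exactly two leftover vertices.
    If a star pair exists, its center is x, and tightness makes x the apex of
    z with both its ends, which gives C. If none exists, the other leftover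
    vertex is a spoke, and x, this spoke, m x and z form C. *)
Lemma rich_no_isolated m x u z : max_matching (thick T) m -> x \in matched m ->
  u \notin matched m -> thick T x u -> z \notin matched m -> thick T x z.
Proof.
move=> mm xM uM xu zM; apply: contraT => nxz.
have iso q : ~~ thick T z q.
  apply: contraNN nxz => zq; have qz : thick T q z by rewrite (thickC acT).
  by rewrite (rich_unique mm uM xu zM qz).
have [n nn] := max_matching_exists (star_pair T m).
have [t card] := all_tight mm nn.
have zR : z \in rest m n.
  rewrite in_rest zM; apply/negP => /(star_matched acT mm nn)[_ _ _ [q _ /and3P[_ h _]]].
  by have := iso q; rewrite (thickC acT) h.
have {}card : #|rest m n| = 2 by case: card => // /cards0_eq e; rewrite e inE in zR.
have [c cz eR] : exists2 c, c != z & rest m n = [set c; z].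
  have /cards1P[c ec] : #|rest m n :\ z| == 1.
    by have := cardsD1 z (rest m n); rewrite card zR; move: #|_| => k; lia.
  have : c \in rest m n :\ z by rewrite ec inE.
  rewrite inE in_set1 => /andP[cz cR]; exists c => //.
  by rewrite -(setD1K zR) ec setUC.
have cR : c \in rest m n by rewrite eR !inE eqxx.
have cM : c \notin matched m by move: cR; rewrite in_rest => /andP[].
have spoke_x q v : v \notin matched m -> thick T v q -> q = x.
  move=> vM vq; rewrite (thickC acT) in vq; exact/esym/(rich_unique mm uM xu vM vq).
have [N0|[a aN]] := set_0Vmem (matched n).
  have [uc|uz] : u = c \/ u = z.
    have : u \in rest m n by rewrite in_rest uM N0 inE.
    by rewrite eR !inE => /orP[] /eqP ->; [left|right].
  2: by rewrite uz (negbTE nxz) in xu.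
  subst u.
  case: (spoke_pair mm nn uM xu) => [h|[_ _ h]]; last by rewrite N0 inE in h.
  have apex y' v : spoke m x y' -> T x y' v -> v != m x -> v != c -> v = z.
    move=> sy h1 vmx vc; have vx : v != x by neq.
    have [vM|vM] := boolP (v \in matched m).
      by have := spoke_apex mm xM uM xu vM vx vmx sy; rewrite h1.
    have : v \in rest m n by rewrite in_rest vM N0 inE.
    by rewrite eR !inE (negbTE vc) => /eqP.
  have sc : spoke m x c by rewrite /spoke uM xu orbT.
  have sy : spoke m x (m x) by rewrite /spoke eqxx.
  have [p hp pn] := thick_other (m x) xu.
  have pc : p != c by neq.
  have ep := apex c p sc hp pn pc; subst p.
  have [q hq qn] := thick_other c (matched_thick mm xM).
  have qy : q != m x by neq.
  have eq_ := apex _ q sy hq qy qn; subst q.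
  by Cfree c (m x) z x.
have [aM bM anb [x0 x0M /and3P[h1 h2 h3]]] := star_matched acT mm nn aN.
have e0 : x0 = x by apply: (rich_unique mm aM h2 uM xu).
subst x0.
have one v : v \notin matched m -> thick T x v -> 
    w z v + 3 * rest_link T m n z v \in [:: 0; 2; 5] \/ w z v + 3 * rest_link T m n z v = 3 /\ T z v x.
  move=> vM xv; have nozp p : thick T z p = false by apply/negbTE.
  have [cov|/existsPn nc] := boolP [exists p, T z v p]; last first.
    left; rewrite weight_nthin; last by apply/negP => /thin_apex[p]; rewrite (negbTE (nc p)).
    by rewrite (_ : rest_link T m n z v = false) //; apply/negbTE/negP => /existsP[p /andP[_ h]]; rewrite (negbTE (nc p)) in h.
  case/existsP: cov => p zvp.
  have tzv : thin T z v by apply: (nthick_thin zvp); rewrite nozp.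
  have zpv : T z p v by tsy.
  have tzp : thin T z p by apply: (nthick_thin zpv); rewrite nozp.
  have rl : rest_link T m n z v = (p \in rest m n).
    apply/existsP/idP => [[p' /andP[h h']]|h]; last by exists p; rewrite h.
    by rewrite (thin_eq tzv zvp h').
  rewrite rl (weight_thin tzv zvp) tzp.
  have vpz : T v p z by tsy.
  have [vp|nvp] := boolP (thick T v p).
    have ep := spoke_x p v vM vp; subst p.
    by right; rewrite (thick_nthin vp) in_rest xM.
  by left; rewrite (nthick_thin vpz nvp); case: (p \in rest m n).
have t6 := tightRN t zR aN.
have [ha|[_ ha]] := one a aM h2.
  have [hb|[hb _]] := one (n a) bM h3; move: ha; rewrite !inE; last by move: hb t6; clear; lia.
  by move: hb t6; rewrite !inE; clear; lia.
have [hb|[_ hb]] := one (n a) bM h3.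
  have [ha'|[ha' _]] := one a aM h2; move: hb ha' t6; rewrite !inE; clear; lia.
by Cfree a (n a) z x.
Qed.
End Rich.

(** * Equality: the structure for even order *)

Section Structure.
Variables (V : finType) (T : V -> V -> V -> bool).
Hypothesis acT : acfree T.
Hypothesis all_tight : forall m n, max_matching (thick T) m ->
  max_matching (star_pair T m) n -> tight T m n /\ (#|rest m n| = 0 \/ #|rest m n| = 2).
Notation w := (weight T).
Implicit Types (m n : V -> V) (a b c d u v x y z : V).

Definition dominating_blocks (K : {set V}) (k : V -> V) :=
  [/\ K != set0, tight_pairs T K k & forall a b, a \in K -> b \notin K -> T a (k a) b].
Definition star_at x := forall a b c, T a b c -> [|| x == a, x == b | x == c].

(** All vertices outside the other blocks are x or its spokes, and the other
    blocks dominate them. Without other blocks, two spokes have no apex but x,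
    so x is in all triples. *)
Lemma rich_structure m x u : max_matching (thick T) m -> u \notin matched m -> thick T x u ->
  (exists K, dominating_blocks K m) \/ star_at x.
Proof.
move=> mm uM xu; have inv : involutive m by case: mm => -[].
have xM : x \in matched m by apply: (unmatched_thick acT mm uM); rewrite (thickC acT).
have sp z : z \notin matched m -> spoke T m x z.
  by move=> zM; rewrite /spoke zM (rich_no_isolated acT all_tight mm xM uM xu zM) orbT.
have sy : spoke T m x (m x) by rewrite /spoke eqxx.
have leaf z d : spoke T m x z -> thick T z d -> d = x.
  exact: (spoke_leaf acT all_tight mm uM xu).
pose K := matched m :\ x :\ m x.
have inK a : (a \in K) = [&& a \in matched m, a != x & a != m x].
  by rewrite /K !in_setD1 andbA andbC (andbC (a != x)).
have out b : b \notin K -> b = x \/ spoke T m x b.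
  rewrite inK !negb_and !negbK => /or3P[/sp|/eqP|/eqP ->]; by [right|left|right].
have tp := matched_tight_pairs acT all_tight mm.
have dom a b : a \in K -> b \notin K -> T a (m a) b.
  rewrite inK => /and3P[aM ax amx] /out[->|sb].
    by case: (block_sees_block acT all_tight mm xM uM xu aM ax amx).
  exact: (block_sees_spoke acT all_tight mm xM uM xu aM ax amx sb).
have nothick z a : z \notin K -> a \in K -> thick T z a -> False.
  move=> zK aK za; have := aK; rewrite inK => /and3P[aM ax amx].
  case: (out z zK) => [e|sz]; last by rewrite (leaf z a sz za) eqxx in ax.
  subst z; have xa : x != a by rewrite eq_sym.
  have xma : x != m a by apply: contra_neq amx => ->; rewrite inv.
  have w6 := tight_matched all_tight mm aM xM xa xma.
  have wax : w a x = 0 by rewrite weight_thick // (thickC acT).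
  rewrite wax add0n in w6.
  have h : T a (m a) (m x) by case: (block_sees_block acT all_tight mm xM uM xu aM ax amx).
  have h' : T a (m x) (m a) by tsy.
  have [_ yma] := weight6_thick acT w6 h'.
  by have e := leaf _ _ sy yma; rewrite -e inv eqxx in amx.
have [K0|Kn] := eqVneq K set0; last first.
  left; exists K; split=> //; split.
  - move=> a; rewrite !inK => /and3P[aM ax amx].
    rewrite matched_inv // aM /= (inj_eq (inv_inj inv)) ax andbT.
    by apply: contra_neq amx => <-; rewrite inv.
  - by move=> a _; apply: inv.
  - by move=> a; rewrite inK => /and3P[aM _ _]; apply: (matched_thick mm).
  - move=> a c; rewrite !inK => /and3P[aM _ _] /and3P[cM _ _].
    exact: (pairs_full tp).
  - by move=> z a b zK aK _ za _; case: (nothick z a zK aK za).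
  - by move=> z c d zK cK zc _; case: (nothick z c zK cK zc).
right=> a b c abc; apply: contraT; rewrite !negb_or => /and3P[xa xb xc].
have sp' z : x != z -> thick T x z.
  move=> xz; have zK : z \notin K by rewrite K0 inE.
  case: (out z zK) => [e|]; first by rewrite e eqxx in xz.
  exact: (spoke_thick mm xM).
have xa' := sp' a xa; have xb' := sp' b xb; rewrite (thickC acT) in xa'.
by have e := apex_via acT xa' xb' abc; rewrite e eqxx in xc.
Qed.

(** No star pairs exist, as their ends would be thick to a matched vertex.
    Hence there are no leftover vertices or two, which lie in no common
    triple; a leftover vertex has full weight on every block without being
    thick to anything, so every block dominates it. *)
Lemma poor_structure m : max_matching (thick T) m -> 2 < #|V| ->
  (forall u x, u \notin matched m -> ~~ thick T u x) -> dominating_blocks (matched m) m.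
Proof.
move=> mm V2 poor; have inv : involutive m by case: mm => -[].
have tp := matched_tight_pairs acT all_tight mm.
have [n nn] := max_matching_exists (star_pair T m).
have [t card] := all_tight mm nn.
have N0 z : z \in matched n = false.
  apply/negbTE/negP => /(star_matched acT mm nn)[zM _ _ [q _ /and3P[_ h _]]].
  by have := poor z q zM; rewrite (thickC acT) h.
have inR z : (z \in rest m n) = (z \notin matched m) by rewrite in_rest N0 andbT.
have cardV : #|matched m| + #|rest m n| = #|V|.
  rewrite -(cardsC (matched m)); congr (_ + _); apply: eq_card => z.
  by rewrite inR in_setC.
split=> //.
  by rewrite -card_gt0; move: cardV V2 card; clear; lia.
move=> a b aM bM.
have bR : b \in rest m n by rewrite inR.
have {}card : #|rest m n| = 2 by case: card => // /cards0_eq e; rewrite e inE in bR.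
have [c cb eR] : exists2 c, c != b & rest m n = [set c; b].
  have /cards1P[c ec] : #|rest m n :\ b| == 1.
    by have := cardsD1 b (rest m n); rewrite card bR; move: #|_| => k; lia.
  have : c \in rest m n :\ b by rewrite ec inE.
  rewrite inE in_set1 => /andP[cz cR]; exists c => //.
  by rewrite -(setD1K bR) ec setUC.
have cR : c \in rest m n by rewrite eR !inE eqxx.
have cM : c \notin matched m by rewrite -inR.
have thin_iso p q z : p \notin matched m -> T p q z -> thin T p q.
  by move=> pM pq; apply: (nthick_thin pq); apply: poor.
have ncov q : ~~ T b c q.
  apply/negP => h; have := tightRR t bR cR.
  have qR : q \notin rest m n by rewrite eR !inE !negb_or; apply/andP; split; neq.
  have nin : (b \in inner T m n c) = false.
    apply/negbTE; rewrite inE negb_and; apply/orP; right.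
    apply/existsPn => q'; apply/negP => /andP[h' q'R].
    have tbc := thin_iso _ _ _ bM h.
    have h2 : T b c q' by tsy.
    by rewrite (thin_eq tbc h h2) q'R in qR.
  have h1 : T b q c by tsy.
  have h2 : T c q b by tsy.
  rewrite /cellRR nin (weight_thin (thin_iso _ _ _ bM h) h).
  rewrite (thin_iso _ _ _ bM h1) (thin_iso _ _ _ cM h2).
  by case: (_ \in _); case: (_ \in _).
have out0 : outer T m n b = set0.
  apply/setP => z; rewrite inE in_set0; apply/negbTE/negP => /and3P[zR _ /existsP[q /andP[h _]]].
  have zc : z = c.
    by move: zR; rewrite eR !inE => /orP[/eqP //|/eqP e]; subst z; irr.
  by subst z; have := ncov q; rewrite h.
have := tight_outer t bR; rewrite out0 cards0 => /esym /eqP.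
rewrite addn_eq0 => /andP[/eqP half0 _].
have nh z : z \in matched m -> half_block T m b z = false.
  move=> zM; move: half0; rewrite (bigD1 z) //= => /eqP; rewrite addn_eq0 => /andP[+ _].
  by rewrite eqb0 => /negbTE.
have full : full_view T (matched m) m b.
  move=> z zM _ _; have := tightRM t bR zM.
  by rewrite nh // nh ?matched_inv //; clear; lia.
have ba : b != a by apply: contraNneq bM => ->.
have bma : b != m a by apply: contraNneq bM => ->; rewrite matched_inv.
case: (full_viewP acT tp full aM ba bma) => [//|h _|h _|y h1 h2 h3].
- have tb : thin T b a by apply: weight_gt0; rewrite h.
  have [q bq] := thin_apex tb; have [bq' _] := weight6_thick acT h bq.
  by have := poor b q bM; rewrite bq'.
- have tb : thin T b (m a) by apply: weight_gt0; rewrite h.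
  have [q bq] := thin_apex tb; have [bq' _] := weight6_thick acT h bq.
  by have := poor b q bM; rewrite bq'.
- by have := poor b y bM; rewrite h3.
Qed.

Theorem even_structure : 2 < #|V| ->
  (exists K k, dominating_blocks K k) \/ exists x, star_at x.
Proof.
move=> V2; have [m mm] := max_matching_exists (thick T).
have [/existsP[u /andP[uM /existsP[x ux]]]|/existsPn poor] :=
    boolP [exists u, (u \notin matched m) && [exists x, thick T u x]].
  rewrite (thickC acT) in ux; case: (rich_structure mm uM ux) => [[K h]|h].
    by left; exists K, m.
  by right; exists x.
left; exists (matched m), m; apply: poor_structure => // u x uM.
by have := poor u; rewrite uM /= => /existsPn.
Qed.
End Structure.

(** * Fully paired five-rings *)

Section FullRing.
Variables (V : finType) (T : V -> V -> V -> bool).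
Hypothesis acT : acfree T.
Variables s0 s1 s2 s3 s4 : V.
Hypothesis ring : five_ring_on T s0 s1 s2 s3 s4.
Implicit Types a b c d p q s v x y z t u : V.
Notation w := (weight T).
Notation S := (ring_set s0 s1 s2 s3 s4).
Notation P := (ring_paired T s0 s1 s2 s3 s4).
Notation W := (~: S).
Hypothesis fully_paired : P = W.

(** By [ring_view] the apex of u does not depend on the ring vertex s. *)
Definition ring_mate u := odflt u [pick x | [exists s in S, T s u x]].
Notation bar := ring_mate.

Lemma ring_mateP u : u \in W -> 
  [/\ bar u \in W, exists p q, [/\ p \in S, q \in S, p != q, T p u (bar u) & T q u (bar u)] &
   forall s y, s \in S -> T s u y -> y = bar u].
Proof.
move=> uW; have uS : u \notin S by rewrite -in_setC.
have := uW; rewrite -fully_paired in_set uS /= => /existsP[p /andP[pS /existsP[q /andP[qS]]]].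
case/and3P => pq /existsP[x pux] /existsP[y quy].
have uniq s z : s \in S -> T s u z -> z = x.
  move=> sS suz; have [e|sp] := eqVneq s p; last by apply: (ring_view acT ring uS sS pS sp suz pux).
  have sq : s != q by rewrite e.
  by rewrite (ring_view acT ring uS sS qS sq suz quy) (ring_view acT ring uS pS qS pq pux quy).
have e : bar u = x.
  rewrite /bar; case: pickP => [z /existsP[s /andP[sS suz]]|/(_ x)]; first exact: uniq suz.
  by move/existsPn => /(_ p); rewrite pS pux.
have ey := uniq _ _ qS quy; subst y; rewrite e; split=> //; last by exists p, q.
by rewrite fully_paired in_setC; apply: (outside_ring acT ring pS uS pux).
Qed.

Lemma ring_mateK u : u \in W -> bar (bar u) = u.
Proof.
move=> uW; have [bW [p [q [pS qS pq h1 h2]]] _] := ring_mateP uW.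
have [_ _ only] := ring_mateP bW; apply/esym/(only p) => //; tsy.
Qed.

Lemma ring_mate_thick u : u \in W -> thick T u (bar u).
Proof.
move=> uW; have [_ [p [q [pS qS pq h1 h2]]] _] := ring_mateP uW.
by apply: (@thick_two _ T u (bar u) p q); [tsy|tsy|].
Qed.

Lemma ring_outside_nthick s u : s \in S -> u \in W -> ~~ thick T s u.
Proof.
move=> sS uW; have [_ _ only] := ring_mateP uW; apply/negP.
case/card_gt1P => x [y [+ + xy]]; rewrite !inE => h1 h2.
by rewrite (only _ _ sS h1) (only _ _ sS h2) eqxx in xy.
Qed.

Lemma ring_outside_weight s u : s \in S -> u \in W -> w s u = 3 * T s u (bar u).
Proof.
move=> sS uW; have [bW _ only] := ring_mateP uW.
have [h|nh] := boolP (T s u (bar u)).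
  have h' : T s (bar u) u by tsy.
  have t1 := nthick_thin h (ring_outside_nthick sS uW).
  have t2 := nthick_thin h' (ring_outside_nthick sS bW).
  by rewrite (weight_thin t1 h) t2 (thick_nthin (ring_mate_thick uW)).
rewrite weight_nthin //; apply/negP => /thin_apex[x h].
by move: nh; rewrite -(only _ _ sS h) h.
Qed.

(** A five-ring through v and the block of z would have, as the apexes of its
    side on this block, exactly the two vertices of the given ring that see z.
    Then v would be the apex of one of them with z, namely the mate of z. *)
Lemma ring_block_view v z : v \in W -> z \in W -> z != v -> z != bar v ->
  w v z + w v (bar z) <= 6.
Proof.
move=> vW zW zv zbv; have zz := ring_mate_thick zW.
have [bW [p [q [pS qS pq h1 h2]]] only] := ring_mateP zW.
case: (thick_viewP acT v zz) => [h ->//|nh nt -> le|nh nt -> le|y nh g1 g2 g3 t1 t2 t3 t4 -> ->//|y y' nh yy' g1 g2 g3 g4 only' t1 t2 t3 t4 -> ->//|y y' nh r e1 e2].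
- by rewrite addn0.
- by rewrite add0n.
have [y0|y0] : p = y \/ q = y.
  have side := ring_side acT (ring_rot (ring_rot r)).
  have h1' : T z (bar z) p by tsy.
  have h2' : T z (bar z) q by tsy.
  case/orP: (side _ h1') => /eqP e1'; case/orP: (side _ h2') => /eqP e2'; subst.
  all: try by left. all: try by right.
  by rewrite eqxx in pq.
- subst y; case: r => r1 r2 r3 r4 r5.
  have h : T p z v by tsy.
  have e := only _ _ pS h; move: zbv; rewrite e ring_mateK // eqxx //.
- subst y; case: r => r1 r2 r3 r4 r5.
  have h : T q z v by tsy.
  have e := only _ _ qS h; move: zbv; rewrite e ring_mateK // eqxx //.
Qed.

Lemma ring_mate_neq u : u \in W -> u != bar u.
Proof. by move=> uW; apply: (thick_neq acT); apply: ring_mate_thick. Qed.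

Lemma ring_mate_in u : u \in W -> bar u \in W.
Proof. by move=> /ring_mateP[]. Qed.

Lemma sum_ring_mate (F : V -> nat) : \sum_(u in W) F (bar u) = \sum_(u in W) F u.
Proof.
rewrite [RHS](reindex_onto bar bar) => [|u uW]; last exact: ring_mateK.
apply: eq_bigl => u; apply/idP/andP => [uW|[uW /eqP <-]].
  by rewrite ring_mateK // ring_mate_in.
exact: ring_mate_in.
Qed.

Definition mate_cell v z := w v z + w v (bar z) + 6 * ((z == v) + (z == bar v)).

Lemma mate_cell_le v z : v \in W -> z \in W -> mate_cell v z <= 6.
Proof.
move=> vW zW; rewrite /mate_cell.
have [e|zv] := eqVneq z v.
  subst z; rewrite (negbTE (ring_mate_neq vW)) weight_xx // weight_thick //.
  exact: ring_mate_thick.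
have [e|zbv] := eqVneq z (bar v).
  subst z; rewrite ring_mateK // weight_xx // weight_thick //.
  exact: ring_mate_thick.
by have := ring_block_view vW zW zv zbv; clear; lia.
Qed.

Lemma mate_cell_sum : \sum_(v in W) \sum_(z in W) mate_cell v z =
  2 * (\sum_(v in W) \sum_(z in W) w v z) + 12 * #|W|.
Proof.
have e u : u \in W -> \sum_(z in W) (z == u) = 1.
  by move=> uW; rewrite (bigD1 u) //= eqxx big1 // => z /andP[_ /negbTE ->].
have row v : v \in W -> \sum_(z in W) mate_cell v z = 2 * \sum_(z in W) w v z + 12.
  move=> vW; rewrite /mate_cell; split_sums; rewrite !e ?ring_mate_in //.
  by rewrite (sum_ring_mate (w v)); clear; lia.
by rewrite (eq_bigr _ row); split_sums; rewrite sum_nat_const; clear; lia.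
Qed.

Lemma ring_weight_row : \sum_(b in S) w s0 b <= 12.
Proof.
rewrite (sum_ring acT ring) !big_cons big_nil.
have r4 := ring_rot (ring_rot (ring_rot (ring_rot ring))).
rewrite weight_xx // (weight_thick (ring_thick acT ring)).
rewrite (weightC acT s0 s4) (weight_thick (ring_thick acT r4)).
have := weight_le6 T s0 s2; have := weight_le6 T s0 s3; clear; lia.
Qed.
End FullRing.

Section FullRingBound.
Variables (V : finType) (T : V -> V -> V -> bool).
Hypothesis acT : acfree T.
Variables s0 s1 s2 s3 s4 : V.
Hypothesis ring : five_ring_on T s0 s1 s2 s3 s4.
Implicit Types a b c d p q s v x y z t u : V.
Notation w := (weight T).
Notation S := (ring_set s0 s1 s2 s3 s4).
Notation P := (ring_paired T s0 s1 s2 s3 s4).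
Notation W := (~: S).
Hypothesis fully_paired : P = W.
Notation bar := (ring_mate T s0 s1 s2 s3 s4).

Lemma ring_weights : \sum_(a in S) \sum_(b in S) w a b <= 60.
Proof.
have r1 := ring_rot ring; have r2 := ring_rot r1; have r3 := ring_rot r2.
have r4 := ring_rot r3.
rewrite (sum_ring acT ring) !big_cons big_nil.
have := ring_weight_row acT ring; have := ring_weight_row acT r1.
have := ring_weight_row acT r2.
have := ring_weight_row acT r3; have := ring_weight_row acT r4.
have e1 := ring_set_rot s0 s1 s2 s3 s4; have e2 := ring_set_rot s1 s2 s3 s4 s0.
have e3 := ring_set_rot s2 s3 s4 s0 s1; have e4 := ring_set_rot s3 s4 s0 s1 s2.
by rewrite -e4 -e3 -e2 -e1; clear; lia.
Qed.

(** The ring pairs weigh at most 60, and a ring vertex or a vertex of another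
    block at most 6 on a block. The sum is 12 fAC(n) exactly, so equality
    makes every block dominate the ring. *)
Theorem ring_full : ntriples T <= 6 * fAC #|V| /\
  (6 * fAC #|V| <= ntriples T -> W != set0 -> dominating_blocks T W bar).
Proof.
have mateK := ring_mateK acT ring fully_paired.
have mate_in := ring_mate_in acT ring fully_paired.
have tot : 2 * ntriples T = \sum_(a in S) \sum_(b in S) w a b
   + 2 * \sum_(a in S) \sum_(b in W) w a b + \sum_(a in W) \sum_(b in W) w a b.
  rewrite -weight_sum //.
  have split (F : V -> nat) : \sum_a F a = \sum_(a in S) F a + \sum_(a in W) F a.
    by rewrite (bigID (mem S)) /=; congr (_ + _); apply: eq_bigl => a; rewrite in_setC.
  under eq_bigr do rewrite split.
  rewrite big_split /= !split.
  have -> : \sum_(a in W) \sum_(b in S) w a b = \sum_(a in S) \sum_(b in W) w a b.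
    by rewrite exchange_big; do 2!(apply: eq_bigr => ? _); rewrite weightC.
  by clear; lia.
have eSW : \sum_(a in S) \sum_(b in W) w a b = \sum_(a in S) \sum_(b in W) 3 * T a b (bar b).
  by do 2!(apply: eq_bigr => ? ?); apply: (ring_outside_weight acT ring fully_paired).
have capSW : \sum_(a in S) \sum_(b in W) 3 = 15 * #|W|.
  by under eq_bigr do rewrite sum_nat_const; rewrite sum_nat_const (card_ring acT ring); clear; lia.
have leSW s u : s \in S -> u \in W -> 3 * T s u (bar u) <= 3 by case: (T s u _).
have SWle : \sum_(a in S) \sum_(b in W) w a b <= 15 * #|W|.
  by rewrite eSW -capSW; do 2!(apply: leq_sum => ? ?); apply: leSW.
have capW : \sum_(a in W) \sum_(b in W) 6 = 6 * (#|W| * #|W|).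
  by under eq_bigr do rewrite sum_nat_const; rewrite sum_nat_const; clear; lia.
have cell v z : v \in W -> z \in W -> _ := @mate_cell_le _ _ acT _ _ _ _ _ ring fully_paired v z.
have WWle : 2 * (\sum_(v in W) \sum_(z in W) w v z) + 12 * #|W| <= 6 * (#|W| * #|W|).
  by rewrite -(mate_cell_sum acT ring fully_paired) -capW; do 2!(apply: leq_sum => ? ?); apply: cell.
have SSle := ring_weights.
have cV : 5 + #|W| = #|V| by rewrite -(card_ring acT ring) cardsC.
have Wodd : ~~ odd #|W|.
  apply: (@card_involution_even _ bar) => u uW; rewrite mate_in // mateK //.
  by rewrite eq_sym (ring_mate_neq acT ring fully_paired uW).
have f6 : 2 * (6 * fAC #|V|) = 60 + 30 * #|W| + 3 * (#|W| * #|W|) - 6 * #|W|.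
  have e : #|W| = (#|W|./2).*2 by rewrite -[LHS]odd_double_half (negbTE Wodd).
  rewrite -cV e; move: (#|W|./2) => j.
  have -> : 5 + j.*2 = (j + 2).*2.+1 by clear; lia.
  rewrite fAC_odd; last by clear; lia.
  by rewrite -muln2; clear; nia.
have W2 : 2 * #|W| <= #|W| * #|W|.
  by move: Wodd; clear; case: #|W| => [|[|k]] // _; nia.
split.
  move: tot SWle WWle SSle f6 W2; clear.
  move: (ntriples T) (fAC _) (#|W| * #|W|) #|W| => t f w2 w1.
  by move: (\sum_(v in W) _) (\sum_(v in S) \sum_(b in W) _) (\sum_(v in S) _) => x y z; lia.
move=> ge Wn.
have [geSW geWW] : 15 * #|W| <= \sum_(a in S) \sum_(b in W) w a b /\
    6 * (#|W| * #|W|) <= 2 * (\sum_(v in W) \sum_(z in W) w v z) + 12 * #|W|.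
  move: ge tot SWle WWle SSle f6 W2; clear.
  move: (ntriples T) (fAC _) (#|W| * #|W|) #|W| => t f w2 w1.
  by move: (\sum_(v in W) _) (\sum_(v in S) \sum_(b in W) _) (\sum_(v in S) _) => x y z; split; lia.
rewrite -(mate_cell_sum acT ring fully_paired) -capW in geWW.
rewrite eSW -capSW in geSW.
have dom s u : s \in S -> u \in W -> T s u (bar u).
  move=> sS uW; have := sum2_tight leSW geSW sS uW; by case: (T s u _).
have full v z : v \in W -> z \in W -> mate_cell T s0 s1 s2 s3 s4 v z = 6.
  by move=> vW zW; apply: (sum2_tight cell geWW vW zW).
have nth := ring_outside_nthick acT ring fully_paired.
have inS z : z \notin W -> z \in S by rewrite in_setC negbK.
split=> //; last by move=> a b aW /inS bS; have := dom b a bS aW => h; tsy.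
split.
- exact: mate_in.
- exact: mateK.
- exact: (ring_mate_thick acT ring fully_paired).
- move=> a c aW cW ca cma; have := full a c aW cW.
  by rewrite /mate_cell (negbTE ca) (negbTE cma) addn0.
- by move=> z a b /inS zS aW _ za; have := nth z a zS aW; rewrite za.
- by move=> z a b /inS zS aW za; have := nth z a zS aW; rewrite za.
Qed.
End FullRingBound.

(** * The structure of an extremal relation *)

Section Step.
Variables (V : finType) (T : V -> V -> V -> bool).
Hypothesis acT : acfree T.
Hypothesis inside_bound : forall X : {set V}, X \proper [set: V] -> inside T X <= 6 * fAC #|X|.
Implicit Types a b c d p q s v x y z t u : V.

Definition spanning_ring :=
  exists s0 s1 s2 s3 s4, five_ring_on T s0 s1 s2 s3 s4 /\ ring_set s0 s1 s2 s3 s4 = [set: V].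

(** If every five-ring has four active vertices the weight bound holds; for
    odd n above 3 it falls one triple short of fAC. Otherwise the five-ring is
    either not fully paired, and the bound is strict, or fully paired. *)
Theorem extremal_structure : ntriples T <= 6 * fAC #|V| /\
  (3 < #|V| -> 6 * fAC #|V| <= ntriples T ->
   [\/ exists K k, dominating_blocks T K k /\ (odd #|V| -> #|K| + 5 <= #|V|), ~~ odd #|V| /\ exists x, star_at T x | spanning_ring]).
Proof.
have [|noring] := boolP [exists s0, exists s1, exists s2, exists s3, exists s4,
  [&& T s0 s1 s2, T s1 s2 s3, T s2 s3 s4, T s3 s4 s0, T s4 s0 s1 &
    #|active T s0 s1 s2 s3 s4| <= 3]].
  case/existsP=> s0 /existsP[s1 /existsP[s2 /existsP[s3 /existsP[s4]]]].
  case/and5P => h0 h1 h2 h3 /andP[h4 act3]; have r : five_ring_on T s0 s1 s2 s3 s4 by split.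
  have [full|nfull] := eqVneq (ring_paired T s0 s1 s2 s3 s4) (~: ring_set s0 s1 s2 s3 s4).
    have [le eqc] := ring_full acT r full; split=> // _ ge.
    have [W0|Wn] := eqVneq (~: ring_set s0 s1 s2 s3 s4) set0.
      by apply: Or33; exists s0, s1, s2, s3, s4; rewrite -[ring_set _ _ _ _ _]setCK W0 setC0.
    apply: Or31; eexists; eexists; split; first exact: (eqc ge Wn).
    by move=> _; rewrite -(card_ring acT r) addnC cardsC.
  have lt := ring_few_active acT r inside_bound act3 nfull.
  by split=> [|_]; [apply: ltnW|rewrite leqNgt lt].
have actives s0 s1 s2 s3 s4 : five_ring_on T s0 s1 s2 s3 s4 -> 3 < #|active T s0 s1 s2 s3 s4|.
  case=> h0 h1 h2 h3 h4; rewrite ltnNge; apply: contra noring => act3.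
  apply/existsP; exists s0; apply/existsP; exists s1; apply/existsP; exists s2.
  by apply/existsP; exists s3; apply/existsP; exists s4; rewrite h0 h1 h2 h3 h4.
have slack m n (mm : max_matching (thick T) m) (nn : max_matching (star_pair T m) n) :=
  four_active_slack acT mm nn actives.
have [m mm] := max_matching_exists (thick T).
have [n nn] := max_matching_exists (star_pair T m).
have eV := odd_double_half #|V|.
have [oV|oV] := boolP (odd #|V|).
  have := ntriples_bound_odd acT mm nn (slack m n mm nn) oV.
  rewrite oV add1n in eV; rewrite -eV /=; move: (#|V|./2) (ntriples T) => j t le.
  have [j1|j1] := ltnP 1 j.
    rewrite fAC_odd //; move: le; rewrite -muln2; clear => le.
    by split=> [|_]; [nia|move=> ge; exfalso; nia].
  split; last by move: j1; rewrite -muln2; clear; lia.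
  by move: j1 le; case: j => [|[|//]] _; rewrite /fAC /=; clear; lia.
rewrite (negbTE oV) add0n in eV.
have bound := ntriples_bound_even acT mm nn (slack m n mm nn) oV.
have f6 : 2 * (6 * fAC #|V|) = 3 * (#|V| * (#|V| - 2)).
  rewrite -eV fAC_even; move: (#|V|./2) => j; rewrite -muln2; clear.
  by case: j => // j; rewrite /= (_ : j.+1 * 2 - 2 = j * 2); [nia|lia].
split; first by move: bound f6; clear; lia.
move=> V3 ge; have ge' : 3 * (#|V| * (#|V| - 2)) <= 2 * ntriples T by move: ge f6; clear; lia.
have tight_all m' n' (mm' : max_matching (thick T) m') (nn' : max_matching (star_pair T m') n') :=
  ntriples_tight acT mm' nn' (slack m' n' mm' nn') oV ge'.
case: (even_structure acT tight_all (ltnW V3)) => [[K [k h]]|h].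
  by apply: Or31; exists K, k; split=> // oV'; rewrite oV' in oV.
exact: Or32.
Qed.
End Step.

(** * Families of triples and their relations *)

Definition trip (V : finType) (F : {set {set V}}) a b c := [set a; b; c] \in F.

Section Triples.
Variable V : finType.
Implicit Types (F : {set {set V}}) (e : {set V}) (a b c d v x y z : V).

Lemma set3CA a b c : [set a; b; c] = [set b; a; c].
Proof. by rewrite (setUC [set a]). Qed.

Lemma set3AC a b c : [set a; b; c] = [set a; c; b].
Proof. by rewrite setUAC. Qed.

Lemma in_set3 x a b c : (x \in [set a; b; c]) = [|| x == a, x == b | x == c].
Proof. by rewrite !inE -orbA. Qed.

Lemma card_set3 a b c : (#|[set a; b; c]| == 3) = [&& a != b, a != c & b != c].
Proof.
rewrite setUC cardsU1 cards2 !inE negb_or (eq_sym c a) (eq_sym c b).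
by case: (a == b); case: (a == c); case: (b == c).
Qed.

Lemma card3P e : reflect (exists a b c, e = [set a; b; c] /\ [&& a != b, a != c & b != c]) (#|e| == 3).
Proof.
apply: (iffP idP) => [e3|[a [b [c [-> h]]]]]; last by rewrite card_set3.
have [a ae] : exists a, a \in e by apply/set0Pn; rewrite -card_gt0 (eqP e3).
have : #|e :\ a| == 2 by rewrite -eqSS -add1n -(eqP e3) (cardsD1 a e) ae.
case/cards2P => b [c [bc ebc]]; exists a, b, c.
have ee : e = [set a; b; c] by rewrite -(setD1K ae) ebc setUA.
by split=> //; rewrite -card_set3 -ee.
Qed.

Lemma tripleP F e : triple_system F -> e \in F ->
  exists a b c, [/\ e = [set a; b; c], trip F a b c & [&& a != b, a != c & b != c]].
Proof.
move=> /forall_inP sF eF; have /card3P[a [b [c [ee h]]]] := sF e eF.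
by exists a, b, c; rewrite /trip -ee.
Qed.

Lemma trip_neq F a b c : triple_system F -> trip F a b c -> [&& a != b, a != c & b != c].
Proof. by move=> /forall_inP sF /sF; rewrite card_set3. Qed.

Lemma acfree_trip F : triple_system F ->
  (forall a b c x, trip F a b x -> trip F a c x -> trip F b c x -> False) ->
  (forall a b c x y z, trip F a b x -> trip F a c y -> trip F b c z ->
    x != c -> y != b -> z != a -> x != y -> x != z -> y != z -> False) ->
  acfree (trip F).
Proof.
move=> sF cf af; split=> //.
- by move=> a b c; rewrite /trip set3CA.
- by move=> a b c; rewrite /trip set3AC.
- by move=> a b; apply/negP => /(trip_neq sF); rewrite eqxx.
Qed.

(** Given the first vertices, the next one ranges over the remaining elements
    of e: 3 * 2 * 1 choices. *)
Lemma sum_set3 e : #|e| = 3 -> \sum_a \sum_b \sum_c (e == [set a; b; c]) = 6.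
Proof.
move=> e3; have sub a b c : (e == [set a; b; c]) = [&& a \in e, b \in e :\ a & c \in e :\ a :\ b].
  apply/eqP/and3P => [ee|[ae]].
    have : #|[set a; b; c]| == 3 by rewrite -ee e3.
    rewrite card_set3 => /and3P[ab ac bc]; rewrite !inE ee !in_set3 !eqxx !orbT.
    by rewrite (eq_sym b a) (eq_sym c a) (eq_sym c b) ab ac bc.
  rewrite !inE => /andP[ba be] /and3P[cb ca ce].
  apply/esym/eqP; rewrite eqEcard e3 leq_eqVlt eq_sym card_set3.
  rewrite (eq_sym a b) (eq_sym a c) (eq_sym b c) ba ca cb /= andbT.
  by apply/subsetP => z; rewrite in_set3 => /or3P[] /eqP ->.
have row (P : bool) (A : {set V}) (G : V -> nat) k :
    (forall b, b \in A -> G b = k) -> P -> \sum_b (P && (b \in A)) * G b = #|A| * k.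
  move=> gk ->; rewrite -sum_nat_const [RHS]big_mkcond; apply: eq_bigr => b _ /=.
  by case bA: (b \in A); rewrite ?mul1n ?mul0n ?gk.
have one a b : a \in e -> b \in e :\ a -> \sum_c (e == [set a; b; c]) = 1.
  move=> ae be; rewrite (eq_bigr (fun c => nat_of_bool (c \in e :\ a :\ b))); last first.
    by move=> c _; rewrite sub ae be.
  rewrite -[LHS]big_mkcond sum1_card.
  by have := cardsD1 a e; have := cardsD1 b (e :\ a); rewrite ae be e3; clear; lia.
have zero a b : ~~ ((a \in e) && (b \in e :\ a)) -> \sum_c (e == [set a; b; c]) = 0.
  by move=> h; apply: big1 => c _; rewrite sub andbA (negbTE h).
have two a : a \in e -> \sum_b \sum_c (e == [set a; b; c]) = 2.
  move=> ae; rewrite (eq_bigr (fun b => nat_of_bool (b \in e :\ a))); last first.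
    move=> b _; case be : (b \in e :\ a); first by rewrite one.
    by rewrite zero // be andbF.
  rewrite -[LHS]big_mkcond sum1_card.
  by have := cardsD1 a e; rewrite ae e3; clear; lia.
rewrite (bigID (mem e)) /= (eq_bigr (fun=> 2)) // sum_nat_const e3.
by rewrite big1 // => a ae; apply: big1 => b _; apply: zero; rewrite (negbTE ae).
Qed.

Lemma ntriples_trip F : triple_system F -> ntriples (trip F) = 6 * #|F|.
Proof.
move=> /forall_inP sF.
have e1 a b c : nat_of_bool (trip F a b c) = \sum_(e in F) (e == [set a; b; c]).
  rewrite /trip; case h : (_ \in F).
    rewrite (bigD1 [set a; b; c]) //= eqxx big1 // => e /andP[_ /negbTE ->] //.
  by rewrite big1 // => e eF; apply/eqP; rewrite eqb0; apply: contraFneq h => <-.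
rewrite /ntriples; under eq_bigr do under eq_bigr do under eq_bigr do rewrite e1.
under eq_bigr do under eq_bigr do rewrite exchange_big /=.
under eq_bigr do rewrite exchange_big /=.
rewrite exchange_big /= (eq_bigr (fun=> 6)); last first.
  by move=> e eF; apply: sum_set3; apply/eqP; apply: sF.
by rewrite sum_nat_const mulnC.
Qed.
End Triples.

Section Relabel.
Variables (V W : finType).
Implicit Types (F : {set {set V}}) (h : V -> W).

Lemma imset_set3 h a b c : h @: [set a; b; c] = [set h a; h b; h c].
Proof. by rewrite !imsetU !imset_set1. Qed.

Lemma card_relabel h F : injective h -> #|relabel h F| = #|F|.
Proof. by move=> hI; apply: card_imset; apply: imset_inj. Qed.

Lemma trip_relabel h F a b c : injective h -> 
  trip (relabel h F) (h a) (h b) (h c) = trip F a b c.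
Proof. by move=> hI; rewrite /trip -imset_set3 (mem_imset _ _ (imset_inj hI)). Qed.

Lemma triple_system_relabel h F : injective h -> triple_system F -> triple_system (relabel h F).
Proof.
move=> hI /forall_inP sF; apply/forall_inP => _ /imsetP[e eF ->].
by rewrite card_imset // sF.
Qed.

(** Serves for relabelled and restricted families, and for extensions with a
    relation T that is decided by case analysis. *)
Lemma acfree_pull F (T : W -> W -> W -> bool) h : triple_system F -> injective h ->
  (forall a b c, trip F a b c -> T (h a) (h b) (h c)) -> acfree T -> acfree (trip F).
Proof.
move=> sF hI hT acT; apply: acfree_trip => // [a b c x h1 h2 h3|a b c x y z h1 h2 h3].
  exact: (C_free acT (hT _ _ _ h1) (hT _ _ _ h2) (hT _ _ _ h3)).
move=> *; apply: (A_free acT (hT _ _ _ h1) (hT _ _ _ h2) (hT _ _ _ h3));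
  by rewrite (inj_eq hI).
Qed.
End Relabel.

Lemma isomorphic_trip (V W : finType) (F : {set {set V}}) (G : {set {set W}}) :
  isomorphic F G -> triple_system F -> acfree (trip F) ->
  [/\ triple_system G, acfree (trip G), #|G| = #|F| & #|W| = #|V|].
Proof.
case=> h [hb ->] sF acF; have hI := bij_inj hb.
have sG := triple_system_relabel hI sF.
split=> //; [|exact: card_relabel|by rewrite (bij_eq_card hb)].
case: hb => g hg gh; have gI : injective g := can_inj gh.
apply: (acfree_pull sG gI _ acF) => a b c.
by rewrite -{1}(gh a) -{1}(gh b) -{1}(gh c) trip_relabel.
Qed.

Section Avoid.
Variables (V : finType) (F : {set {set V}}).
Hypothesis sF : triple_system F.

Lemma vtx_eq k i j : 0 < i <= k.+1 -> 0 < j <= k.+1 -> (vtx k i == vtx k j) = (i == j).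
Proof.
case: i j => [|i] [|j] //= ik jk.
by rewrite /vtx -val_eqE /= !inordK // eqSS.
Qed.

Lemma avoids_acfree : avoids F [:: confA; confC] <-> acfree (trip F).
Proof.
rewrite /avoids /= andbT; split=> [/andP[nA nC]|acF].
  apply: acfree_trip => // [a b c x h1 h2 h3|a b c x y z h1 h2 h3].
    case/existsP: nC; have /and3P[ab ax bx] := trip_neq sF h1.
    have /and3P[ac _ cx] := trip_neq sF h2; have /and3P[bc _ _] := trip_neq sF h3.
    pose s := [:: a; b; c; x]; exists [ffun i : 'I_4 => nth a s i].
    have us : uniq s by rewrite /= !inE !negb_or ab ac ax bc bx cx.
    apply/andP; split.
      apply/injectiveP => i j; rewrite !ffunE => /eqP; rewrite nth_uniq //= => /eqP e.
      exact: val_inj.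
    apply/subsetP => _ /imsetP[e + ->]; rewrite !inE -orbA.
    by case/or3P => /eqP ->; rewrite imset_set3 !ffunE /= !inordK.
  move=> xc yb za xy xz yz.
  case/existsP: nA; have /and3P[ab ax bx] := trip_neq sF h1.
  have /and3P[ac ay cy] := trip_neq sF h2; have /and3P[bc bz cz] := trip_neq sF h3.
  pose s := [:: a; b; c; x; y; z]; exists [ffun i : 'I_6 => nth a s i].
  have us : uniq s.
    rewrite /= !inE !negb_or ab ac ax bc bx cy ay bz cz xy xz yz.
    by rewrite (eq_sym a z) za (eq_sym b y) yb (eq_sym c x) xc.
  apply/andP; split.
    apply/injectiveP => i j; rewrite !ffunE => /eqP; rewrite nth_uniq //= => /eqP e.
    exact: val_inj.
  apply/subsetP => _ /imsetP[e + ->]; rewrite !inE -orbA.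
  by case/or3P => /eqP ->; rewrite imset_set3 !ffunE /= !inordK.
apply/andP; split; apply/existsP => -[h /andP[/injectiveP hI /subsetP hF]].
  have T i j k : triple 5 i j k \in triples confA -> trip F (h (vtx 5 i)) (h (vtx 5 j)) (h (vtx 5 k)).
    by move=> t; rewrite /trip -imset_set3; apply: hF; apply: imset_f.
  have h1 := T 1 2 4; have h2 := T 1 3 5; have h3 := T 2 3 6.
  by apply: (A_free acF (h1 _) (h2 _) (h3 _)); rewrite ?inE ?eqxx ?orbT ?(inj_eq hI) ?vtx_eq.
have T i j k : triple 3 i j k \in triples confC -> trip F (h (vtx 3 i)) (h (vtx 3 j)) (h (vtx 3 k)).
  by move=> t; rewrite /trip -imset_set3; apply: hF; apply: imset_f.
have h1 := T 1 2 4; have h2 := T 1 3 4; have h3 := T 2 3 4.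
by apply: (C_free acF (h1 _) (h2 _) (h3 _)); rewrite ?inE ?eqxx ?orbT.
Qed.
End Avoid.

Section Restrict.
Variables (V : finType) (F : {set {set V}}) (X : {set V}).
Hypothesis sF : triple_system F.
Hypothesis acF : acfree (trip F).
Notation U := {x : V | x \in X}.

Definition restrict : {set {set U}} := [set e | val @: (e : {set U}) \in F].

Lemma trip_restrict a b c : trip restrict a b c = trip F (val a) (val b) (val c).
Proof. by rewrite /trip inE imset_set3. Qed.

Lemma triple_system_restrict : triple_system restrict.
Proof.
apply/forall_inP => e; rewrite inE => eF.
by move/forall_inP: sF => /(_ _ eF); rewrite card_imset //; apply: val_inj.
Qed.

Lemma acfree_restrict : acfree (trip restrict).
Proof.
apply: (acfree_pull triple_system_restrict val_inj _ acF) => a b c.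
by rewrite trip_restrict.
Qed.

Lemma card_restrict_type : #|{: U}| = #|X|.
Proof. by rewrite card_sig; apply: eq_card => x. Qed.

Lemma inside_restrict : inside (trip F) X = ntriples (trip restrict).
Proof.
rewrite /inside /ntriples big_sub; apply: eq_bigr => a _.
rewrite big_sub; apply: eq_bigr => b _; rewrite big_sub; apply: eq_bigr => c _.
by rewrite trip_restrict.
Qed.
End Restrict.

(** * The two extensions as relations *)

Section ExtRelations.
Variables (V : finType) (T : V -> V -> V -> bool).
Hypothesis acT : acfree T.

(** The booleans are the two new vertices. *)
Definition ext2_trip (p q r : V + bool) :=
  match p, q, r with
  | inl a, inl b, inl c => T a b c
  | inl _, inr i, inr j | inr i, inl _, inr j | inr i, inr j, inl _ => i != j
  | _, _, _ => false
  end.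

Lemma acfree_ext2_trip : acfree ext2_trip.
Proof.
split.
- by case=> [a|i] [b|j] [c|k] //=; [apply: (tripleCl acT)|rewrite eq_sym].
- by case=> [a|i] [b|j] [c|k] //=; [apply: (tripleCr acT)|rewrite eq_sym].
- by case=> [a|i] [b|j] //=; [apply: (tripleI acT)|rewrite eqxx].
- case=> [a|[]] [b|[]] c [x|[]] //=; case: c => [c|[]] //=.
  exact: (C_free acT).
- move=> a b c x y z; case: a => [a|[]]; case: b => [b|[]]; case: x => [x|[]] //=;
  case: c => [c|[]]; case: y => [y|[]] //=; case: z => [z|[]] //=; rewrite ?eqxx //.
  by move=> h1 h2 h3 n1 n2 n3 n4 n5 n6; apply: (A_free acT h1 h2 h3); [move: n1|move: n2|move: n3|move: n4|move: n5|move: n6].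
Qed.

(** A new vertex (g, i) belongs to the pair 12 or 34 according to g, and i
    tells whether it is one of the vertices 2 and 3 that lie in both triples
    of new vertices. *)
Definition ext4_trip (p q r : V + bool * bool) :=
  match p, q, r with
  | inl a, inl b, inl c => T a b c
  | inl _, inr i, inr j | inr i, inl _, inr j | inr i, inr j, inl _ =>
      (i.1 == j.1) && (i.2 != j.2)
  | inr i, inr j, inr k =>
      [&& i != j, i != k, j != k & i.2 + j.2 + k.2 == 2]
  | _, _, _ => false
  end.

Lemma acfree_ext4_trip : acfree ext4_trip.
Proof.
split.
- case=> [a|i] [b|j] [c|k] //=; [apply: (tripleCl acT)|by rewrite eq_sym (eq_sym i.2)|].
  by rewrite (eq_sym i j) (addnC i.2) (andbCA (i != k)).
- case=> [a|i] [b|j] [c|k] //=; [apply: (tripleCr acT)|by rewrite eq_sym (eq_sym j.2)|].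
  by rewrite (eq_sym j k) (addnAC i.2) (andbCA (i != j)).
- case=> [a|i] [b|j] //=; rewrite ?(tripleI acT) ?eqxx /= ?eqxx ?andbF //.
- case=> [a|[[] []]] [b|[[] []]] c [x|[[] []]] //=; case: c => [c|[[] []]] //=.
  exact: (C_free acT).
- move=> a b c x y z; case: a => [a|[[] []]]; case: b => [b|[[] []]]; case: x => [x|[[] []]] //=;
  case: c => [c|[[] []]]; case: y => [y|[[] []]] //=; case: z => [z|[[] []]] //=; rewrite ?eqxx //.
  by move=> h1 h2 h3 n1 n2 n3 n4 n5 n6; apply: (A_free acT h1 h2 h3); [move: n1|move: n2|move: n3|move: n4|move: n5|move: n6].
Qed.
End ExtRelations.

(** * The two extensions preserve triples, freeness and counts *)

Section Ext2.
Variables (V : finType) (F : {set {set V}}).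
Hypothesis sF : triple_system F.
Notation W := (V + 'I_2)%type.
Notation new i := (inr (vtx 1 i) : W).

Lemma vtx1_neq : vtx 1 1 != vtx 1 2. Proof. by rewrite vtx_eq. Qed.

Lemma triple_system_ext2 : triple_system (ext2 F).
Proof.
apply/forall_inP => e /setUP[eF|/imsetP[v _ ->]].
  have inlI : injective (@inl V 'I_2) by move=> ? ? [].
  by have /forall_inP := triple_system_relabel inlI sF; apply.
by rewrite card_set3 /= andbT; apply: vtx1_neq.
Qed.

Lemma card_ext2 : #|ext2 F| = #|F| + #|V|.
Proof.
rewrite /ext2 cardsU disjoint_setI0 ?cards0 ?subn0.
  rewrite card_relabel; last by move=> ? ? [].
  rewrite card_imset ?cardsT // => u v e.
  have : inl u \in [set new 1; new 2; inl v] by rewrite -e in_set3 eqxx !orbT.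
  by rewrite in_set3 /= => /eqP[].
rewrite disjoints_subset; apply/subsetP => _ /imsetP[e eF ->]; rewrite inE.
apply/imsetP => -[v _ ee]; have : new 1 \in inl @: e by rewrite ee in_set3 eqxx.
by case/imsetP.
Qed.

Definition ext2_code (p : W) : V + bool :=
  match p with inl v => inl v | inr i => inr (i == 1 :> nat) end.

Lemma acfree_ext2 : acfree (trip F) -> acfree (trip (ext2 F)).
Proof.
move=> acF; apply: (acfree_pull triple_system_ext2 (h := ext2_code) _ _ (acfree_ext2_trip acF)).
  move=> [u|i] [v|j] //= [] => [->//|] e.
  by congr inr; apply: val_inj; move: e; case: i => [[|[|i]]] //= _; case: j => [[|[|j]]].
have codev i : 0 < i <= 2 -> ext2_code (new i) = inr (i == 2).
  by case: i => // i ih; rewrite /= /vtx /= inordK.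
move=> p q r pqr; have := trip_neq triple_system_ext2 pqr.
case/setUP: pqr => [/imsetP[e eF ee]|/imsetP[v _ ee]].
  have mem x : x \in [set p; q; r] -> exists y, x = inl y by rewrite ee => /imsetP[y _ ->]; exists y.
  have [|a ea] := mem p; first by rewrite in_set3 eqxx.
  have [|b eb] := mem q; first by rewrite in_set3 eqxx !orbT.
  have [|c ec] := mem r; first by rewrite in_set3 eqxx !orbT.
  subst p q r => _ /=; rewrite /trip.
  have inlI : injective (@inl V 'I_2) by move=> ? ? [].
  by rewrite -imset_set3 in ee; rewrite (imset_inj inlI ee).
have mem x : x \in [set p; q; r] -> [|| x == new 1, x == new 2 | x == inl v].
  by rewrite ee in_set3.
have := mem p; have := mem q; have := mem r; rewrite !in_set3 !eqxx !orbT.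
move=> /(_ isT) /or3P[] /eqP -> /(_ isT) /or3P[] /eqP -> /(_ isT) /or3P[] /eqP ->;
  by rewrite ?eqxx ?andbF // !codev.
Qed.
End Ext2.

Section Ext4.
Variables (V : finType) (F : {set {set V}}).
Hypothesis sF : triple_system F.
Notation W := (V + 'I_4)%type.
Notation new i := (inr (vtx 3 i) : W).

Lemma new_eq i j : 0 < i <= 4 -> 0 < j <= 4 -> (new i == new j) = (i == j).
Proof. exact: vtx_eq. Qed.

Lemma triple_system_ext4 : triple_system (ext4 F).
Proof.
apply/forall_inP => e; rewrite !in_setU => /orP[/orP[/orP[eF|/imsetP[v _ ->]]|/imsetP[v _ ->]]|].
- have inlI : injective (@inl V 'I_4) by move=> ? ? [].
  by have /forall_inP := triple_system_relabel inlI sF; apply.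
- by rewrite card_set3 !new_eq.
- by rewrite card_set3 !new_eq.
- by rewrite !inE => /orP[] /eqP ->; rewrite card_set3 !new_eq.
Qed.

Lemma card_pencil i j : 
  #|[set [set new i; new j; inl v] | v : V]| = #|V|.
Proof.
rewrite card_imset ?cardsT // => u v e.
have : inl u \in [set new i; new j; inl v] by rewrite -e in_set3 eqxx !orbT.
by rewrite in_set3 /= => /eqP[].
Qed.

Lemma cardsU_disjoint (T : finType) (A B : {set T}) : (forall x, x \in A -> x \in B -> False) ->
  #|A :|: B| = #|A| + #|B|.
Proof.
move=> dis; rewrite cardsU disjoint_setI0 ?cards0 ?subn0 //.
by rewrite disjoints_subset; apply/subsetP => x xA; rewrite inE; apply/negP; apply: dis.
Qed.

Lemma card_ext4 : #|ext4 F| = #|F| + 2 * #|V| + 2.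
Proof.
rewrite /ext4 cardsU_disjoint; first (rewrite cardsU_disjoint; first rewrite cardsU_disjoint).
- rewrite card_relabel; last by move=> ? ? [].
  rewrite !card_pencil cards2 (_ : _ != _); first by clear; lia.
  apply/eqP => e; have : new 1 \in [set new 2; new 3; new 4] by rewrite -e in_set3 eqxx.
  by rewrite in_set3 !new_eq.
- move=> _ /imsetP[e eF ->] /imsetP[v _ ee].
  by have : new 1 \in inl @: e by [rewrite ee in_set3 eqxx]; case/imsetP.
- move=> e /setUP[/imsetP[e' eF ->]|/imsetP[u _ ->]] /imsetP[v _ ee].
    by have : new 3 \in inl @: e' by [rewrite ee in_set3 eqxx]; case/imsetP.
  have : new 1 \in [set new 3; new 4; inl v] by rewrite -ee in_set3 eqxx.
  by rewrite in_set3 !new_eq.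
- move=> e e1 e2; have nl v : inl v \notin e.
    by move: e2; rewrite !inE => /orP[] /eqP ->; rewrite in_set3.
  have n2 : new 2 \in e by move: e2; rewrite !inE => /orP[] /eqP ->; rewrite in_set3 eqxx ?orbT.
  case/setUP: e1 => [/setUP[/imsetP[e' _ ee]|/imsetP[v _ ee]]|/imsetP[v _ ee]].
  + by rewrite ee in n2; case/imsetP: n2.
  + by have := nl v; rewrite ee in_set3 eqxx !orbT.
  + by have := nl v; rewrite ee in_set3 eqxx !orbT.
Qed.

Definition ext4_code (p : W) : V + bool * bool :=
  match p with inl v => inl v | inr i => inr (1 < i, (i == 1 :> nat) || (i == 2 :> nat)) end.

Lemma acfree_ext4 : acfree (trip F) -> acfree (trip (ext4 F)).
Proof.
move=> acF; apply: (acfree_pull triple_system_ext4 (h := ext4_code) _ _ (acfree_ext4_trip acF)).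
  move=> [u|i] [v|j] //= [] => [->//|] e1 e2.
  congr inr; apply: val_inj; move: e1 e2.
  by case: i => [[|[|[|[|i]]]]] //= _; case: j => [[|[|[|[|j]]]]].
have codev i : 0 < i <= 4 -> ext4_code (new i) = inr (2 < i, (i == 2) || (i == 3)).
  by case: i => // i ih; rewrite /= /vtx /= inordK.
move=> p q r pqr; have := trip_neq triple_system_ext4 pqr.
have star x y z : [set p; q; r] = [set x; y; z] -> 
    [&& (p == x) || (p == y) || (p == z), (q == x) || (q == y) || (q == z)
      & (r == x) || (r == y) || (r == z)].
  have pP : p \in [set p; q; r] by rewrite in_set3 eqxx.
  have qP : q \in [set p; q; r] by rewrite in_set3 eqxx !orbT.
  have rP : r \in [set p; q; r] by rewrite in_set3 eqxx !orbT.
  by move=> e; move: pP qP rP; rewrite e !in_set3 -!orbA => -> -> ->.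
move: pqr; rewrite /trip !in_setU => /orP[/orP[/orP[|]|]|].
- case/imsetP => e eF ee.
  have mem x : x \in [set p; q; r] -> exists y, x = inl y by rewrite ee => /imsetP[y _ ->]; exists y.
  have [|a ea] := mem p; first by rewrite in_set3 eqxx.
  have [|b eb] := mem q; first by rewrite in_set3 eqxx !orbT.
  have [|c ec] := mem r; first by rewrite in_set3 eqxx !orbT.
  subst p q r => _ /=.
  have inlI : injective (@inl V 'I_4) by move=> ? ? [].
  by rewrite -imset_set3 in ee; rewrite (imset_inj inlI ee).
- case/imsetP => v _ /star /and3P[].
  move=> /orP[/orP[]|] /eqP -> /orP[/orP[]|] /eqP -> /orP[/orP[]|] /eqP ->;
    by rewrite ?eqxx ?andbF // !codev.
- case/imsetP => v _ /star /and3P[].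
  move=> /orP[/orP[]|] /eqP -> /orP[/orP[]|] /eqP -> /orP[/orP[]|] /eqP ->;
    by rewrite ?eqxx ?andbF // !codev.
- rewrite !inE => /orP[] /eqP /star /and3P[].
  + move=> /orP[/orP[]|] /eqP -> /orP[/orP[]|] /eqP -> /orP[/orP[]|] /eqP ->;
    by rewrite ?eqxx ?andbF // !codev.
  + move=> /orP[/orP[]|] /eqP -> /orP[/orP[]|] /eqP -> /orP[/orP[]|] /eqP ->;
    by rewrite ?eqxx ?andbF // !codev.
Qed.
End Ext4.

(** * The base systems and all systems built from them *)

(** At n = 1 and n = 3 the recursion fails, because fAC then takes its smaller
    value. *)
Lemma fAC_ext2 n : n != 1 -> n != 3 -> fAC (n + 2) = fAC n + n.
Proof.
have [n3|] := ltnP 3 n; first by move=> _ _; apply: fAC_add2.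
by case: n => [|[|[|[|]]]].
Qed.

Lemma fAC_ext4 n : n != 1 -> n != 3 -> fAC (n + 4) = fAC n + 2 * n + 2.
Proof.
move=> n1 n3; rewrite (_ : n + 4 = n + 2 + 2); last by clear; lia.
rewrite !fAC_ext2 //; first by clear; lia.
  by move: n n1 n3 => [|[|[|n]]].
by move: n n1 n3 => [|[|[|n]]] //; lia.
Qed.

Definition extremal (V : finType) (F : {set {set V}}) :=
  [/\ triple_system F, acfree (trip F) & #|F| = fAC #|V|].

Lemma isomorphic_extremal (V W : finType) (F : {set {set V}}) (G : {set {set W}}) :
  isomorphic F G -> extremal F -> extremal G.
Proof. by move=> i [h1 h2 h3]; have [g1 g2 g3 g4] := isomorphic_trip i h1 h2; split=> //; rewrite g3 h3 g4. Qed.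

Lemma extremal_ext2 (V : finType) (F : {set {set V}}) : #|V| != 1 -> #|V| != 3 ->
  extremal F -> extremal (ext2 F).
Proof.
move=> n1 n3 [sF acF cF]; split; first exact: triple_system_ext2.
  exact: acfree_ext2.
by rewrite card_ext2 // card_sum card_ord fAC_ext2 // cF.
Qed.

Lemma extremal_ext4 (V : finType) (F : {set {set V}}) : #|V| != 1 -> #|V| != 3 ->
  extremal F -> extremal (ext4 F).
Proof.
move=> n1 n3 [sF acF cF]; split; first exact: triple_system_ext4.
  exact: acfree_ext4.
by rewrite card_ext4 // card_sum card_ord fAC_ext4 // cF.
Qed.

Lemma obtained_extremal (V0 V : finType) (F0 : {set {set V0}}) (F : {set {set V}}) :
  obtained_from F0 F -> #|V0| != 1 -> #|V0| != 3 -> extremal F0 ->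
  [/\ extremal F, #|V| != 1 & #|V| != 3].
Proof.
move=> ob n1 n3 ex0.
have sz (U W : finType) (G : {set {set U}}) (H : {set {set W}}) : isomorphic G H -> #|W| = #|U|.
  by case=> h [hb _]; rewrite (bij_eq_card hb).
elim: ob => {V F} [V F i|V W F G _ [ex m1 m3] i|V W F G _ [ex m1 m3] i].
- by rewrite (sz _ _ _ _ i); split=> //; apply: isomorphic_extremal i ex0.
- rewrite (sz _ _ _ _ i) card_sum card_ord; split.
  + exact: isomorphic_extremal i (extremal_ext2 m1 m3 ex).
  + by rewrite addn2; case: #|V|.
  + by rewrite addn2 !eqSS.
- rewrite (sz _ _ _ _ i) card_sum card_ord; split.
  + exact: isomorphic_extremal i (extremal_ext4 m1 m3 ex).
  + by rewrite addn4.
  + by rewrite addn4.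
Qed.

Section Star.
Variable m : nat.
Hypothesis m_gt0 : 0 < m.
Notation U := (option ('I_(m.-1)./2 + 'I_(uphalf m.-1))).

Definition star_code (p : U) : nat :=
  match p with None => 0 | Some (inl _) => 1 | Some (inr _) => 2 end.

Lemma card_star_type : #|{: U}| = m.
Proof.
rewrite card_option card_sum !card_ord uphalf_half addnCA addnn odd_double_half.
by rewrite prednK.
Qed.

Lemma trip_star p q r : trip (Fstar m) p q r ->
  [/\ star_code p != star_code q, star_code p != star_code r & star_code q != star_code r].
Proof.
case/imset2P => a b _ _ ee.
have mem x : x \in [set p; q; r] -> [|| x == None, x == Some (inl a) | x == Some (inr b)].
  by rewrite ee in_set3.
have c3 : #|[set p; q; r]| == 3 by rewrite ee card_set3.
move: c3; rewrite card_set3; have := mem p; have := mem q; have := mem r.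
rewrite !in_set3 !eqxx !orbT.
by move=> /(_ isT) /or3P[] /eqP -> /(_ isT) /or3P[] /eqP -> /(_ isT) /or3P[] /eqP ->; rewrite ?eqxx ?andbF.
Qed.

Lemma triple_system_star : triple_system (Fstar m).
Proof. by apply/forall_inP => e /imset2P[a b _ _ ->]; rewrite card_set3. Qed.

(** The apex and the two parts are colour classes that every triple meets
    once. In C four vertices would need four colours. In A one vertex of the
    triangle would be the apex, and so would the vertex completing the
    opposite side. *)
Lemma acfree_star : acfree (trip (Fstar m)).
Proof.
have lt3 p : star_code p < 3 by case: p => [[]|].
have none p q : star_code p = 0 -> star_code q = 0 -> p = q by case: p q => [[]|] // [[]|].
apply: acfree_trip => [|a b c x|a b c x y z]; first exact: triple_system_star.
  move=> /trip_star[h1 h2 h3] /trip_star[h4 h5 h6] /trip_star[h7 h8 h9].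
  move: (lt3 a) (lt3 b) (lt3 c) (lt3 x) h1 h2 h3 h4 h5 h6 h7 h8 h9.
  by clear; lia.
move=> /trip_star[h1 h2 h3] /trip_star[h4 h5 h6] /trip_star[h7 h8 h9] xc yb za _ _ _.
have nz p q : p != q -> (star_code p != 0) || (star_code q != 0).
  by move=> pq; rewrite -negb_and; apply: contra_neqN pq => /andP[/eqP ? /eqP ?]; apply: none.
move: (nz _ _ xc) (nz _ _ yb) (nz _ _ za).
move: (lt3 a) (lt3 b) (lt3 c) (lt3 x) (lt3 y) (lt3 z) h1 h2 h3 h4 h5 h6 h7 h8 h9.
move: (star_code a) (star_code b) (star_code c) (star_code x) (star_code y) (star_code z).
by case=> [|[|[|?]]] [|[|[|?]]] [|[|[|?]]] //; clear; lia.
Qed.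

Lemma card_star : #|Fstar m| = (m.-1)./2 * uphalf m.-1.
Proof.
have -> : Fstar m = [set [set None; Some (inl p.1); Some (inr p.2)] | p : 'I_(m.-1)./2 * 'I_(uphalf m.-1)].
  apply/setP => e; apply/imset2P/imsetP => [[a b _ _ ->]|[[a b] _ ->]]; first by exists (a, b).
  by exists a b.
rewrite card_imset; first by rewrite card_prod !card_ord.
move=> [a b] [c d] /= e.
have : Some (inl a) \in [set None; Some (inl c); Some (inr d)] by rewrite -e in_set3 eqxx !orbT.
have : Some (inr b) \in [set None; Some (inl c); Some (inr d)] by rewrite -e in_set3 eqxx !orbT.
by rewrite !in_set3 /= orbF => /eqP[->] /eqP[->].
Qed.

Lemma extremal_star : [|| ~~ odd m, m == 1 | m == 3] -> extremal (Fstar m).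
Proof.
move=> h; split; [exact: triple_system_star|exact: acfree_star|].
rewrite card_star card_star_type; case/or3P: h m_gt0 => [em|/eqP->|/eqP->] //.
have e : m = (m./2).*2 by rewrite -[LHS]odd_double_half (negbTE em).
rewrite e fAC_even; case: (m./2) => // k _.
by rewrite doubleS /= uphalf_double doubleK mulnC.
Qed.
End Star.

Section RingBase.
(** A set of vertices is identified by the sum of the powers of two; the
    listed sums are those of the five triples of cyclically consecutive
    vertices. *)
Definition ring_code (p q r : 'I_5) := 2 ^ p + 2 ^ q + 2 ^ r \in [:: 7; 14; 28; 25; 19].

Lemma trip_five_ring p q r : trip five_ring p q r -> ring_code p q r.
Proof.
have mem (x y z : 'I_5) : [set p; q; r] = [set x; y; z] -> [&& x != y, x != z & y != z] -> ring_code x y z -> ring_code p q r.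
  move=> ee dxyz; have : #|[set p; q; r]| == 3 by rewrite ee card_set3.
  rewrite card_set3.
  have : p \in [set x; y; z] by rewrite -ee in_set3 eqxx.
  have : q \in [set x; y; z] by rewrite -ee in_set3 eqxx !orbT.
  have : r \in [set x; y; z] by rewrite -ee in_set3 eqxx !orbT.
  rewrite /ring_code !in_set3.
  move=> /or3P[] /eqP -> /or3P[] /eqP -> /or3P[] /eqP ->; rewrite ?eqxx ?andbF // => _;
  by move: (2 ^ x) (2 ^ y) (2 ^ z) => i j k; rewrite !inE; clear; lia.
rewrite /trip !inE => h.
case/orP: h => [/orP[/orP[/orP[]|]|]|] /eqP /mem; apply; rewrite ?vtx_eq // /ring_code /vtx /= !inordK //.
Qed.

Lemma triple_system_five_ring : triple_system five_ring.
Proof.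
apply/forall_inP => e; rewrite !inE => h.
by case/orP: h => [/orP[/orP[/orP[]|]|]|] /eqP ->; rewrite card_set3 !vtx_eq.
Qed.

Lemma triple_eqF i j k i' j' k' :
  let ok x := 0 < x <= 5 in all ok [:: i; j; k; i'; j'; k'] ->
  ~~ [&& i \in [:: i'; j'; k'], j \in [:: i'; j'; k'] & k \in [:: i'; j'; k']] ->
  (triple 4 i j k == triple 4 i' j' k') = false.
Proof.
move=> ok /= /and5P[oi oj ok' oi' /and3P[oj' ok'' _]]; apply: contraNF => /eqP e.
have mem x : ok x -> vtx 4 x \in triple 4 i j k -> x \in [:: i'; j'; k'].
  by move=> ox; rewrite e in_set3 !vtx_eq // !inE.
by rewrite !mem // in_set3 eqxx ?orbT.
Qed.

Lemma card_five_ring : #|five_ring| = 5.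
Proof.
pose s := [:: triple 4 1 2 3; triple 4 2 3 4; triple 4 3 4 5; triple 4 4 5 1; triple 4 5 1 2].
have -> : #|five_ring| = #|s| by apply: eq_card => e; rewrite !inE -!orbA.
by rewrite (card_uniqP _) //= !inE !triple_eqF.
Qed.

Lemma acfree_five_ring : acfree (trip five_ring).
Proof.
apply: acfree_trip => [|a b c x|a b c x y z h1 h2 h3 n1 n2 n3 n4 n5 n6]; first exact: triple_system_five_ring.
  move=> /trip_five_ring + /trip_five_ring + /trip_five_ring; rewrite /ring_code.
  case: a => [[|[|[|[|[|a]]]]] //= _]; case: b => [[|[|[|[|[|b]]]]] //= _];
  case: x => [[|[|[|[|[|x]]]]] //= _]; case: c => [[|[|[|[|[|c]]]]] //= _] //.
have /and3P[ab ax bx] := trip_neq triple_system_five_ring h1.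
have /and3P[ac ay cy] := trip_neq triple_system_five_ring h2.
have /and3P[bc bz cz] := trip_neq triple_system_five_ring h3.
have us : uniq [:: a; b; c; x; y; z].
  rewrite /= !inE !negb_or ab ac ax bc bx cy ay bz cz n4 n5 n6.
  by rewrite (eq_sym a z) n3 (eq_sym b y) n2 (eq_sym c x) n1.
by have := max_card (mem [:: a; b; c; x; y; z]); rewrite (card_uniqP us) card_ord.
Qed.

Lemma extremal_five_ring : extremal five_ring.
Proof.
split; [exact: triple_system_five_ring|exact: acfree_five_ring|].
by rewrite card_five_ring card_ord.
Qed.
End RingBase.

(** * Recognising an extension *)

Lemma triple_at (V : finType) (F : {set {set V}}) e a : triple_system F -> e \in F -> a \in e ->
  exists x y, e = [set a; x; y] /\ trip F a x y.
Proof.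
move=> sF eF ae; suff [x [y ee]] : exists x y, e = [set a; x; y].
  by exists x, y; rewrite /trip -ee.
have [p [q [r [ee t _]]]] := tripleP sF eF.
move: ae; rewrite ee in_set3 => /or3P[] /eqP ->.
- by exists q, r.
- by exists p, r; rewrite set3CA.
- by exists p, q; rewrite set3AC set3CA.
Qed.

Section Embed.
Variables (V : finType) (F : {set {set V}}) (X : {set V}).
Notation U := {x : V | x \in X}.

(** The triples of an extension that contain no new vertex. *)
Lemma relabel_restrict_old k (h : U + 'I_k -> V) (G : {set {set U + 'I_k}}) :
  (forall u, h (inl u) = val u) -> relabel inl (restrict F X) \subset G ->
  forall e, e \in F -> e \subset X -> e \in relabel h G.
Proof.
move=> hu sub e eF eX; apply/imsetP; exists (inl @: (val @^-1: e : {set U})).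
  apply: (subsetP sub); apply: imset_f; rewrite inE.
  suff -> : val @: (val @^-1: e : {set U}) = e by [].
  apply/setP => z; apply/imsetP/idP => [[u + ->]|ze]; first by rewrite inE.
  by exists (exist _ z (subsetP eX z ze)); rewrite // inE.
rewrite -imset_comp; apply/setP => z; apply/idP/imsetP => [ze|[u + ->]].
  by exists (exist _ z (subsetP eX z ze)); rewrite ?inE //= hu.
by rewrite /= hu inE.
Qed.

Lemma relabel_restrict_in k (h : U + 'I_k -> V) e :
  (forall u, h (inl u) = val u) -> e \in relabel inl (restrict F X) -> h @: e \in F.
Proof.
move=> hu /imsetP[e' + ->]; rewrite inE -imset_comp => eF.
by rewrite (eq_imset _ (g := val)).
Qed.
End Embed.

Section Top2.
Variables (V : finType) (F : {set {set V}}).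
Hypothesis sF : triple_system F.
Hypothesis acT : acfree (trip F).
Variables a b : V.
Hypothesis ab : a != b.
Hypothesis top : forall v, v != a -> v != b -> trip F a b v.
Notation X := (~: [set a; b]).
Notation U := {x : V | x \in X}.

Let inX v : (v \in X) = (v != a) && (v != b).
Proof. by rewrite !inE negb_or. Qed.

Lemma top_touch x y : trip F a x y -> [|| x == b | y == b].
Proof.
move=> axy; apply: contraT; rewrite negb_or => /andP[xb yb].
have abx : trip F a b x by apply: top => //; neq.
have aby : trip F a b y by apply: top => //; neq.
by Cfree b x y a.
Qed.

Definition ext2_embed (p : U + 'I_2) : V :=
  match p with inl u => val u | inr i => if i == 0 :> nat then a else b end.

Lemma ext2_embed_inj : injective ext2_embed.
Proof.
have [na nb] : (forall u : U, val u != a) /\ (forall u : U, val u != b).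
  by split=> -[u uX] /=; have := uX; rewrite inX => /andP[].
move=> [u|i] [v|j] /=.
- by move/val_inj => ->.
- by case: ifP => _ /eqP; rewrite ?(negbTE (na u)) ?(negbTE (nb u)).
- by case: ifP => _ /esym /eqP; rewrite ?(negbTE (na v)) ?(negbTE (nb v)).
- case: ifP => i0; case: ifP => j0 e.
  + by congr inr; apply: val_inj; rewrite /= (eqP i0) (eqP j0).
  + by move: ab; rewrite e eqxx.
  + by move: ab; rewrite e eqxx.
  + congr inr; apply: val_inj; move: i0 j0.
    by case: i e => [[|[|i]]] //= _ _; case: j => [[|[|j]]].
Qed.

Lemma card_top2 : #|{: U}| + 2 = #|V|.
Proof. by rewrite card_restrict_type -(cardsC X) setCK cards2 ab. Qed.

(** If a triple contained just one of a and b, it would give C with two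
    triples on ab. *)
Lemma top_ext2 : isomorphic (ext2 (restrict F X)) F.
Proof.
exists ext2_embed; split.
  apply: inj_card_bij; first exact: ext2_embed_inj.
  by rewrite card_sum card_ord card_top2.
have n1 : ext2_embed (inr (vtx 1 1)) = a by rewrite /= inordK.
have n2 : ext2_embed (inr (vtx 1 2)) = b by rewrite /= inordK.
have old e := relabel_restrict_old (h := ext2_embed) (fun=> erefl) (subsetUl _ _) (e := e).
have pencil z : trip F a b z -> [set a; b; z] \in relabel ext2_embed (ext2 (restrict F X)).
  move=> t; have zX : z \in X by rewrite inX; apply/andP; split; neq.
  apply/imsetP; exists [set inr (vtx 1 1); inr (vtx 1 2); inl (exist _ z zX)].
    by apply/setUP; right; apply: imset_f.
  by rewrite imset_set3 n1 n2.
apply/eqP; rewrite eqEsubset; apply/andP; split; apply/subsetP => e.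
  move=> eF; have [ae|nae] := boolP (a \in e).
    have [x [y [ee t]]] := triple_at sF eF ae; subst e.
    case/orP: (top_touch t) => /eqP e; subst; first exact: pencil.
    by rewrite set3AC; apply: pencil; tsy.
  have [be|nbe] := boolP (b \in e).
    have [x [y [ee t]]] := triple_at sF eF be; subst e.
    have [xa ya] : x != a /\ y != a.
      by move: nae; rewrite in_set3 !negb_or !(eq_sym a) => /and3P[].
    have abx : trip F a b x by apply: top => //; neq.
    have aby : trip F a b y by apply: top => //; neq.
    by Cfree a x y b.
  apply: old => //; apply/subsetP => z ze; rewrite inX.
  by apply/andP; split; [apply: contraNneq nae|apply: contraNneq nbe] => <-.
case/imsetP => e' + ->; case/setUP => [|/imsetP[u _ ->]].
  by apply: relabel_restrict_in.
rewrite imset_set3 n1 n2 /=; have := valP u; rewrite inX => /andP[ua ub].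
exact: top.
Qed.
End Top2.

Section Top4.
Variables (V : finType) (T : V -> V -> V -> bool).
Hypothesis acT : acfree T.

(** The vertices b, a, c, d play the roles of the new vertices 1, 2, 3, 4 of a
    4-extension. *)
Definition chain_over (b a c d : V) :=
  [/\ b != d, T b a c, T a c d &
   forall v, v != b -> v != a -> v != c -> v != d -> T a b v /\ T c d v].

Lemma chain_over_sym b a c d : chain_over b a c d -> chain_over d c a b.
Proof.
case=> bd bac acd h; split; [by rewrite eq_sym|tsy|tsy|].
by move=> v v1 v2 v3 v4; have [] := h v v4 v3 v2 v1.
Qed.

(** Every other triple at a forms C with two of the triples that the chain
    provides. *)
Lemma chain_inner b a c d x y : chain_over b a c d -> T a x y ->
  [\/ x = b /\ y != d, y = b /\ x != d, x = c /\ y = d | x = d /\ y = c].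
Proof.
case=> bd bac acd old axy.
have nabd : ~~ T a b d by apply/negP => h; Cfree b c d a.
have oldv v : v != a -> v != b -> v != c -> v != d -> T a b v.
  by move=> va vb vc vd; have [] := old v vb va vc vd.
have nc v : v != b -> v != d -> ~~ T a c v.
  move=> vb vd; apply/negP => h.
  have va : v != a by neq.
  have vc : v != c by neq.
  by have abv := oldv v va vb vc vd; Cfree b c v a.
have nd v : v != c -> ~~ T a d v.
  move=> vc; apply/negP => h; have [e|vb] := eqVneq v b.
    by subst v; case/negP: nabd; tsy.
  have va : v != a by neq.
  have vd : v != d by neq.
  have [abv cdv] := old v vb va vc vd.
  by Cfree a c v d.
have ayx : T a y x by tsy.
have xy : x != y by neq.
have xa : x != a by neq.
have ya : y != a by neq.
have [e|xb] := eqVneq x b.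
  subst x; apply: Or41; split=> //; by apply: contraNneq nabd => <-.
have [e|yb] := eqVneq y b.
  subst y; apply: Or42; split=> //; by apply: contraNneq nabd => <-.
have [e|xc] := eqVneq x c.
  subst x; have [e|yd] := eqVneq y d; first exact: Or43.
  by have := nc y yb yd; rewrite axy.
have [e|yc] := eqVneq y c.
  subst y; have [e|xd] := eqVneq x d; first by apply: Or44.
  by have := nc x xb xd; rewrite ayx.
have [e|xd] := eqVneq x d; first by subst x; have := nd y yc; rewrite axy.
have [e|yd] := eqVneq y d; first by subst y; have := nd x xc; rewrite ayx.
have abx := oldv x xa xb xc xd; have aby := oldv y ya yb yc yd.
by Cfree b x y a.
Qed.

(** A triple on b and d would give A on the triangle a, b, d, with c as apex
    of ad and a further vertex outside the chain as apex of ab; all other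
    triples at b are excluded by C or by [chain_inner]. *)
Lemma chain_outer b a c d x y u v : chain_over b a c d -> T b x y ->
  u != v -> u \notin [:: b; a; c; d] -> v \notin [:: b; a; c; d] -> x = a \/ y = a.
Proof.
move=> ch bxy uv uO vO; have [e|xa] := eqVneq x a; first by left.
have [e|ya] := eqVneq y a; first by right.
case: (ch) => bd bac acd old.
have nc z : z != a -> ~~ T c b z.
  move=> za; apply/negP => h.
  have ca : c != a by neq.
  have ba : b != a by neq.
  case: (chain_inner (chain_over_sym ch) h) => [[e _]|[_ e]|[e _]|[_ e]].
  - by rewrite e eqxx in bd.
  - by rewrite eqxx in e.
  - by rewrite e eqxx in ba.
  - by rewrite e eqxx in za.
have other z : exists w, [/\ w != z, w != b, w != a, w != c & w != d].
  move: uO vO; rewrite !inE !negb_or => /and4P[u1 u2 u3 u4] /and4P[v1 v2 v3 v4].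
  by have [e|uz] := eqVneq u z; [exists v; rewrite -e eq_sym|exists u].
have no z : z != a -> z != c -> T b d z -> False.
  move=> za zc bdz; have [w [wz wb wa wc wd]] := other z.
  have [abw _] := old w wb wa wc wd.
  have adc : T a d c by tsy.
  have cb : c != b by neq.
  have cz : c != z by rewrite eq_sym.
  by Afree a b d w c z.
have byx : T b y x by tsy.
have xc : x != c by apply/eqP => e; subst x; have := nc y ya; rewrite (tripleCl acT) bxy.
have yc : y != c by apply/eqP => e; subst y; have := nc x xa; rewrite (tripleCl acT) byx.
have xd : x != d by apply/eqP => e; subst x; apply: (no y).
have yd : y != d by apply/eqP => e; subst y; apply: (no x).
have xb : x != b by neq.
have yb : y != b by neq.
have [abx _] := old x xb xa xc xd; have [aby _] := old y yb ya yc yd.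
by Cfree a x y b.
Qed.
End Top4.

Section Embed4.
Variables (V : finType) (F : {set {set V}}).
Hypothesis sF : triple_system F.
Hypothesis acT : acfree (trip F).
Variables b a c d : V.
Hypothesis ch : chain_over (trip F) b a c d.
Notation O := [set x in [:: b; a; c; d]].
Notation X := (~: O).
Notation U := {x : V | x \in X}.
Hypothesis many : 5 < #|V|.

Let inX v : (v \in X) = [&& v != b, v != a, v != c & v != d].
Proof. by rewrite !inE !negb_or. Qed.

Let uniq4 : uniq [:: b; a; c; d].
Proof.
case: ch => bd bac acd _; rewrite /= !inE !negb_or bd.
by (have -> : b != a by neq); (have -> : b != c by neq); (have -> : a != c by neq);
  (have -> : a != d by neq); (have -> : c != d by neq).
Qed.

Definition ext4_embed (p : U + 'I_4) : V :=
  match p with inl u => val u | inr i => nth a [:: b; a; c; d] i end.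

Lemma card_top4 : #|{: U}| + 4 = #|V|.
Proof.
have cO : #|O| = 4 by rewrite cardsE; exact: (card_uniqP uniq4).
by rewrite card_restrict_type -(cardsC X) setCK cO.
Qed.

Lemma ext4_embed_inj : injective ext4_embed.
Proof.
have out (u : U) (i : 'I_4) : val u != nth a [:: b; a; c; d] i.
  have := valP u; rewrite in_setC inE; apply: contraNneq => ->.
  by rewrite mem_nth.
move=> [u|i] [v|j] /=.
- by move/val_inj => ->.
- by move/eqP; rewrite (negbTE (out u j)).
- by move/esym/eqP; rewrite (negbTE (out v i)).
- by move/eqP; rewrite nth_uniq // => /eqP /val_inj ->.
Qed.

Lemma chain_ext4 : isomorphic (ext4 (restrict F X)) F.
Proof.
exists ext4_embed; split.
  apply: inj_card_bij; first exact: ext4_embed_inj.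
  by rewrite card_sum card_ord card_top4.
have n1 : ext4_embed (inr (vtx 3 1)) = b by rewrite /= inordK.
have n2 : ext4_embed (inr (vtx 3 2)) = a by rewrite /= inordK.
have n3 : ext4_embed (inr (vtx 3 3)) = c by rewrite /= inordK.
have n4 : ext4_embed (inr (vtx 3 4)) = d by rewrite /= inordK.
have sub : relabel inl (restrict F X) \subset ext4 (restrict F X).
  by apply/subsetP => e eF; rewrite !in_setU eF.
have old e := relabel_restrict_old (h := ext4_embed) (fun=> erefl) sub (e := e).
set G := relabel _ _.
have [u [v [uv uO vO]]] : exists u v, [/\ u != v, u \notin [:: b; a; c; d] & v \notin [:: b; a; c; d]].
  have : 1 < #|X| by rewrite -card_restrict_type; move: card_top4 many; clear; lia.
  by case/card_gt1P => u [v [uX vX uv]]; exists u, v; move: uX vX; rewrite !in_setC !inE.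
case: (ch) => bd bac acd _.
have g1 : [set b; a; c] \in G.
  apply/imsetP; exists [set inr (vtx 3 1); inr (vtx 3 2); inr (vtx 3 3)].
    by rewrite !inE eqxx !orbT.
  by rewrite imset_set3 n1 n2 n3.
have g2 : [set a; c; d] \in G.
  apply/imsetP; exists [set inr (vtx 3 2); inr (vtx 3 3); inr (vtx 3 4)].
    by rewrite !inE eqxx !orbT.
  by rewrite imset_set3 n2 n3 n4.
have p1 z : z \in X -> [set b; a; z] \in G.
  move=> zX; apply/imsetP; exists [set inr (vtx 3 1); inr (vtx 3 2); inl (exist _ z zX)].
    by apply/setUP; left; apply/setUP; left; apply/setUP; right; apply: imset_f.
  by rewrite imset_set3 n1 n2.
have p2 z : z \in X -> [set c; d; z] \in G.
  move=> zX; apply/imsetP; exists [set inr (vtx 3 3); inr (vtx 3 4); inl (exist _ z zX)].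
    by apply/setUP; left; apply/setUP; right; apply: imset_f.
  by rewrite imset_set3 n3 n4.
have ina z : trip F a b z -> z != d -> [set a; b; z] \in G.
  move=> t zd; rewrite set3CA; have [->//|zc] := eqVneq z c.
  apply: p1; rewrite inX zd zc.
  by (have -> : z != a by neq); (have -> : z != b by neq).
have inc z : trip F c d z -> z != b -> [set c; d; z] \in G.
  move=> t zb; have [->|za] := eqVneq z a; first by rewrite set3AC set3CA.
  apply: p2; rewrite inX zb za.
  by (have -> : z != c by neq); (have -> : z != d by neq).
have touch_a e : e \in F -> a \in e -> e \in G.
  move=> eF ae; have [x [y [ee t]]] := triple_at sF eF ae; subst e.
  have t' : trip F a y x by tsy.
  case: (chain_inner acT ch t) => -[e1 e2]; subst.
  - exact: ina.
  - by rewrite set3AC; apply: ina.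
  - exact: g2.
  - by rewrite set3AC.
have touch_c e : e \in F -> c \in e -> e \in G.
  move=> eF ce; have [x [y [ee t]]] := triple_at sF eF ce; subst e.
  have t' : trip F c y x by tsy.
  case: (chain_inner acT (chain_over_sym acT ch) t) => -[e1 e2]; subst.
  - exact: inc.
  - by rewrite set3AC; apply: inc.
  - by apply: touch_a => //; rewrite in_set3 eqxx orbT.
  - by apply: touch_a => //; rewrite in_set3 eqxx !orbT.
have rev w : w \in [:: b; a; c; d] -> w \in [:: d; c; a; b].
  by rewrite !inE => /or4P[] ->; rewrite ?orbT.
apply/eqP; rewrite eqEsubset; apply/andP; split; apply/subsetP => e.
  move=> eF; have [ae|nae] := boolP (a \in e); first exact: touch_a.
  have [ce|nce] := boolP (c \in e); first exact: touch_c.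
  have [be|nbe] := boolP (b \in e).
    have [x [y [ee t]]] := triple_at sF eF be; case/negP: nae; rewrite ee in_set3.
    by case: (chain_outer acT ch t uv uO vO) => ->; rewrite eqxx !orbT.
  have [de|nde] := boolP (d \in e).
    have [x [y [ee t]]] := triple_at sF eF de; case/negP: nce; rewrite ee in_set3.
    have uO' : u \notin [:: d; c; a; b] by apply: contra uO; rewrite !inE => /or4P[] ->; rewrite ?orbT.
    have vO' : v \notin [:: d; c; a; b] by apply: contra vO; rewrite !inE => /or4P[] ->; rewrite ?orbT.
    by case: (chain_outer acT (chain_over_sym acT ch) t uv uO' vO') => ->; rewrite eqxx !orbT.
  apply: old => //; apply/subsetP => z ze; rewrite inX; apply/and4P.
  by split; [apply: contraNneq nbe|apply: contraNneq nae|apply: contraNneq nce|apply: contraNneq nde] => <-.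
have oldT (w : U) : trip F a b (val w) /\ trip F c d (val w).
  have := valP w; rewrite inX => /and4P[w1 w2 w3 w4].
  by case: ch => _ _ _; apply.
case/imsetP => e' + ->; rewrite !in_setU => /orP[/orP[/orP[|]|]|].
- exact: relabel_restrict_in.
- case/imsetP => w _ ->; rewrite imset_set3 n1 n2 set3CA.
  by case: (oldT w).
- case/imsetP => w _ ->; rewrite imset_set3 n3 n4.
  by case: (oldT w).
- by rewrite !inE => /orP[] /eqP ->; rewrite imset_set3 ?n1 n2 n3 ?n4.
Qed.
End Embed4.

(** * Recognising a base system *)

Section Recognise.
Variables (V : finType) (F : {set {set V}}).
Hypothesis exF : extremal F.
Let sF : triple_system F. Proof. by case: exF. Qed.
Let acT : acfree (trip F). Proof. by case: exF. Qed.
Let cF : #|F| = fAC #|V|. Proof. by case: exF. Qed.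
Notation T := (trip F).
Implicit Types a b c v x z : V.

(** Both families have the extremal size, so that an inclusion is an equality.
    *)
Lemma isomorphic_bound (V0 : finType) (F0 : {set {set V0}}) (h : V0 -> V) :
  extremal F0 -> injective h -> #|V0| = #|V| -> (forall e, e \in F0 -> h @: e \in F) ->
  isomorphic F0 F.
Proof.
move=> [_ _ c0] hI cV sub; exists h; split; first by apply: inj_card_bij; rewrite ?cV.
apply/esym/eqP; rewrite eqEcard card_relabel // c0 cV cF leqnn andbT.
by apply/subsetP => _ /imsetP[e eF ->]; apply: sub.
Qed.

Lemma spanning_ring_isomorphic : spanning_ring T -> isomorphic five_ring F.
Proof.
case=> s0 [s1 [s2 [s3 [s4 [r full]]]]]; have cS := card_ring acT r.
rewrite full cardsT in cS.
pose s := [:: s0; s1; s2; s3; s4].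
have us : uniq s by apply/card_uniqP; have := card_ring acT r; rewrite cardsE.
apply: (@isomorphic_bound _ five_ring (fun i => nth s0 s i)).
- exact: extremal_five_ring.
- by move=> i j /eqP; rewrite nth_uniq // => /eqP /val_inj.
- by rewrite card_ord.
case: r => h1 h2 h3 h4 h5 e; rewrite !inE => h.
by case/orP: h => [/orP[/orP[/orP[]|]|]|] /eqP ->; rewrite imset_set3 /vtx /= !inordK.
Qed.

Lemma bipartite_isomorphic x (A B : {set V}) :
  x \notin A -> x \notin B -> [disjoint A & B] -> 
  #|A| = (#|V|.-1)./2 -> #|B| = uphalf #|V|.-1 -> ~~ odd #|V| ->
  (forall a b, a \in A -> b \in B -> T x a b) -> isomorphic (Fstar #|V|) F.
Proof.
move=> xA xB dis cA cB eV all.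
have V0 : 0 < #|V| by apply/card_gt0P; exists x.
pose h (p : option ('I_(#|V|.-1)./2 + 'I_(uphalf #|V|.-1))) : V :=
  match p with None => x | Some (inl i) => enum_val (cast_ord (esym cA) i)
  | Some (inr i) => enum_val (cast_ord (esym cB) i) end.
have hA i : h (Some (inl i)) \in A by apply: enum_valP.
have hB i : h (Some (inr i)) \in B by apply: enum_valP.
have disE v : v \in A -> v \in B -> False.
  by move=> vA vB; move/disjoint_setI0/setP: dis => /(_ v); rewrite !inE vA vB.
apply: (@isomorphic_bound _ _ h).
- by apply: extremal_star; rewrite ?eV.
- move=> [[i|i]|] [[j|j]|] e //.
  + by move/enum_val_inj/cast_ord_inj: e => ->.
  + by case: (disE (h (Some (inl i)))) => //; rewrite e.
  + by have := hA i; rewrite e (negbTE xA).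
  + by case: (disE (h (Some (inr i)))) => //; rewrite e.
  + by move/enum_val_inj/cast_ord_inj: e => ->.
  + by have := hB i; rewrite e (negbTE xB).
  + by have := hA j; rewrite -e (negbTE xA).
  + by have := hB j; rewrite -e (negbTE xB).
- exact: card_star_type.
- by move=> _ /imset2P[i j _ _ ->]; rewrite imset_set3; apply: all.
Qed.

(** Mantel's theorem with equality in the link of x. The neighbourhood B of a
    vertex v of maximum degree is independent, so every edge has an end in its
    complement A, and there are at most #|A| * #|B| edges. Equality makes the
    degrees in A equal to #|B| and leaves no edge inside A. *)
Lemma star_isomorphic x : star_at T x -> ~~ odd #|V| -> isomorphic (Fstar #|V|) F.
Proof.
move=> star eV; pose deg b := #|apexes T x b|.
have xxc c : T x x c = false by apply: (tripleI acT).
have degE b : \sum_c T x b c = deg b by apply: sum_apexes.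
have tot : \sum_b deg b = 2 * fAC #|V|.
  have pt a b c : nat_of_bool (T a b c) = (a == x) * T x b c + (b == x) * T x a c + (c == x) * T x a b.
    have -> : (a == x) * T x b c = (a == x) * T a b c by case: eqP => [->|].
    have -> : (b == x) * T x a c = (b == x) * T a b c.
      by case: eqP => [->|//]; rewrite (tripleCl acT a).
    have -> : (c == x) * T x a b = (c == x) * T a b c.
      by case: eqP => [->|//]; rewrite (tripleCr acT a) (tripleCl acT a).
    case abc: (T a b c); rewrite ?muln0 //.
    have [ab ac bc] := triple_ne acT abc.
    have := star a b c abc; rewrite !(eq_sym x).
    have [e|_] := eqVneq a x; first by subst a; rewrite !(eq_sym _ x) (negbTE ab) (negbTE ac).
    have [e|_] := eqVneq b x; first by subst b; rewrite (eq_sym c) (negbTE bc).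
    by move=> /= ->.
  have pick1 (G : V -> V -> nat) : \sum_a \sum_b \sum_c (a == x) * G b c = \sum_b \sum_c G b c.
    rewrite (bigD1 x) //= eqxx [X in _ + X]big1 ?addn0.
      by do 2!(apply: eq_bigr => ? _); rewrite mul1n.
    by move=> a /negbTE ->; do 2!(apply: big1 => ? _); rewrite mul0n.
  have e2 : \sum_a \sum_b \sum_c (b == x) * T x a c = \sum_b \sum_c T x b c.
    by rewrite exchange_big; apply: (pick1 (fun a c => nat_of_bool (T x a c))).
  have e3 : \sum_a \sum_b \sum_c (c == x) * T x a b = \sum_b \sum_c T x b c.
    under eq_bigr do rewrite exchange_big /=.
    by rewrite exchange_big; apply: (pick1 (fun a b => nat_of_bool (T x a b))).
  have := ntriples_trip sF; rewrite cF /ntriples.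
  under eq_bigr do under eq_bigr do under eq_bigr do rewrite pt.
  under eq_bigr do under eq_bigr do rewrite !big_split /=.
  under eq_bigr do rewrite !big_split /=.
  rewrite !big_split /= e2 e3 (pick1 (fun b c => nat_of_bool (T x b c))).
  under eq_bigr do rewrite degE.
  by clear; lia.
have V0 : 0 < #|V| by apply/card_gt0P; exists x.
case: (arg_maxnP (P := predT) deg (i0 := x)) => // v _ vmax.
pose B := apexes T x v; pose A := ~: B :\ x.
have xB : x \notin B by rewrite inE; apply/negP => h; irr.
have xA : x \notin A by rewrite !inE eqxx.
have inA z : (z \in A) = (z != x) && (z \notin B) by rewrite in_setD1 in_setC.
have cAB : #|A| + #|B| = #|V|.-1.
  have := cardsD1 x (~: B); have := cardsC B; rewrite in_setC xB -/A.
  by move: V0; clear; lia.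
have Bind b c : b \in B -> T x b c -> c \in A.
  move=> bB xbc; rewrite inA; have -> : c != x by neq.
  apply/negP => cB; rewrite !inE in bB cB.
  by Cfree v b c x.
have sAB : \sum_b deg b = \sum_(a in A) deg a + \sum_(c in A) \sum_(b in B) T x c b.
  rewrite (bigID (mem B)) /= addnC; congr (_ + _).
    rewrite (bigD1 x) //= (_ : deg x = 0) ?add0n; last first.
      by rewrite -degE big1 // => c _; rewrite xxc.
    by apply: eq_bigl => z; rewrite inA andbC.
  rewrite [RHS]exchange_big /=; apply: eq_bigr => b bB; rewrite -degE.
  rewrite [LHS](bigID (mem A)) /= [X in _ + X]big1 ?addn0.
    by apply: eq_bigr => c _; rewrite (tripleCr acT).
  by move=> c cA; apply/eqP; rewrite eqb0; apply: contra cA; apply: Bind.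
have leA : \sum_(a in A) deg a <= #|A| * #|B|.
  by rewrite -sum_nat_const; apply: leq_sum => a _; apply: vmax.
have leC : \sum_(c in A) \sum_(b in B) T x c b <= \sum_(a in A) deg a.
  apply: leq_sum => a _; rewrite -degE [X in _ <= X](bigID (mem B)) /=; exact: leq_addr.
have [k ek] : exists k, #|V| = k.*2.+2.
  exists (#|V|./2.-1); have := odd_double_half #|V|; rewrite (negbTE eV) add0n.
  by move: V0; case: #|V|./2 => [|k] /=; lia.
have fk : fAC #|V| = k.+1 * k by rewrite ek -doubleS fAC_even.
rewrite ek /= in cAB.
have prod : #|A| * #|B| = k.+1 * k /\ (#|A| = k /\ #|B| = k.+1 \/ #|A| = k.+1 /\ #|B| = k).
  move: cAB leA leC sAB; rewrite tot fk.
  move: (\sum_(a in A) deg a) (\sum_(c in A) _) #|A| #|B| => s t p q; rewrite -muln2.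
  move=> pq le1 le2 e; have le : k.+1 * k <= p * q by move: e le1 le2; clear; lia.
  have [d|d] := leqP p k.
    have [r er] : exists r, p + r = k by exists (k - p); move: d; clear; lia.
    have r0 : r = 0 by move: le pq; rewrite -er; clear; nia.
    by subst r; move: pq er; clear => pq er; split; [nia|left; lia].
  have [r er] : exists r, k.+1 + r = p by exists (p - k.+1); move: d; clear; lia.
  have r0 : r = 0 by move: le pq; rewrite -er; clear; nia.
  by subst r; move: pq er; clear => pq er; split; [nia|right; lia].
case: prod => prod sizes.
have geC : \sum_(c in A) \sum_(b in B) 1 <= \sum_(c in A) \sum_(b in B) T x c b.
  rewrite !sum_nat_const muln1 prod; move: leA leC sAB; rewrite tot fk prod.
  by move: (\sum_(a in A) deg a) (\sum_(c in A) _) => s t; clear; lia.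
have full a b : a \in A -> b \in B -> T x a b.
  have le i j : i \in A -> j \in B -> T x i j <= 1 by rewrite leq_b1.
  by move=> aA bB; have := sum2_tight le geC aA bB; case: (T x a b).
have dis : [disjoint A & B] by rewrite disjoints_subset; apply/subsetP => z; rewrite inA in_setC => /andP[].
case: sizes => -[cA cB].
  apply: (@bipartite_isomorphic x A B) => //; rewrite ek /=.
    by rewrite uphalf_double.
  by rewrite doubleK.
apply: (@bipartite_isomorphic x B A) => //; rewrite ?ek //=.
- by rewrite disjoint_sym.
- by rewrite uphalf_double.
- by rewrite doubleK.
- by move=> a b aB bA; have := full b a bA aB => h; tsy.
Qed.
End Recognise.

(** * The inductive step *)

(** The class of the theorem in terms of the order m of the initial system,
    which suits induction. *)
Definition reachable (V : finType) (F : {set {set V}}) :=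
  if odd #|V| then obtained_from five_ring F
  else exists m, [/\ ~~ odd m, 2 <= m <= #|V| & obtained_from (Fstar m) F].

Lemma reachable_step (V W : finType) (F : {set {set V}}) (G : {set {set W}}) :
  odd #|W| = odd #|V| -> #|V| <= #|W| ->
  (forall (V0 : finType) (F0 : {set {set V0}}), obtained_from F0 F -> obtained_from F0 G) ->
  reachable F -> reachable G.
Proof.
rewrite /reachable => -> VW step; case: (odd #|V|); first exact: step.
move=> [m [em /andP[m2 mV] ob]]; exists m; split=> //; last exact: step.
by rewrite m2 (leq_trans mV).
Qed.

Lemma isomorphic_extremal_ext2 (V W : finType) (F : {set {set V}}) (G : {set {set W}}) :
  triple_system F -> acfree (trip F) -> isomorphic (ext2 F) G -> #|G| = fAC #|W| ->
  #|V| != 1 -> #|V| != 3 -> extremal F.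
Proof.
move=> sF acF iso cG V1 V3; split=> //.
have [_ _ e1 e2] := isomorphic_trip iso (triple_system_ext2 sF) (acfree_ext2 sF acF).
move: cG; rewrite e1 e2 card_ext2 // card_sum card_ord fAC_ext2 //.
exact: addIn.
Qed.

Lemma isomorphic_extremal_ext4 (V W : finType) (F : {set {set V}}) (G : {set {set W}}) :
  triple_system F -> acfree (trip F) -> isomorphic (ext4 F) G -> #|G| = fAC #|W| ->
  #|V| != 1 -> #|V| != 3 -> extremal F.
Proof.
move=> sF acF iso cG V1 V3; split=> //.
have [_ _ e1 e2] := isomorphic_trip iso (triple_system_ext4 sF) (acfree_ext4 sF acF).
move: cG; rewrite e1 e2 card_ext4 // card_sum card_ord fAC_ext4 //.
by move=> /addIn /addIn.
Qed.

Lemma small_reachable (V : finType) (F : {set {set V}}) : extremal F -> #|V| = 2 -> reachable F.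
Proof.
move=> ex V2; rewrite /reachable V2; exists 2; split=> //; apply: obtained_start.
have : 1 < #|V| by rewrite V2.
rewrite -cardsT => /card_gt1P[x [y [_ _ xy]]]; rewrite -V2.
apply: (@bipartite_isomorphic _ _ ex x set0 [set y]); rewrite ?V2 ?cards0 ?cards1 ?inE //.
  by rewrite -setI_eq0 set0I.
by move=> a b; rewrite in_set0.
Qed.

Section Step.
Variables (V : finType) (F : {set {set V}}).
Hypothesis sF : triple_system F.
Hypothesis acF : acfree (trip F).
Hypothesis smaller : forall (U : finType) (G : {set {set U}}), #|U| < #|V| ->
  triple_system G -> acfree (trip G) ->
  #|G| <= fAC #|U| /\ (1 < #|U| -> #|U| != 3 -> #|G| = fAC #|U| -> reachable G).

Lemma inside_bound (X : {set V}) : X \proper [set: V] -> inside (trip F) X <= 6 * fAC #|X|.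
Proof.
move=> pX; have sR := triple_system_restrict X sF.
rewrite inside_restrict ntriples_trip // leq_mul2l /=.
have cU := card_restrict_type X; rewrite -cU.
have lt : #|{: {x : V | x \in X}}| < #|V| by rewrite cU -cardsT proper_card.
by have [] := smaller lt sR (acfree_restrict X sF acF).
Qed.

(** On five vertices the removal of the pair would leave order 3, at which
    [fAC_ext2] fails. *)
Lemma pair_step a b : a != b -> (forall v, v != a -> v != b -> trip F a b v) ->
  3 < #|V| -> #|V| != 5 -> #|F| = fAC #|V| -> reachable F.
Proof.
move=> ab top V3 V5 cF; have iso := top_ext2 sF acF ab top; move: iso.
have := card_top2 ab; set X := ~: _ => cU iso.
set G := restrict F X in iso; have sG : triple_system G := triple_system_restrict X sF.
have acG : acfree (trip G) := acfree_restrict X sF acF.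
have ltU : #|{: {x : V | x \in X}}| < #|V| by rewrite -cU addn2.
have [U1 U3] : 1 < #|{: {x : V | x \in X}}| /\ #|{: {x : V | x \in X}}| != 3.
  by move: V3 V5; rewrite -cU addn2 !ltnS.
have U1' : #|{: {x : V | x \in X}}| != 1 by rewrite gtn_eqF.
have [_ _ cG] := isomorphic_extremal_ext2 sG acG iso cF U1' U3.
have [_ /(_ U1 U3 cG)] := smaller ltU sG acG.
apply: reachable_step; first by rewrite -cU oddD addbF.
  exact: ltnW.
by move=> V0 F0 ob; apply: obtained_ext2 ob iso.
Qed.

Lemma chain_step b a c d : chain_over (trip F) b a c d ->
  5 < #|V| -> #|V| != 7 -> #|F| = fAC #|V| -> reachable F.
Proof.
move=> ch V5 V7 cF; have iso := chain_ext4 sF acF ch V5; move: iso.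
have := card_top4 acF ch; set X := ~: _ => cU iso.
set G := restrict F X in iso; have sG : triple_system G := triple_system_restrict X sF.
have acG : acfree (trip G) := acfree_restrict X sF acF.
have ltU : #|{: {x : V | x \in X}}| < #|V| by rewrite -cU -addn1 leq_add2l.
have [U1 U3] : 1 < #|{: {x : V | x \in X}}| /\ #|{: {x : V | x \in X}}| != 3.
  by move: V5 V7; rewrite -cU addn4 !ltnS.
have U1' : #|{: {x : V | x \in X}}| != 1 by rewrite gtn_eqF.
have [_ _ cG] := isomorphic_extremal_ext4 sG acG iso cF U1' U3.
have [_ /(_ U1 U3 cG)] := smaller ltU sG acG.
apply: reachable_step; first by rewrite -cU oddD addbF.
  exact: ltnW.
by move=> V0 F0 ob; apply: obtained_ext4 ob iso.
Qed.

Lemma extremal_step : #|F| <= fAC #|V| /\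
  (1 < #|V| -> #|V| != 3 -> #|F| = fAC #|V| -> reachable F).
Proof.
have := extremal_structure acF inside_bound; rewrite ntriples_trip // => -[le struct].
split; first by rewrite leq_mul2l in le.
move=> V1 V3 cF; have ex : extremal F by split.
have [V4|] := ltnP 3 #|V|; last first.
  by move=> V4; apply: small_reachable => //; move: V1 V3 V4; move: #|V| => [|[|[|[|n]]]].
have : 6 * fAC #|V| <= 6 * #|F| by rewrite cF.
case/(struct V4) => [[K [k [[Kn tp dom] big]]]|[eV [x star]]|ring].
- have small2 a : a \in K -> #|V| != 5.
    move=> aK; apply/eqP => e; have := big; rewrite e => /(_ isT).
    by have := cards_eq0 K; rewrite (negbTE Kn); move: #|K| => n; clear; lia.
  case: (top_block acF tp dom Kn) => [[a aK top]|[a [c [aK cK ca cka [h1 h2 h3]]]]].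
    apply: (pair_step (a := a) (b := k a)) => //; last exact: small2 aK.
    by rewrite eq_sym (pair_neq acF tp aK).
  have [ac akc kca kcka kac] := k_neq tp aK cK ca cka.
  have [V5|V5] := ltnP 5 #|V|.
    apply: (chain_step (b := k a) (a := a) (c := c) (d := k c)) => //.
      split=> //; first by rewrite eq_sym.
      by move=> v v1 v2 v3 v4; apply: h3.
    apply/eqP => e; have := big; rewrite e => /(_ isT).
    have : 2 < #|K|.
      have c3 : #|[set a; k a; c]| == 3.
        by rewrite card_set3 ac kac eq_sym (pair_neq acF tp aK).
      rewrite -(eqP c3); apply: subset_leq_card; apply/subsetP => z.
      by rewrite in_set3 => /or3P[] /eqP -> //; apply: (pairs_stable tp).
    by clear; lia.
  (* on four vertices the chain consists of the two triples on the pair a, c *)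
  have V4' : #|V| = 4 by have := small2 a aK; move: V4 V5; clear; lia.
  apply: (pair_step (a := a) (b := c)) => //; last by rewrite V4'.
  move=> v va vc; have [->|vka] := eqVneq v (k a); first by tsy.
  have [->//|vkc] := eqVneq v (k c).
  have u5 : uniq [:: v; a; k a; c; k c].
    rewrite /= !inE !negb_or va vka vc vkc ac akc kac.
    rewrite (eq_sym a) (pair_neq acF tp aK) (eq_sym (k a)) kcka.
    by rewrite (eq_sym c) (pair_neq acF tp cK).
  by have := max_card (mem [:: v; a; k a; c; k c]); rewrite (card_uniqP u5) V4'.
- rewrite /reachable (negbTE eV); exists #|V|; rewrite leqnn V1; split=> //.
  by apply: obtained_start; apply: (star_isomorphic ex star).
- have iso := spanning_ring_isomorphic ex ring.
  have : #|V| = 5 by case: iso => h [hb _]; rewrite -(bij_eq_card hb) card_ord.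
  by rewrite /reachable => ->; apply: obtained_start.
Qed.
End Step.

(** * The theorem *)

Lemma acfree_bound (V : finType) (F : {set {set V}}) : triple_system F -> acfree (trip F) ->
  #|F| <= fAC #|V| /\ (1 < #|V| -> #|V| != 3 -> #|F| = fAC #|V| -> reachable F).
Proof.
have [k] := ubnP #|V|; elim: k V F => // k IH V F; rewrite ltnS => Vk sF acF.
apply: (extremal_step sF acF) => U G UV; apply: IH; exact: leq_trans UV Vk.
Qed.

Lemma reachable_extremal (V : finType) (F : {set {set V}}) : reachable F -> extremal F.
Proof.
rewrite /reachable; case: (odd #|V|) => [ob|[m [em /andP[m2 _] ob]]].
  by have [] := obtained_extremal ob _ _ extremal_five_ring; rewrite ?card_ord.
have cm : #|{: option ('I_(m.-1)./2 + 'I_(uphalf m.-1))}| = m.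
  by apply: card_star_type; apply: ltnW.
have [] // := obtained_extremal ob; rewrite ?cm.
- by rewrite gtn_eqF.
- by apply: contraNneq em => ->.
- by apply: extremal_star; rewrite ?em // ltnW.
Qed.

Lemma obtained_ge (V0 V : finType) (F0 : {set {set V0}}) (F : {set {set V}}) :
  obtained_from F0 F -> #|V0| <= #|V|.
Proof.
elim=> {V F} [V F|V W F G _ le|V W F G _ le] [h [hb _]]; rewrite -(bij_eq_card hb) //;
  by rewrite card_sum; apply: leq_trans le (leq_addr _ _).
Qed.

Lemma Fclass_reachable (V : finType) (F : {set {set V}}) : 4 <= #|V| ->
  Fclass #|V| F <-> reachable F.
Proof.
move=> V4; rewrite /Fclass /reachable; case oV: (odd #|V|).
  split=> [[_ []]|ob] //; split=> //; split=> //.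
  by have := obtained_ge ob; rewrite card_ord.
have e := odd_double_half #|V|; rewrite oV add0n in e.
split=> [[_ [_ [k kle ob]]]|[m [em /andP[m2 mV] ob]]].
  exists (#|V| - 2 * k); split=> //.
    by rewrite oddB ?oV ?mul2n ?odd_double //; move: kle V4; rewrite -e; lia.
  by rewrite leq_subr andbT; move: kle V4; clear; lia.
split=> //; split; first by apply: ltnW; apply: ltnW.
exists ((#|V| - m) %/ 2); first by rewrite leq_div2r // leq_sub2l.
have -> : #|V| - 2 * ((#|V| - m) %/ 2) = m; last by [].
rewrite mulnC divnK; first by rewrite subKn.
by rewrite dvdn2 oddB // oV (negbTE em).
Qed.

(** For odd n from 5 on, the systems are 2-extensions of the five-ring. *)
Lemma extremal_exists n : 0 < n -> exists (V : finType) (F : {set {set V}}), #|V| = n /\ extremal F.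
Proof.
move=> n0; have [h|] := boolP [|| ~~ odd n, n == 1 | n == 3].
  exists (option ('I_(n.-1)./2 + 'I_(uphalf n.-1)) : finType), (Fstar n).
  by split; [apply: card_star_type|apply: extremal_star].
rewrite !negb_or negbK => /and3P[on n1 n3].
have en : n = 5 + 2 * (n - 5)./2.
  have := odd_double_half n; rewrite on; move: n1 n3; clear.
  by case: n => [|[|[|[|[|n]]]]] //= _ _; lia.
rewrite en; elim: (_./2) => [|j [V [F [cV ex]]]].
  by exists 'I_5, five_ring; split; [rewrite card_ord|exact: extremal_five_ring].
exists (V + 'I_2 : finType)%type, (ext2 F); split.
  by rewrite card_sum card_ord cV mulnS addnA addnAC.
by apply: extremal_ext2 ex; rewrite cV.
Qed.

Lemma extremal_transport (V W : finType) (F : {set {set V}}) : #|V| = #|W| -> extremal F ->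
  exists G : {set {set W}}, extremal G.
Proof.
move=> VW ex; pose h v : W := enum_val (cast_ord VW (enum_rank v)).
have hI : injective h by move=> u v /enum_val_inj/cast_ord_inj/enum_rank_inj.
exists (relabel h F); apply: isomorphic_extremal ex; exists h; split=> //.
by apply: inj_card_bij; rewrite ?VW.
Qed.

Theorem theorem13 (n : nat) (n_gt0 : 0 < n) :
  exnum n [:: confA; confC] = fAC n /\
  (4 <= n ->
   forall (V : finType) (F : {set {set V}}), #|V| = n ->
     ([/\ triple_system F, avoids F [:: confA; confC] & #|F| = fAC n]
      <-> Fclass n F)).
Proof.
split.
  apply/eqP; rewrite eqn_leq; apply/andP; split.
    apply/bigmax_leqP => F /andP[sF aF].
    by have [] := acfree_bound sF ((avoids_acfree sF).1 aF); rewrite card_ord.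
  have [V [F [cV ex]]] := extremal_exists n_gt0.
  have [G [sG acG cG]] : exists G : {set {set 'I_n}}, extremal G.
    by apply: extremal_transport ex; rewrite card_ord.
  rewrite card_ord in cG; rewrite -cG /exnum.
  by apply: (leq_bigmax_cond (F := fun F : {set {set 'I_n}} => #|F|)); rewrite sG; apply/(avoids_acfree sG).
move=> n4 V F cV; subst n; rewrite (Fclass_reachable F n4).
split=> [[sF aF cF]|/reachable_extremal[sF acF cF]].
  have acF := (avoids_acfree sF).1 aF.
  have [_ h] := acfree_bound sF acF; apply: h => //; first by apply: ltnW; apply: ltnW.
  by rewrite gtn_eqF.
by split=> //; apply/(avoids_acfree sF).
Qed.
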